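(* Let $m\geq 0$ and $n\geq 0$ be integers and let $M=[0,1]\times\mathbb{T}^n$. There is a constant $C=C(n,m)$, depending only on $n$ and $m$, such that for every $f\in L^2(M;\mathcal{P}_m^{n+1})$ (that is, every $L^2$-regular symmetric tensor field of order $m$ on $M$) the following are equivalent: 1. The X-ray transform of $f$ vanishes: $I^m f=0$. 2. There are $h\in L^2([0,1];\mathcal{P}_m^{n+1})$ and $g\in H^1_0(M;\mathcal{P}_{m-1}^{n+1})$ such that $\int_0^1 h(x;v,w)\,\mathrm{d}x=0$ for all $(v,w)\in\mathbb{R}^{n+1}$ and $f=\pi^*h+\mathrm{d}g$, where $\pi\colon M\to[0,1]$ is the projection to the first component; and in addition $$\|h\|_{L^2([0,1];\mathcal{P}_m^{n+1})}+\|g\|_{H^1_0(M;\mathcal{P}_{m-1}^{n+1})}\leq C\|f\|_{L^2(M;\mathcal{P}_m^{n+1})}.$$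
   Context: $\mathbb{T}^n=\mathbb{R}^n/\mathbb{Z}^n$ is the flat torus, and $M=[0,1]\times\mathbb{T}^n$ carries the Euclidean product metric. Points of $M$ are written $(x,y)\in[0,1]\times\mathbb{T}^n$. $\mathcal{P}_m^{n+1}$ is the (finite-dimensional) space of complex-valued homogeneous polynomials of order $m$ on $\mathbb{R}^{n+1}=\mathbb{R}\times\mathbb{R}^n\ni(v,w)$, normed via restriction to the unit sphere $S^n$ and the norm of $L^2(S^n)$; $\mathcal{P}_0^{n+1}=\mathbb{C}$ and by convention $\mathcal{P}_{-1}^{n+1}=0$. A symmetric covariant tensor field of order $m$ on $M$ is identified with a function $f\colon M\to\mathcal{P}_m^{n+1}$, written $f(x,y;v,w)$. Regularity of a tensor field means regularity of the polynomial coefficients as functions on $M$, with the corresponding norms. $H^1_0(M;\mathcal{P}_{m-1}^{n+1})$ is the usual space of $H^1$ tensor fields on $M$ with zero trace on $\partial M=\{0,1\}\times\mathbb{T}^n$. The symmetrized covariant derivative of $g$ is $(\mathrm{d}g)(x,y;v,w)=(v\partial_x+w\cdot\nabla_y)g(x,y;v,w)$ (weak derivatives). The pullback is $(\pi^*h)(x,y;v,w)=h(x;v,w)$. X-ray transform: for $a\in\mathbb{T}^n$, $b\in\mathbb{R}^n$, $$I^mf(a,b)=\int_0^1 f(t,a+bt;1,b)\,\mathrm{d}t.$$ For $f\in L^2$ this is defined for every $b\in\mathbb{R}^n$ and almost every $a\in\mathbb{T}^n$; equivalently, for every $b\in\mathbb{R}^n$ and $\psi\in C^\infty(\mathbb{T}^n)$,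 $\langle I^mf(\cdot,b),\psi\rangle_{\mathbb{T}^n}=\int_M f(x,y;1,b)\,\psi(y-bx)\,\mathrm{d}x\,\mathrm{d}y$ (bilinear pairing). $I^mf=0$ means that for every $b\in\mathbb{R}^n$, $I^mf(a,b)=0$ for almost every $a$ (equivalently, all these pairings vanish). *)

(* Defs.v *)
From HB Require Import structures.
From mathcomp Require Import all_boot all_order all_algebra.
From mathcomp Require Import complex.
(* The notations of mpoly clash with those of mathcomp-analysis. *)
From mathcomp Require Import -(notations) mpoly.
From mathcomp Require Import all_classical all_reals all_analysis.
From mathcomp Require Import measurable_realfun.
Set Implicit Arguments.
Unset Strict Implicit.
Unset Printing Implicit Defensive.
Import Order.TTheory GRing.Theory Num.Theory.
Import numFieldNormedType.Exports.

Local Open Scope classical_set_scope.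
Local Open Scope ring_scope.

Fact rV_display : measure_display. Proof. exact: default_measure_display. Qed.

Section rV_measurable.
Context (R : realType) (n : nat).

(* The product (Borel) sigma-algebra on R^n. *)
Definition rV_measurable : set (set 'rV[R]_n) :=
  g_sigma_preimage (fun (i : 'I_n) (u : 'rV[R]_n) => u 0 i).

Let rV_set0 : rV_measurable set0.
Proof. exact: sigma_algebra0. Qed.

Let rV_setC A : rV_measurable A -> rV_measurable (~` A).
Proof. exact: sigma_algebraC. Qed.

Let rV_bigcup (F : (set 'rV[R]_n)^nat) :
  (forall i, rV_measurable (F i)) -> rV_measurable (\bigcup_i F i).
Proof. exact: sigma_algebra_bigcup. Qed.

HB.instance Definition _ := @isMeasurable.Build rV_display
  'rV[R]_n rV_measurable rV_set0 rV_setC rV_bigcup.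

End rV_measurable.

Lemma measurable_coord (R : realType) n (i : 'I_n) :
  measurable_fun [set: 'rV[R]_n] (fun u : 'rV[R]_n => u 0 i).
Proof.
move=> _ Y mY; rewrite setTI; apply: sub_sigma_algebra => /=.
rewrite -bigcup_seq/=; exists i => /=; first by rewrite mem_index_enum.
by exists Y => //; rewrite setTI.
Qed.

Lemma measurable_fun_rV d (T : measurableType d) (R : realType) n
    (f : T -> 'rV[R]_n) :
  (forall i, measurable_fun [set: T] (fun x => f x 0 i)) ->
  measurable_fun [set: T] f.
Proof.
move=> mf.
suff H : g_sigma_preimage (fun i x => f x 0 i) `<=` (@measurable d T).
  move=> _ A mA; rewrite setTI; apply: H.
  have := g_sigma_preimage_comp (fun (i : 'I_n) (u : 'rV[R]_n) => u 0 i) f.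
  by rewrite /comp => ->; exists A => //; rewrite setTI.
apply: smallest_sub; first exact: sigma_algebra_measurable.
case: n => [|n] in f mf *; first by rewrite big_ord0.
rewrite -bigcup_mkord_ord; apply: bigcup_sub => i Ii.
by move=> A [B mB <-]; exact: mf.
Qed.

Section lebesgue_rV.
Context (R : realType).

(* The identification of R x R^n with R^(n+1), (v, w) |-> (v, w_1, ..., w_n). *)
Definition cons_rV n (p : R * 'rV[R]_n) : 'rV[R]_n.+1 :=
  row_mx (p.1%:M : 'rV_1) p.2.

Lemma cons_rV0 n (p : R * 'rV[R]_n) : cons_rV p 0 0 = p.1.
Proof.
rewrite /cons_rV mxE; case: splitP => // j _.
by rewrite ord1 mxE eqxx mulr1n.
Qed.

Lemma cons_rVS n (p : R * 'rV[R]_n) j : cons_rV p 0 (lift 0 j) = p.2 0 j.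
Proof.
rewrite /cons_rV mxE; case: splitP => k; first by rewrite ord1.
by rewrite lift0 => -[/val_inj ->].
Qed.

Lemma measurable_cons_rV n : measurable_fun [set: measurableTypeR R * 'rV[R]_n] (@cons_rV n).
Proof.
apply: measurable_fun_rV => i.
have [->|[j ->]] : i = 0 \/ exists j, i = lift 0 j.
  by case: (unliftP 0 i) => [j ->|->]; [right; exists j|left].
  under eq_fun do rewrite cons_rV0; exact: measurable_fst.
under eq_fun do rewrite cons_rVS.
exact: (measurableT_comp (@measurable_coord R n j)).
Qed.

Definition uncons_rV n (u : 'rV[R]_n.+1) : R * 'rV[R]_n :=
  (u 0 0, \row_j u 0 (lift 0 j)).

Lemma cons_rVK n : cancel (@cons_rV n) (@uncons_rV n).
Proof.
move=> [x y]; rewrite /uncons_rV cons_rV0; congr (_, _).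
by apply/rowP => j; rewrite mxE cons_rVS.
Qed.

Lemma measurable_uncons_rV n :
  measurable_fun [set: 'rV[R]_n.+1] (@uncons_rV n).
Proof.
apply/measurable_fun_pairP; split; first exact: measurable_coord.
apply: measurable_fun_rV => i /=.
by under eq_fun do rewrite mxE; exact: measurable_coord.
Qed.

(* Lebesgue measure on R^(n+1), as the image of the product of Lebesgue measure
   on R and a measure m on R^n; see lebesgue_rV. *)
Definition lebesgue_rV_succ n (m : {sigma_finite_measure set 'rV[R]_n -> \bar R})
  : set 'rV[R]_n.+1 -> \bar R :=
  pushforward (lebesgue_measure \x m)%E (@cons_rV n).


Section succ.
Context n (m : {sigma_finite_measure set 'rV[R]_n -> \bar R}).

Let leb_m : {measure set (measurableTypeR R * 'rV[R]_n)%type -> \bar R} :=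
  (lebesgue_measure \x m)%E.

Let push := measure_function_pushforward__canonical__measure_function_Measure
  leb_m (@measurable_cons_rV n).

Let succ0 : lebesgue_rV_succ m set0 = 0%E.
Proof. exact: (measure0 push). Qed.

Let succ_ge0 A : (0 <= lebesgue_rV_succ m A)%E.
Proof. exact: (measure_ge0 push). Qed.

Let succ_sigma_additive : semi_sigma_additive (lebesgue_rV_succ m).
Proof. exact: (@measure_semi_sigma_additive _ _ _ push). Qed.

HB.instance Definition _ := isMeasure.Build _ _ _ (lebesgue_rV_succ m)
  succ0 succ_ge0 succ_sigma_additive.

Let succ_sigma_finite : sigma_finite setT (lebesgue_rV_succ m).
Proof.
have /sigma_finiteP[F [FT ndF Foo]] := sigma_finiteT (@lebesgue_measure R).
have /sigma_finiteP[G [GT ndG Goo]] := sigma_finiteT m.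
exists (fun k => @uncons_rV n @^-1` (F k `*` G k)).
  rewrite -preimage_bigcup -(_ : setT = \bigcup_k (F k `*` G k))//.
  rewrite -setXTT FT GT predeqE => -[x y]; split.
    move=> [/= [i _ Fix] [k _ Gky]]; exists (maxn i k) => //; split.
    - by move: x Fix; exact/subsetPset/ndF/leq_maxl.
    - by move: y Gky; exact/subsetPset/ndG/leq_maxr.
  by move=> [k _ []/= ? ?]; split; exists k.
move=> k; have [mF Fk] := Foo k; have [mG Gk] := Goo k; split.
  by rewrite -[X in measurable X]setTI; apply: measurable_uncons_rV;
    [|exact: measurableX].
rewrite /lebesgue_rV_succ /pushforward -comp_preimage.
rewrite (_ : @uncons_rV n \o @cons_rV n = id) ?preimage_id//.
  by rewrite product_measure1E// lte_mul_pinfty// ge0_fin_numE.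
by apply/funext => p /=; rewrite cons_rVK.
Qed.

HB.instance Definition _ := Measure_isSigmaFinite.Build _ _ _
  (lebesgue_rV_succ m) succ_sigma_finite.

End succ.

Fixpoint lebesgue_rV n : {sigma_finite_measure set 'rV[R]_n -> \bar R} :=
  if n is n'.+1 then lebesgue_rV_succ (lebesgue_rV n') else dirac (0 : 'rV[R]_0).

End lebesgue_rV.

Section sphere.
Context (R : realType) (n : nat).

Definition euclid (u : 'rV[R]_n) : R := Num.sqrt (\sum_i u 0 i ^+ 2).

Definition euclid_ball : set 'rV[R]_n := [set u | euclid u <= 1].

Definition normalize (u : 'rV[R]_n) : 'rV[R]_n := (euclid u)^-1 *: u.

Lemma measurable_euclid : measurable_fun [set: 'rV[R]_n] euclid.
Proof.
apply: (measurableT_comp (f := @Num.sqrt R)).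
  exact: (continuous_measurable_fun (@sqrt_continuous R)).
apply: measurable_sum => i.
by apply: measurable_funX; exact: measurable_coord.
Qed.

Lemma measurable_euclid_ball : measurable euclid_ball.
Proof.
rewrite (_ : euclid_ball = [set: 'rV[R]_n] `&` euclid @^-1` `]-oo, 1]).
  exact: measurable_euclid.
by rewrite setTI; apply/seteqP; split => u; rewrite /euclid_ball /= in_itv.
Qed.

Lemma measurable_normalize : measurable_fun [set: 'rV[R]_n] normalize.
Proof.
apply: measurable_fun_rV => i; rewrite /normalize.
under eq_fun do rewrite mxE.
apply: measurable_funM; last exact: measurable_coord.
under eq_fun do rewrite -powR_inv1 ?sqrtr_ge0//.
exact: (measurableT_comp (measurable_powR _) measurable_euclid).
Qed.
End sphere.

(* Surface measure on the unit sphere S^n of R^(n+1), as a measure on R^(n+1)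
   carried by S^n.  A set A gets n+1 times the volume of the cone
   {r theta | 0 < r <= 1, theta \in A}: this is integration in polar coordinates,
   |cone A| = \int_0^1 r^n sigma(A) dr.  For n = 0 it is the counting measure on
   S^0 = {-1, 1}. *)
Section sphere_measure.
Context (R : realType) (n : nat).
Local Open Scope ereal_scope.

Definition sphere_measure (A : set 'rV[R]_n.+1) : \bar R :=
  (n.+1%:R : R)%R%:E *
  lebesgue_rV R n.+1 (@normalize R n.+1 @^-1` A `&` @euclid_ball R n.+1).

Let cone : {measure set 'rV[R]_n.+1 -> \bar R} := mscale ((n.+1%:R : R)%:nng)%R
  (measure_function_pushforward__canonical__measure_function_Measure
    (mrestr (lebesgue_rV R n.+1) (@measurable_euclid_ball R n.+1))
    (@measurable_normalize R n.+1)).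

Let sphere0 : sphere_measure set0 = 0.
Proof. exact: (measure0 cone). Qed.

Let sphere_ge0 A : 0 <= sphere_measure A.
Proof. exact: (measure_ge0 cone). Qed.

Let sphere_sigma_additive : semi_sigma_additive sphere_measure.
Proof. exact: (@measure_semi_sigma_additive _ _ _ cone). Qed.

HB.instance Definition _ := isMeasure.Build _ _ _ sphere_measure
  sphere0 sphere_ge0 sphere_sigma_additive.

End sphere_measure.

Definition cintegral (R : realType) d (T : measurableType d)
    (mu : {measure set T -> \bar R}) (D : set T) (F : T -> R[i]) : R[i] :=
  Complex (\int[mu]_(z in D) complex.Re (F z)) (\int[mu]_(z in D) complex.Im (F z)).

Section polynomials.
Context (R : realType) (n : nat).

Definition evalP (p : mpoly n.+1 R[i]) (u : 'rV[R]_n.+1) : R[i] :=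
  meval (fun i => (u 0 i)%:C%C) p.

(* p belongs to P_k^(n+1); this space is 0 for negative k. *)
Definition homogP (k : int) (p : mpoly n.+1 R[i]) : bool :=
  if k is Posz d then p \is ishomog1 d mdeg else p == 0.

Definition normP (p : mpoly n.+1 R[i]) : R :=
  fine 'N[@sphere_measure R n]_2%:E[EFin \o (@ComplexField.Normc.normc R) \o evalP p]%E.

Context d (T : measurableType d).
Implicit Types (mu : {measure set T -> \bar R}) (D : set T).

Definition L2norm mu D (f : T -> mpoly n.+1 R[i]) : \bar R :=
  'N[mu]_2%:E[(EFin \o normP \o f) \_ D]%E.

Definition L2 mu D (f : T -> mpoly n.+1 R[i]) : Prop :=
  (forall al, measurable_fun D (fun z => complex.Re (mcoeff al (f z))) /\
              measurable_fun D (fun z => complex.Im (mcoeff al (f z)))) /\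
  (L2norm mu D f < +oo)%E.

End polynomials.

Fixpoint Ck (R : realType) (V : normedModType R) (k : nat) (phi : V -> R) :
    Prop :=
  continuous phi /\
  if k is k'.+1 then
    forall v, (forall z, derivable phi z v) /\ Ck k' (fun z => 'D_v phi z)
  else True.

Definition smooth (R : realType) (V : normedModType R) (phi : V -> R) : Prop :=
  forall k, Ck k phi.

(* Functions on the torus R^n/Z^n are Z^n-periodic functions on R^n, integrated
   over the fundamental domain [0,1)^n.  Functions on M = [0,1] x (R^n/Z^n) are
   functions on R x R^n of which only the values at points (x, y) with x in
   [0,1] matter, and which are Z^n-periodic in y there. *)
Section tensor_fields.
Context (R : realType) (n : nat).

Notation P := (mpoly n.+1 R[i]).
Notation field := (R * 'rV[R]_n -> P).

Definition cube : set 'rV[R]_n := [set y | forall i, 0 <= y 0 i < 1].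

Definition slab : set (R * 'rV[R]_n) := `[0, 1] `*` setT.

Definition cell : set (R * 'rV[R]_n) := `[0, 1] `*` cube.

Definition volM : {measure set (measurableTypeR R * 'rV[R]_n)%type -> \bar R} :=
  (@lebesgue_measure R \x lebesgue_rV R n)%E.

Definition periodic_on (T : Type) (D : set (R * 'rV[R]_n))
    (F : R * 'rV[R]_n -> T) : Prop :=
  forall z (q : 'rV[int]_n), D z -> F (z.1, z.2 + map_mx intr q) = F z.

Definition L2_tensor (k : int) (f : field) : Prop :=
  [/\ forall z, slab z -> homogP k (f z),
      periodic_on slab f & L2 volM cell f].

Definition L2_profile (k : int) (h : R -> P) : Prop :=
  (forall x, x \in `[0, 1] -> homogP k (h x)) /\
  L2 (@lebesgue_measure R) `[0, 1] h.

(* The coordinate vectors of R x R^n; index 0 is the direction of x. *)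
Definition coordM (i : 'I_n.+1) : R * 'rV[R]_n := uncons_rV (delta_mx 0 i).

(* Compactly supported in the interior ]0,1[ x (R^n/Z^n). *)
Definition test_function (phi : R * 'rV[R]_n -> R) : Prop :=
  [/\ smooth phi, periodic_on setT phi &
      exists2 e : R, 0 < e & forall z, phi z != 0 -> e <= z.1 <= 1 - e].

Definition weak_partial (i : 'I_n.+1) (g g' : field) : Prop :=
  forall phi, test_function phi -> forall al,
    cintegral volM cell (fun z => mcoeff al (g z) * ('D_(coordM i) phi z)%:C%C) =
    - cintegral volM cell (fun z => mcoeff al (g' z) * (phi z)%:C%C).

Definition H1 (k : int) (g : field) (Dg : 'I_n.+1 -> field) : Prop :=
  [/\ L2_tensor k g, forall i, L2_tensor k (Dg i) &
      forall i, weak_partial i g (Dg i)].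

Definition H1norm (g : field) (Dg : 'I_n.+1 -> field) : \bar R :=
  ((L2norm volM cell g ^+ 2 + \sum_i L2norm volM cell (Dg i) ^+ 2) `^ 2^-1)%E.

(* Smooth tensor fields on M, as restrictions of smooth fields on
   R x (R^n/Z^n). *)
Definition smooth_tensor (k : int) (u : field) : Prop :=
  [/\ forall z, homogP k (u z), periodic_on setT u &
      forall al, smooth (fun z => complex.Re (mcoeff al (u z))) /\
                 smooth (fun z => complex.Im (mcoeff al (u z)))].

Definition classical_partial (i : 'I_n.+1) (u u' : field) : Prop :=
  forall z al, mcoeff al (u' z) =
    Complex ('D_(coordM i) (fun z => complex.Re (mcoeff al (u z))) z)
            ('D_(coordM i) (fun z => complex.Im (mcoeff al (u z))) z).

(* tau0, tau1 are the traces of g on {0} x T^n and {1} x T^n: the trace operator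
   is the continuous extension to H^1 of the restriction of smooth fields to the
   boundary. *)
Definition has_trace (k : int) (g : field) (Dg : 'I_n.+1 -> field)
    (tau0 tau1 : 'rV[R]_n -> P) : Prop :=
  exists (u : nat -> field) (Du : nat -> 'I_n.+1 -> field),
    [/\ forall N, smooth_tensor k (u N),
        forall N i, classical_partial i (u N) (Du N i),
        (fun N => H1norm (u N \- g) (fun i => Du N i \- Dg i)) @ \oo --> 0%E,
        (fun N => L2norm (lebesgue_rV R n) cube
                    (fun y => u N (0, y) - tau0 y)) @ \oo --> 0%E &
        (fun N => L2norm (lebesgue_rV R n) cube
                    (fun y => u N (1, y) - tau1 y)) @ \oo --> 0%E].

Definition H10 (k : int) (g : field) (Dg : 'I_n.+1 -> field) : Prop :=
  H1 k g Dg /\ has_trace k g Dg (fun=> 0) (fun=> 0).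

(* (v d/dx + w . grad_y) g, where Dg are the partial derivatives of g and the
   indeterminates are v = X_0 and w_j = X_(j+1). *)
Definition symd (Dg : 'I_n.+1 -> field) : field :=
  fun z => \sum_i mpolyX R[i] (mnm1 i) * Dg i z.

Definition xray (f : field) (a b : 'rV[R]_n) : R[i] :=
  cintegral (@lebesgue_measure R) `[0, 1]
    (fun t => evalP (f (t, a + t *: b)) (cons_rV (1, b))).

Definition xray_vanishes (f : field) : Prop :=
  forall b, {ae lebesgue_rV R n, forall a, cube a -> xray f a b = 0}.

End tensor_fields.

(* Main.v *)
Require Import Defs.
From mathcomp Require Import all_boot all_order all_algebra.
From mathcomp Require Import complex.
From mathcomp Require Import -(notations) mpoly.
From mathcomp Require Import all_classical all_reals all_analysis.
From mathcomp Require Import measurable_realfun ring lra zify.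
Set Implicit Arguments.
Unset Strict Implicit.
Unset Printing Implicit Defensive.
Import Order.TTheory GRing.Theory Num.Theory.
Import numFieldNormedType.Exports.
Local Open Scope classical_set_scope.
Local Open Scope ring_scope.

(** Expand everything in the characters [chi s k (x, y) = exp (2 pi i (s x + k . y))]
    of the unit cell [[0,1] x T^n].  If the X-ray transform of [f] vanishes, the
    Fourier coefficient [fhat (s, k)], a polynomial in [(v, w)], vanishes on the
    hyperplane [s v + k . w = 0] (off [v = 0]): there it is the pairing of
    [f (x, y; 1, b)] with a character constant along lines of direction [(1, b)].
    For [k <> 0] it is therefore divisible by [s v + k . w], with a bound on the
    quotient [q (s, k)], and [g] is the series with coefficients
    [q (s, k) / (2 pi i)]; the coefficients with [k = 0] make up [h].

    The trace of [g] is zero because the sums [T_M = \sum_(|s| <= M) q (s, k)]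
    tend to 0.  Integration by parts against [chi t (- k)] shows that
    [(exp (2 pi i t) - 1) T_M] has a limit for every real [t]; with [t = 1/2] the
    [T_M] converge, and with [t = k . b] the limit vanishes at [(1, b)] whenever
    [k . b] is not an integer, hence identically. *)

(** * Division of homogeneous polynomials by a linear form *)

(** All estimates concern squared moduli weighted by the frequency: [kappa_i ^ 2 |q| ^ 2] is at most
    a constant times the energy of [fhat] at the same index. With [i] arbitrary this puts every
    derivative of [g] in L^2, and since an integer vector [k <> 0] has an entry of modulus at least
    1, it puts [g] itself in L^2. The constant stems from the degree and from the equivalence of
    norms on a finite-dimensional space, hence from n and m alone.

    At [k = 0] the hyperplane condition is void off [v = 0] unless [s = 0], where it says that
    [fhat] vanishes: this is the zero mean of [h].

    The obstacle is the boundary. Partial sums with integer [s] agree at [x = 0] and [x = 1], so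
    characters of the cell do not detect their trace; nonintegral real frequencies do. The [T_M]
    tend to 0 only for each [k] separately, so the smooth approximants fix a finite set of [k]
    before the range of [s] is enlarged.

    For the converse, [h + dg] is paired with [chi s k], [s = - k . b]; integration by parts, made
    on the smooth fields that witness the zero trace, gives the factor [s + k . b = 0]. *)

Section meval_grid.
Context (K : fieldType).

(** [muni] turns the last variable into the indeterminate of a univariate polynomial, so that roots
    can be counted one variable at a time. *)
Lemma meval_muni n (v : 'I_n.+1 -> K) (p : mpoly n.+1 K) :
  meval v p =
  (map_poly (meval (fun i => v (widen_ord (leqnSn n) i))) (muni p)).[v ord_max].
Proof.
elim/mpolyind: p => [|c m p _ _ IH]; first by rewrite muni0 map_poly0 !raddf0 horner0.
rewrite mevalD IH muniD rmorphD /= hornerD; congr (_ + _).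
rewrite mevalZ mevalX muniZ map_polyZ hornerZ /= mevalC; congr (_ * _).
rewrite big_ord_recr /= muniE msuppX big_seq1 mcoeffX eqxx scale1r.
rewrite map_polyZ /= map_polyXn hornerZ hornerXn mevalX; congr (_ * _).
by apply: eq_bigr => i _; rewrite mnmE.
Qed.

Lemma muniK n (p : mpoly n.+1 K) :
  (mpwiden (muni p)).[mpolyX K (mnm1 ord_max)] = p.
Proof.
elim/mpolyind: p => [|c m p _ _ IH]; first by rewrite muni0 raddf0 horner0.
have mpwidenD : {morph @mpwiden n K : q r / q + r} by exact: raddfD.
rewrite muniD mpwidenD hornerD; congr (_ + _); last exact: IH.
rewrite muniZ mpwidenZ hornerZ mwidenC mul_mpolyC; congr (_ *: _).
rewrite muniE msuppX big_seq1 mcoeffX eqxx scale1r.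
rewrite mpwidenZ rmorphXn /= mpwidenX hornerZ hornerXn mwidenX mpolyXn -mpolyXD; congr (mpolyX _ _).
apply/mnmP => i; rewrite mnmDE mulmnE mnm1E.
have [->|] := eqVneq i ord_max.
  by rewrite mnmwiden_ordmax mul1n.
move=> ni; have li : (i < n)%N.
  by have := ltn_ord i; rewrite ltnS leq_eqVlt => /orP[/eqP E|//]; case/eqP: ni; apply/val_inj.
rewrite (_ : i = widen_ord (leqnSn n) (Ordinal li)); last exact/val_inj.
rewrite mnmwiden_widen mnmE mul0n addn0.
by congr (m _).
Qed.

(** Induction on the number of variables: once the other coordinates are fixed, the polynomial in
    the last variable has infinitely many roots, so each of its coefficients vanishes on a grid of
    lower dimension. *)
Lemma meval_grid_eq0 n (s : 'I_n -> nat -> K) (p : mpoly n K) :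
  (forall i, injective (s i)) ->
  (forall j : 'I_n -> nat, meval (fun i => s i (j i)) p = 0) -> p = 0.
Proof.
elim: n s p => [|n IH] s p inj_s p0.
  apply/mpolyP => m; rewrite mcoeff0; have := p0 (fun=> 0%N).
  rewrite mevalE; have m0 (m' : multinom 0) : m' = mnm0 by apply/mnmP => -[].
  rewrite (m0 m); have [ms|] := boolP (mnm0 \in msupp p); last first.
    by rewrite mcoeff_msupp negbK => /eqP.
  rewrite (bigD1_seq mnm0) ?msupp_uniq//= big_ord0 mulr1 big1 ?addr0//.
  by move=> m' /eqP; rewrite (m0 m').
have {}p0 (j : 'I_n -> nat) :
    map_poly (meval (fun i => s (widen_ord (leqnSn n) i) (j i))) (muni p) = 0.
  set P := map_poly _ _; apply/eqP; apply: contraT => P0.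
  (* These are [size P] distinct roots, one more than a nonzero [P] can have. *)
  pose r := [seq s ord_max k | k <- iota 0 (size P)].
  have := @max_poly_roots _ P r P0.
  rewrite size_map size_iota ltnn => -> //.
    apply/allP => _ /mapP[k _ ->]; rewrite /root; apply/eqP.
    pose J (i : 'I_n.+1) : nat := if unlift ord_max i is Some i' then j i' else k.
    have := p0 J; rewrite meval_muni /J unlift_none => <-; congr (_.[_]).
    apply: eq_map_poly => q; apply: meval_eq => i.
    rewrite (_ : widen_ord _ i = lift ord_max i) ?liftK//.
    by apply/val_inj => /=; rewrite /bump leqNgt ltn_ord.
  by rewrite map_inj_uniq ?iota_uniq.
rewrite -(muniK p); suff -> : muni p = 0 by rewrite raddf0 horner0.
apply/polyP => k; rewrite coef0; apply: IH (fun i => s (widen_ord (leqnSn n) i)) _ _ _ => //.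
move=> j; have /(congr1 (fun q : {poly K} => q`_k)) := p0 j.
by rewrite coef_map coef0.
Qed.

End meval_grid.

Section linear_form.
Context (K : fieldType) (n : nat).
Implicit Types (p q : mpoly n K) (k : 'I_n -> K) (al be : multinom n).

Definition linear_form k : mpoly n K := \sum_i k i *: mpolyX K (mnm1 i).

(** The guard excludes the exponents on which the truncated subtraction [mnm_sub] would give a wrong
    index. *)
Lemma mcoeff_mulXU p i al :
  mcoeff al (mpolyX K (mnm1 i) * p) =
  if (0 < al i)%N then mcoeff (mnm_sub al (mnm1 i)) p else 0.
Proof.
rewrite mulrC; case: ltnP => [ai|].
  have {1}-> : al = mnm_add (mnm1 i) (mnm_sub al (mnm1 i)).
    apply/mnmP => j; rewrite mnmDE mnmBE mnm1E.
    by have [<-|_] := eqVneq i j; rewrite ?subn0// subnKC.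
  exact: mcoeffMX.
rewrite leqn0 => /eqP ai; apply/eqP; rewrite mcoeff_eq0.
apply/negP; rewrite (perm_mem (msuppMX _ _)) => /mapP[m _ alE].
by move: ai; rewrite alE mnmDE mnm1E eqxx.
Qed.

Lemma mcoeff_linear_formM k q al :
  mcoeff al (linear_form k * q) =
  \sum_(i | (0 < al i)%N) k i * mcoeff (mnm_sub al (mnm1 i)) q.
Proof.
rewrite mulr_suml raddf_sum/= [RHS]big_mkcond; apply: eq_bigr => i _.
by rewrite -scalerAl mcoeffZ mcoeff_mulXU; case: ifP; rewrite ?mulr0.
Qed.

Lemma linear_form_eval k (v : 'I_n -> K) :
  meval v (linear_form k) = \sum_i k i * v i.
Proof. by rewrite raddf_sum/=; apply: eq_bigr => i _; rewrite mevalZ mevalXU. Qed.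

Lemma linear_form_homog k : linear_form k \is ishomog1 1 mdeg.
Proof. by apply: rpred_sum => i _; apply: rpredZ; rewrite dhomogX; apply/eqP/mdeg1. Qed.

(** Multiplication by a homogeneous polynomial shifts all degrees by [d]. Hence a quotient of a
    homogeneous polynomial by a linear form may be replaced by its homogeneous component of the
    right degree. *)
Lemma pihomogM_homog d e p q : p \is ishomog1 d mdeg ->
  pihomog mdeg (d + e) (p * q) = p * pihomog mdeg e q.
Proof.
move=> hp; pose b := maxn (@mmeasure _ _ mdeg q) e.+1.
have {1}-> := @pihomog_partitionE _ _ mdeg b q (leq_maxl _ _).
rewrite mulr_sumr raddf_sum/= (bigD1 (Ordinal (leq_maxr _ _ : (e < b)%N)))//=.
rewrite pihomog_dE ?dhomogM ?pihomogP// big1 ?addr0// => i ie.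
apply: (@pihomog_ne0 _ _ _ (d + i)); last by rewrite dhomogM ?pihomogP.
by rewrite eqn_add2l; apply: contra ie => /eqP ie; apply/eqP/val_inj.
Qed.

(** The substitution solves [linear_form k = 0] for the variable [i0]. The polynomials that it
    changes by a multiple of the linear form contain the variables and are closed under sums,
    scalings and products. *)
Lemma linear_form_division k i0 p : k i0 != 0 ->
  exists q, p - comp_mpoly [tuple if i == i0 then
     mpolyX K (mnm1 i) - (k i0)^-1 *: linear_form k else mpolyX K (mnm1 i) | i < n] p
   = linear_form k * q.
Proof.
move=> k0; set s := [tuple _ | _ < n]; set L := linear_form k.
pose Q r := exists q, r - comp_mpoly s r = L * q.
have QD r r' : Q r -> Q r' -> Q (r + r').
  move=> [q qE] [q' q'E]; exists (q + q').
  by rewrite raddfD/= mulrDr -qE -q'E opprD addrACA.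
have QZ c r : Q r -> Q (c *: r).
  by move=> [q qE]; exists (c *: q); rewrite comp_mpolyZ -scalerBr qE scalerAr.
have QM r r' : Q r -> Q r' -> Q (r * r').
  move=> [q qE] [q' q'E]; exists (q * r' + comp_mpoly s r * q').
  rewrite rmorphM/= mulrDr mulrA -qE mulrCA -q'E; ring.
have Q1 : Q 1 by exists 0; rewrite comp_mpoly1 subrr mulr0.
have QX i : Q (mpolyX K (mnm1 i)).
  rewrite /Q comp_mpolyXU -tnth_nth tnth_mktuple; case: eqP => _.
    by exists (@mpolyC n K (k i0)^-1); rewrite opprB addrC subrK mulrC mul_mpolyC.
  by exists 0; rewrite subrr mulr0.
have QX' m : Q (mpolyX K m).
  rewrite mpolyXE_id; elim/big_rec: _ => [|i r _ Qr]; first exact: Q1.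
  apply: (QM _ _ _ Qr); elim: (m i) => [|a IH]; first by rewrite expr0; exact: Q1.
  by rewrite exprS; exact: (QM _ _ (QX i) IH).
suff : Q p by [].
elim/mpolyind: p => [|c m p _ _ Qp]; first by exists 0; rewrite raddf0 subrr mulr0.
exact: (QD _ _ (QZ c _ (QX' m)) Qp).
Qed.

End linear_form.

Section quotient_bound.
Context (K : numFieldType) (n d : nat).

(* The coefficient of [q] at [be] is solved for in the coefficient of
   [linear_form k * q] at [be + e_i0]; the other terms have a larger exponent
   of the variable [i0]. *)
Lemma linear_form_quotient_bound (k : 'I_n -> K) (i0 : 'I_n) (q : mpoly n K) (B : K) :
  (forall i, `|k i| <= `|k i0|) -> q \is ishomog1 d mdeg ->
  (forall al, `|mcoeff al (linear_form k * q)| <= B) ->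
  forall be, `|k i0| * `|mcoeff be q| <= n.+1%:R ^+ d * B.
Proof.
move=> k_i0 hq hB.
have B0 : 0 <= B by rewrite (le_trans _ (hB mnm0))// normr_ge0.
have [->|k0] := eqVneq (k i0) 0.
  by move=> be; rewrite normr0 mul0r mulr_ge0// exprn_ge0.
have k0' : 0 < `|k i0| by rewrite normr_gt0.
(* Downward induction on the exponent of the variable [i0]: [t] bounds its distance to [d], and each
   step costs a factor [n.+1]. *)
suff H t (be : multinom n) : (d <= be i0 + t)%N -> `|k i0| * `|mcoeff be q| <= n.+1%:R ^+ t * B.
  by move=> be; apply: H; rewrite leq_addl.
elim: t be => [|t IH] be dbe.
all: have [hd|nd] := eqVneq (mdeg be) d;
  last by rewrite (dhomog_nemf_coeff hq)// normr0 mulr0 mulr_ge0// exprn_ge0.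
all: have := hB (mnm_add (mnm1 i0) be); rewrite mcoeff_linear_formM (bigD1 i0)/=;
  last by rewrite mnmDE mnm1E eqxx.
all: rewrite addmC addmK.
(* Here [be] has degree [d] and [be i0 >= d], so that no other variable occurs in it and the
   coefficient equation has a single term. *)
- rewrite big1 ?addr0 ?normrM ?expr0 ?mul1r// => i /andP[bi ii0].
  move: bi; rewrite mnmDE mnm1E eq_sym (negbTE ii0) addn0 => bi.
  exfalso; move: dbe; rewrite addn0 -hd mdegE (bigD1 i0)//= (bigD1 i)//=.
  by rewrite -{2}(addn0 (be i0)) leq_add2l leqn0 addn_eq0 -leqn0 leqNgt bi.
- move=> hal; set S := \sum_(i | _) _ in hal.
  have S_le : `|S| <= n%:R * (n.+1%:R ^+ t * B).
    rewrite (le_trans (ler_norm_sum _ _ _))//.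
    rewrite (le_trans (y := \sum_(i < n) n.+1%:R ^+ t * B))//; last first.
      by rewrite sumr_const card_ord mulr_natl.
    rewrite [leLHS]big_mkcond/= ler_sum// => i _; case: ifP => [/andP[bi ii0]|_]; last first.
      by rewrite mulr_ge0// exprn_ge0.
    rewrite normrM (le_trans (ler_wpM2r _ (k_i0 i)))// IH//.
    rewrite mnmBE mnmDE !mnm1E eqxx (negbTE ii0) subn0.
    by rewrite addn1 addSnnS.
  rewrite -normrM -(addrK S (k i0 * _)) (le_trans (ler_normB _ _))//.
  rewrite (le_trans (lerD hal S_le))// exprS -natr1 mulrDl mul1r mulrDl -mulrA addrC lerD2l.
  by rewrite -{1}(mul1r B) ler_wpM2r// exprn_ege1// lerDr.
Qed.

End quotient_bound.

Section real_points.
Context (R : realType) (n : nat).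
Implicit Types (p q : mpoly n.+1 R[i]) (u k : 'rV[R]_n.+1).

Lemma evalPD p q u : evalP (p + q) u = evalP p u + evalP q u.
Proof. exact: mevalD. Qed.

Lemma evalPM p q u : evalP (p * q) u = evalP p u * evalP q u.
Proof. exact: mevalM. Qed.

Lemma evalPXU i u : evalP (mpolyX R[i] (mnm1 i)) u = (u 0 i)%:C%C.
Proof. exact: mevalXU. Qed.

Lemma evalP_scale d p (c : R) u : p \is ishomog1 d mdeg ->
  evalP p (c *: u) = (c ^+ d)%:C%C * evalP p u.
Proof.
move=> /dhomogP hp; rewrite /evalP !mevalE mulr_sumr; apply: eq_big_seq => m /hp /= md.
rewrite mulrCA; congr (_ * _).
rewrite -md mdegE -prodrXr rmorph_prod/= -big_split/=; apply: eq_bigr => i _.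
by rewrite mxE rmorphM/= exprMn rmorphXn.
Qed.

(** A box contains the infinite grid of the points with coordinates [c i + e / j.+1], to which
    [meval_grid_eq0] applies. *)
Lemma evalP_box_eq0 p (c : 'I_n.+1 -> R) (e : R) : 0 < e ->
  (forall u, (forall i, c i <= u 0 i <= c i + e) -> evalP p u = 0) -> p = 0.
Proof.
move=> e0 pe; apply: (@meval_grid_eq0 _ _ (fun i j => (c i + e / j.+1%:R)%:C%C)).
  move=> i j j' /complexI/addrI/(mulfI (lt0r_neq0 e0))/invr_inj/eqP.
  by rewrite eqr_nat => /eqP[].
move=> j; have := pe (\row_i (c i + e / (j i).+1%:R)); rewrite /evalP.
under meval_eq => i do rewrite mxE; apply => i; rewrite mxE lerDl.
rewrite divr_ge0 ?(ltW e0)//= lerD2l ler_pdivrMr// ler_peMr ?(ltW e0)//.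
by rewrite ler1n.
Qed.

Lemma evalP_eq0 p : (forall u, evalP p u = 0) -> p = 0.
Proof. by move=> p0; apply: (@evalP_box_eq0 p (fun=> 0) 1 ltr01) => u _. Qed.

(** Eliminating the variable [lift 0 j] amounts to moving a point along that axis onto the
    hyperplane, where [p] vanishes. The axis is not the axis 0, so the condition [u 0 0 != 0]
    survives the move. *)
Lemma linear_form_dvd k j p : k 0 (lift 0 j) != 0 ->
  (forall u, \sum_i k 0 i * u 0 i = 0 -> u 0 0 != 0 -> evalP p u = 0) ->
  exists q, p = linear_form (fun i => (k 0 i)%:C%C) * q.
Proof.
move=> kj pk; set kC := fun i => (k 0 i)%:C%C.
have kCj : kC (lift 0 j) != 0 by rewrite /kC -(rmorph0 (real_complex R)) (inj_eq (@complexI R)).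
have [q] := linear_form_division p kCj; set s := [tuple _ | _ < _] => pq.
exists q; suff s0 : comp_mpoly s p = 0 by rewrite -pq s0 subr0.
(* The remainder is known to vanish only where the coordinate 0 is nonzero. Its product with the
   variable 0 vanishes everywhere, and polynomials form an integral domain. *)
have X0 : mpolyX R[i] (mnm1 (0 : 'I_n.+1)) != 0.
  apply/eqP => /(congr1 (fun r => @evalP R n r (const_mx 1))).
  by rewrite evalPXU mxE /evalP meval0 => /eqP; rewrite oner_eq0.
apply/eqP; rewrite -[_ == _]orFb -(negbTE X0) -mulf_eq0; apply/eqP/evalP_eq0 => u.
rewrite evalPM evalPXU.
have [->|u0] := eqVneq (u 0 0) 0; first by rewrite mul0r.
rewrite [X in _ * X](_ : _ = 0) ?mulr0//.
pose t := u 0 (lift 0 j) - (k 0 (lift 0 j))^-1 * \sum_i k 0 i * u 0 i.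
pose w := \row_i (if i == lift 0 j then t else u 0 i).
rewrite /evalP comp_mpoly_meval -[RHS](pk w).
- apply: meval_eq => i; rewrite tnth_mktuple !mxE; case: eqP => [->|_]; last exact: mevalXU.
  rewrite mevalB mevalXU mevalZ linear_form_eval /t /kC rmorphB rmorphM/= fmorphV.
  by rewrite rmorph_sum/=; under [in RHS]eq_bigr do rewrite rmorphM.
- rewrite (bigD1 (lift 0 j))//= mxE eqxx /t.
  under eq_bigr => i ij do rewrite mxE (negbTE ij).
  by rewrite mulrBr mulrA mulfV// mul1r (bigD1 (lift 0 j))//= opprD addrA subrr add0r addNr.
- by rewrite mxE.
Qed.

End real_points.

(** * Square-integrable complex functions *)

Local Notation cRe := complex.Re.
Local Notation cIm := complex.Im.

Section complex_parts.
Context (R : realType).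
Implicit Types (x y : R[i]) (a : R).

Lemma cReD x y : cRe (x + y) = cRe x + cRe y. Proof. by case: x y => ? ? []. Qed.
Lemma cImD x y : cIm (x + y) = cIm x + cIm y. Proof. by case: x y => ? ? []. Qed.
Lemma cReN x : cRe (- x) = - cRe x. Proof. by case: x. Qed.
Lemma cImN x : cIm (- x) = - cIm x. Proof. by case: x. Qed.
Lemma cReB x y : cRe (x - y) = cRe x - cRe y. Proof. by rewrite cReD cReN. Qed.
Lemma cImB x y : cIm (x - y) = cIm x - cIm y. Proof. by rewrite cImD cImN. Qed.
Lemma cReM x y : cRe (x * y) = cRe x * cRe y - cIm x * cIm y.
Proof. by case: x y => ? ? []. Qed.
Lemma cImM x y : cIm (x * y) = cRe x * cIm y + cIm x * cRe y.
Proof. by case: x y => ? ? []. Qed.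
Lemma cReJ x : cRe (conjc x) = cRe x. Proof. by case: x. Qed.
Lemma cImJ x : cIm (conjc x) = - cIm x. Proof. by case: x. Qed.
Definition cpartE := (cReM, cImM, cReB, cImB, cReD, cImD, cReN, cImN, cReJ, cImJ).

Lemma cRe_sum I (r : seq I) (P : pred I) (F : I -> R[i]) :
  cRe (\sum_(i <- r | P i) F i) = \sum_(i <- r | P i) cRe (F i).
Proof. by apply: (big_morph _ (@cReD)). Qed.

Lemma cIm_sum I (r : seq I) (P : pred I) (F : I -> R[i]) :
  cIm (\sum_(i <- r | P i) F i) = \sum_(i <- r | P i) cIm (F i).
Proof. by apply: (big_morph _ (@cImD)). Qed.

Lemma eq_cparts x y : cRe x = cRe y -> cIm x = cIm y -> x = y.
Proof. by case: x y => ? ? [] ? ? /= -> ->. Qed.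

(** The squared modulus, taken with values in [R]: estimates stay polynomial in the two parts, with
    no square root and no order on the complex numbers. *)
Definition sqn x : R := cRe x ^+ 2 + cIm x ^+ 2.

Lemma sqn_ge0 x : 0 <= sqn x. Proof. by rewrite addr_ge0// sqr_ge0. Qed.
Lemma sqn0 : sqn 0 = 0. Proof. by rewrite /sqn /= expr0n addr0. Qed.
Lemma sqnN x : sqn (- x) = sqn x. Proof. by rewrite /sqn !cpartE !sqrrN. Qed.
Lemma sqnM x y : sqn (x * y) = sqn x * sqn y.
Proof. by rewrite /sqn !cpartE; ring. Qed.
Lemma sqnJ x : sqn (conjc x) = sqn x. Proof. by rewrite /sqn !cpartE sqrrN. Qed.
Lemma conjcM x y : conjc (x * y) = conjc x * conjc y. Proof. exact: rmorphM. Qed.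
Lemma sqnC a : sqn a%:C%C = a ^+ 2. Proof. by rewrite /sqn /= expr0n addr0. Qed.
Lemma mulcJ x : x * conjc x = (sqn x)%:C%C.
Proof. by apply: eq_cparts; rewrite !cpartE /= /sqn; ring. Qed.
Lemma sqn_eq0 x : sqn x = 0 -> x = 0.
Proof.
move/eqP; rewrite paddr_eq0 ?sqr_ge0// !sqrf_eq0 => /andP[/eqP ? /eqP ?].
exact: eq_cparts.
Qed.
Lemma sqnD_le x y : sqn (x + y) <= 2 * sqn x + 2 * sqn y.
Proof.
rewrite -subr_ge0 (_ : _ - _ = sqn (x - y)) ?sqn_ge0//.
by rewrite /sqn !cpartE; ring.
Qed.
Lemma sqnB_le x y : sqn (x - y) <= 2 * sqn x + 2 * sqn y.
Proof. by rewrite (le_trans (sqnD_le _ _))// sqnN. Qed.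
Lemma sqnB x y : sqn (x - y) = sqn x - 2 * cRe (x * conjc y) + sqn y.
Proof. by rewrite /sqn !cpartE; ring. Qed.
(** The constant is not sharp. The bound serves to make products of square-integrable functions
    integrable; the leftover terms in [3 / 4] write the difference as a sum of squares. *)
Lemma norm_cReM x y : `|cRe (x * y)| <= sqn x + sqn y.
Proof.
have h (a : R) : 0 <= 3 / 4 * a ^+ 2 by apply: mulr_ge0; [lra|exact: sqr_ge0].
rewrite ler_norml !cpartE /sqn; apply/andP; split; rewrite -subr_ge0.
  rewrite (_ : _ - _ = (cRe x + 2^-1 * cRe y) ^+ 2 + (cIm x - 2^-1 * cIm y) ^+ 2
     + 3 / 4 * cRe y ^+ 2 + 3 / 4 * cIm y ^+ 2); last by field.
  by rewrite !addr_ge0 ?h ?sqr_ge0.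
rewrite (_ : _ - _ = (cRe x - 2^-1 * cRe y) ^+ 2 + (cIm x + 2^-1 * cIm y) ^+ 2
     + 3 / 4 * cRe y ^+ 2 + 3 / 4 * cIm y ^+ 2); last by field.
by rewrite !addr_ge0 ?h ?sqr_ge0.
Qed.
Lemma norm_cImM x y : `|cIm (x * y)| <= sqn x + sqn y.
Proof.
(* Multiplication by [- i] turns the imaginary part into the real part and preserves [sqn]. *)
rewrite (_ : cIm (x * y) = cRe ((- 'i%C * x) * y)); last first.
  by rewrite !cpartE /=; ring.
by rewrite (le_trans (norm_cReM _ _))// lerD2r sqnM sqnN /sqn /= expr0n expr1n add0r mul1r.
Qed.

End complex_parts.

Section complex_integral.
Context d (T : measurableType d) (R : realType).
Variables (mu : {measure set T -> \bar R}) (D : set T).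
Hypothesis mD : measurable D.
Implicit Types F G : T -> R[i].

Definition cmeas F :=
  measurable_fun D (fun z => cRe (F z)) /\ measurable_fun D (fun z => cIm (F z)).

Lemma cmeas_cst c : cmeas (fun=> c). Proof. by split. Qed.

Lemma cmeasD F G : cmeas F -> cmeas G -> cmeas (fun z => F z + G z).
Proof.
move=> [? ?] [? ?]; split; under eq_fun do rewrite cpartE; exact: measurable_funD.
Qed.

Lemma cmeasN F : cmeas F -> cmeas (fun z => - F z).
Proof. by move=> [? ?]; split; under eq_fun do rewrite cpartE; exact: measurable_funN. Qed.

Lemma cmeasB F G : cmeas F -> cmeas G -> cmeas (fun z => F z - G z).
Proof. by move=> mF /cmeasN; exact: cmeasD. Qed.

Lemma cmeasM F G : cmeas F -> cmeas G -> cmeas (fun z => F z * G z).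
Proof.
move=> [? ?] [? ?]; split; under eq_fun do rewrite cpartE.
  by apply: measurable_funB; apply: measurable_funM.
by apply: measurable_funD; apply: measurable_funM.
Qed.

Lemma cmeasJ F : cmeas F -> cmeas (fun z => conjc (F z)).
Proof.
move=> [? ?]; split; under eq_fun do rewrite cpartE; first by [].
exact: measurable_funN.
Qed.

Lemma cmeas_sum I (r : seq I) (P : pred I) (F : I -> T -> R[i]) :
  (forall i, P i -> cmeas (F i)) -> cmeas (fun z => \sum_(i <- r | P i) F i z).
Proof.
move=> mF; elim: r => [|i r IH].
  by under eq_fun do rewrite big_nil; exact: cmeas_cst.
under eq_fun do rewrite big_cons; case Pi: (P i) => //.
by apply: cmeasD => //; exact: mF.
Qed.

Lemma cmeas_sqn F : cmeas F -> measurable_fun D (fun z => sqn (F z)).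
Proof. by move=> [? ?]; apply: measurable_funD; apply: measurable_funX. Qed.

Lemma eq_cmeas F G : {in D, F =1 G} -> cmeas F -> cmeas G.
Proof.
by move=> FG [m1 m2]; split; [apply: eq_measurable_fun m1|apply: eq_measurable_fun m2] => z zD;
  rewrite FG.
Qed.

Definition rintble (f : T -> R) := mu.-integrable D (EFin \o f).

Definition cintble F := rintble (fun z => cRe (F z)) /\ rintble (fun z => cIm (F z)).

Lemma cintble_meas F : cintble F -> cmeas F.
Proof. by move=> [/measurable_int/measurable_EFinP ? /measurable_int/measurable_EFinP ?]. Qed.

Lemma eq_rintble f g : {in D, f =1 g} -> rintble f -> rintble g.
Proof. by move=> fg; apply: (eq_integrable mD (EFin \o f)) => z zD /=; rewrite fg. Qed.

Lemma rintbleD f g : rintble f -> rintble g -> rintble (fun z => f z + g z).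
Proof. by move=> fi gi; exact: (integrableD mD fi gi). Qed.

Lemma rintbleZ c f : rintble f -> rintble (fun z => c * f z).
Proof. by move=> fi; exact: (integrableZl mD c fi). Qed.

Lemma rintbleN f : rintble f -> rintble (fun z => - f z).
Proof. by move=> fi; apply: (eq_integrable mD _ _ _ (integrableN fi)). Qed.

Lemma rintbleB f g : rintble f -> rintble g -> rintble (fun z => f z - g z).
Proof. by move=> fi gi; apply: rintbleD => //; apply: rintbleN. Qed.

Lemma rintble_sum I (r : seq I) (P : pred I) (F : I -> T -> R) :
  (forall i, P i -> rintble (F i)) -> rintble (fun z => \sum_(i <- r | P i) F i z).
Proof.
move=> mF; apply: (eq_integrable mD _ _ _ (integrable_sum mD r mF)) => // z _ /=.
by rewrite sumEFin.
Qed.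

Lemma rintble_le (f g : T -> R) : measurable_fun D f -> (forall z, D z -> `|f z| <= g z) ->
  rintble g -> rintble f.
Proof.
move=> mf fg; apply: (le_integrable mD) => //; first exact/measurable_EFinP.
by move=> z Dz; rewrite lee_fin (le_trans (fg z Dz))// ler_norm.
Qed.

Lemma eq_cintble F G : {in D, F =1 G} -> cintble F -> cintble G.
Proof.
by move=> FG [i1 i2]; split; [apply: eq_rintble i1|apply: eq_rintble i2] => z zD;
  rewrite FG.
Qed.

Lemma cintbleD F G : cintble F -> cintble G -> cintble (fun z => F z + G z).
Proof.
move=> [? ?] [? ?]; split.
  by apply: eq_rintble (_ : rintble (fun z => cRe (F z) + cRe (G z))); [|exact: rintbleD];
    move=> z _; rewrite cpartE.
by apply: eq_rintble (_ : rintble (fun z => cIm (F z) + cIm (G z))); [|exact: rintbleD];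
  move=> z _; rewrite cpartE.
Qed.

Lemma cintbleZ c F : cintble F -> cintble (fun z => c * F z).
Proof.
move=> [? ?]; split.
  apply: eq_rintble (_ : rintble (fun z => cRe c * cRe (F z) - cIm c * cIm (F z))).
    by move=> z _; rewrite cpartE.
  by apply: rintbleB; apply: rintbleZ.
apply: eq_rintble (_ : rintble (fun z => cRe c * cIm (F z) + cIm c * cRe (F z))).
  by move=> z _; rewrite cpartE.
by apply: rintbleD; apply: rintbleZ.
Qed.

Lemma cintbleN F : cintble F -> cintble (fun z => - F z).
Proof. by under [X in _ -> cintble X]eq_fun do rewrite -mulN1r; exact: cintbleZ. Qed.

Lemma cintbleB F G : cintble F -> cintble G -> cintble (fun z => F z - G z).
Proof. by move=> ? /cintbleN; exact: cintbleD. Qed.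

Lemma cintble_sum I (r : seq I) (P : pred I) (F : I -> T -> R[i]) :
  (forall i, P i -> cintble (F i)) -> cintble (fun z => \sum_(i <- r | P i) F i z).
Proof.
move=> Fi; split.
  apply: eq_rintble (rintble_sum r (fun i Pi => (Fi i Pi).1)) => z _.
  by rewrite cRe_sum.
apply: eq_rintble (rintble_sum r (fun i Pi => (Fi i Pi).2)) => z _.
by rewrite cIm_sum.
Qed.

Lemma cintbleM1 F G : cintble F -> cmeas G -> (forall z, D z -> sqn (G z) <= 1) ->
  cintble (fun z => F z * G z).
Proof.
move=> iF mG G1; have [m1 m2] := cmeasM (cintble_meas iF) mG.
have [iF1 iF2] := iF.
have h : rintble (fun z => `|cRe (F z)| + `|cIm (F z)|).
  by apply: rintbleD; apply: integrable_norm.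
have G1r z : D z -> `|cRe (G z)| <= 1.
  by move=> /G1; apply: contraTT; rewrite -!ltNge => c;
    rewrite ltr_wpDr ?sqr_ge0// -real_normK ?num_real// exprn_egt1.
have G1i z : D z -> `|cIm (G z)| <= 1.
  by move=> /G1; apply: contraTT; rewrite -!ltNge => c;
    rewrite ltr_wpDl ?sqr_ge0// -real_normK ?num_real// exprn_egt1.
split; apply: (rintble_le _ _ h) => // z Dz; rewrite cpartE.
  by rewrite (le_trans (ler_normB _ _))// !normrM lerD// ler_piMr// ?G1r ?G1i.
by rewrite (le_trans (ler_normD _ _))// !normrM lerD// ler_piMr// ?G1r ?G1i.
Qed.

Local Notation cint := (cintegral mu D).

Lemma eq_cint F G : {in D, F =1 G} -> cint F = cint G.
Proof.
by move=> FG; congr Complex; apply: eq_Rintegral => z zD; rewrite FG.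
Qed.

Lemma cintD F G : cintble F -> cintble G ->
  cint (fun z => F z + G z) = cint F + cint G.
Proof.
move=> [? ?] [? ?]; apply: eq_cparts; rewrite cpartE /= -RintegralD//;
  by apply: eq_Rintegral => z _; rewrite cpartE.
Qed.

Lemma cintZ c F : cintble F -> cint (fun z => c * F z) = c * cint F.
Proof.
move=> [? ?]; apply: eq_cparts; rewrite cpartE /= -!RintegralZl//.
  rewrite -RintegralB//; [|exact: rintbleZ..].
  by apply: eq_Rintegral => z _; rewrite cpartE.
rewrite -RintegralD//; [|exact: rintbleZ..].
by apply: eq_Rintegral => z _; rewrite cpartE.
Qed.

Lemma cintN F : cintble F -> cint (fun z => - F z) = - cint F.
Proof. by move=> iF; rewrite -mulN1r -cintZ//; apply: eq_cint => z _; rewrite mulN1r. Qed.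

Lemma cintB F G : cintble F -> cintble G ->
  cint (fun z => F z - G z) = cint F - cint G.
Proof. by move=> iF iG; rewrite cintD ?cintN//; exact: cintbleN. Qed.

Lemma cint0 : cint (fun=> 0) = 0.
Proof. by apply: eq_cparts; rewrite /= Rintegral_cst// mul0r. Qed.

Lemma cint_sum I (r : seq I) (P : pred I) (F : I -> T -> R[i]) :
  (forall i, P i -> cintble (F i)) ->
  cint (fun z => \sum_(i <- r | P i) F i z) = \sum_(i <- r | P i) cint (F i).
Proof.
move=> Fi; elim: r => [|i r IH].
  by rewrite big_nil -[RHS]cint0; apply: eq_cint => z _; rewrite big_nil.
rewrite big_cons; case: ifPn => Pi; last first.
  by rewrite -IH; apply: eq_cint => z _; rewrite big_cons (negbTE Pi).
rewrite -IH -cintD; [|exact: Fi|exact: cintble_sum].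
by apply: eq_cint => z _; rewrite big_cons Pi.
Qed.

Lemma ae_eq_cint F G : cmeas F -> cmeas G ->
  {ae mu, forall z, D z -> F z = G z} -> cint F = cint G.
Proof.
move=> [? ?] [? ?] FG; congr Complex; congr fine; apply: ae_eq_integral => //;
  try exact/measurable_EFinP.
all: by apply: filterS FG => z FG Dz; rewrite FG.
Qed.

Definition csq F := cmeas F /\ rintble (fun z => sqn (F z)).

(** A real number by way of [fine], hence 0 when the integral is infinite: it is the squared L^2
    norm only for functions satisfying [csq]. *)
Definition nsq F : R := (\int[mu]_(z in D) sqn (F z))%R.

Lemma nsq_ge0 F : 0 <= nsq F.
Proof. by apply: Rintegral_ge0 => z _; exact: sqn_ge0. Qed.

Lemma eq_nsq F G : {in D, F =1 G} -> nsq F = nsq G.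
Proof. by move=> FG; apply: eq_Rintegral => z zD; rewrite FG. Qed.

Lemma eq_csq F G : {in D, F =1 G} -> csq F -> csq G.
Proof.
move=> FG [mF iF]; split; first exact: eq_cmeas mF.
by apply: eq_rintble iF => z zD; rewrite FG.
Qed.

Lemma csqD F G : csq F -> csq G -> csq (fun z => F z + G z).
Proof.
move=> [mF iF] [mG iG]; split; first exact: cmeasD.
apply: rintble_le (rintbleD (rintbleZ 2 iF) (rintbleZ 2 iG)).
  by apply: cmeas_sqn; exact: cmeasD.
by move=> z _; rewrite ger0_norm ?sqn_ge0// sqnD_le.
Qed.

Lemma csqM_bounded F G (B : R) : csq F -> cmeas G -> (forall z, D z -> sqn (G z) <= B) ->
  csq (fun z => F z * G z).
Proof.
move=> [mF iF] mG GB; split; first exact: cmeasM.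
apply: rintble_le (rintbleZ B iF); first by apply: cmeas_sqn; exact: cmeasM.
move=> z Dz; rewrite ger0_norm ?sqn_ge0// sqnM mulrC ler_wpM2r ?sqn_ge0//.
exact: GB.
Qed.

Lemma csqZ c F : csq F -> csq (fun z => c * F z).
Proof.
move=> cF; apply: eq_csq (csqM_bounded (G := fun=> c) cF (cmeas_cst c) (B := sqn c) _) => //.
by move=> z _; rewrite mulrC.
Qed.

Lemma csqN F : csq F -> csq (fun z => - F z).
Proof. by under [X in _ -> csq X]eq_fun do rewrite -mulN1r; exact: csqZ. Qed.

Lemma csqB F G : csq F -> csq G -> csq (fun z => F z - G z).
Proof. by move=> ? /csqN; exact: csqD. Qed.

Lemma csqJ F : csq F -> csq (fun z => conjc (F z)).
Proof.
move=> [mF iF]; split; first exact: cmeasJ.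
by apply: eq_rintble iF => z _; rewrite sqnJ.
Qed.

Lemma csq0 : csq (fun=> 0).
Proof.
split; first exact: cmeas_cst.
by apply: (eq_integrable mD _ _ _ (integrable0 mu D)) => // z _ /=; rewrite sqn0.
Qed.

Lemma csq_sum I (r : seq I) (P : pred I) (F : I -> T -> R[i]) :
  (forall i, P i -> csq (F i)) -> csq (fun z => \sum_(i <- r | P i) F i z).
Proof.
move=> Fi; elim: r => [|i r IH].
  by under eq_fun do rewrite big_nil; exact: csq0.
under eq_fun do rewrite big_cons; case Pi: (P i) => //.
by apply: csqD => //; exact: Fi.
Qed.

Lemma csq_mul F G : csq F -> csq G -> cintble (fun z => F z * G z).
Proof.
move=> [mF iF] [mG iG]; have [m1 m2] := cmeasM mF mG; split.
  by apply: rintble_le (rintbleD iF iG) => // z _; exact: norm_cReM.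
by apply: rintble_le (rintbleD iF iG) => // z _; exact: norm_cImM.
Qed.

Lemma nsqZ c F : csq F -> nsq (fun z => c * F z) = sqn c * nsq F.
Proof.
move=> [_ iF]; rewrite /nsq -RintegralZl//.
by apply: eq_Rintegral => z _; rewrite sqnM.
Qed.

Lemma nsqB F G : csq F -> csq G ->
  nsq (fun z => F z - G z) = nsq F - 2 * cRe (cint (fun z => F z * conjc (G z))) + nsq G.
Proof.
move=> cF cG; rewrite /nsq /= -RintegralZl//; last exact: (csq_mul cF (csqJ cG)).1.
have i1 := rintbleZ 2 (csq_mul cF (csqJ cG)).1.
rewrite -RintegralB//; last exact: (proj2 cF).
rewrite -RintegralD//; [|by apply: rintbleB => //; exact: (proj2 cF)|exact: (proj2 cG)].
by apply: eq_Rintegral => z _; rewrite sqnB.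
Qed.

(** The real part is bounded through the nonnegative quadratic polynomial [nsq (F - t conj G)] in
    the real variable [t]. The imaginary part is bounded in the same way after a rotation by [- i];
    adding the two bounds produces the factor 2. *)
Lemma cauchy_schwarz F G : csq F -> csq G ->
  sqn (cint (fun z => F z * G z)) <= 2 * (nsq F * nsq G).
Proof.
have re F' G' : csq F' -> csq G' ->
    cRe (cint (fun z => F' z * G' z)) ^+ 2 <= nsq F' * nsq G'.
  move=> cF cG; set B := cRe _; set A := nsq F'; set C := nsq G'.
  have H t : 0 <= A - 2 * t * B + t ^+ 2 * C.
    have := nsq_ge0 (fun z => F' z - t%:C%C * conjc (G' z)).
    have cG' := csqZ t%:C%C (csqJ cG).
    rewrite nsqB// nsqZ ?sqnC; last exact: csqJ.
    rewrite [X in t ^+ 2 * X](_ : _ = C); last by apply: eq_Rintegral => z _; rewrite sqnJ.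
    rewrite [X in cRe X](_ : _ = t%:C%C * cint (fun z => F' z * G' z)).
      by rewrite cpartE /= mul0r subr0 -/B mulrA.
    rewrite -cintZ; last exact: csq_mul.
    by apply: eq_cint => z _; rewrite conjcM conjcK conjc_real mulrCA.
  have [C0|C0] := eqVneq C 0; last first.
    have Cgt0 : 0 < C by rewrite lt_neqAle eq_sym C0 nsq_ge0.
    (* [B / C] is the minimum of the quadratic polynomial. *)
    have := H (B / C); rewrite (_ : _ + _ = A - B ^+ 2 / C); last by field.
    by rewrite subr_ge0 ler_pdivrMr.
  have [B0|B0] := eqVneq B 0; first by rewrite B0 expr0n mulr_ge0// nsq_ge0.
  (* For [C = 0] the polynomial is affine in [t]; at this point its value is [-1], a
     contradiction. *)
  have := H ((A + 1) / (2 * B)); rewrite C0 mulr0 addr0.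
  rewrite (_ : _ - _ = -1); last by field.
  by rewrite oppr_ge0 ler10.
move=> cF cG; rewrite /sqn mulr_natl mulr2n lerD ?re//.
have cF' := csqZ (- 'i%C) cF.
have -> : cIm (cint (fun z => F z * G z)) = cRe (cint (fun z => (- 'i%C * F z) * G z)).
  rewrite [in RHS](eq_cint (G := fun z => - 'i%C * (F z * G z))); last by move=> z _; rewrite mulrA.
  by rewrite cintZ ?cpartE; [rewrite /=; ring|exact: csq_mul].
by rewrite (le_trans (re _ _ cF' cG))// nsqZ// sqnN /sqn /= expr0n expr1n add0r mul1r.
Qed.

Hypothesis muD : (mu D < +oo)%E.

Lemma rintble_cst (c : R) : rintble (fun=> c).
Proof.
apply: measurable_bounded_integrable => //.
by exists `|c|; split; [exact: num_real|move=> x cx z _ /=; exact: ltW].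
Qed.

Lemma csq_bounded F (B : R) : cmeas F -> (forall z, D z -> sqn (F z) <= B) -> csq F.
Proof.
move=> mF FB; split => //; apply: rintble_le (rintble_cst B); first exact: cmeas_sqn.
by move=> z Dz; rewrite ger0_norm ?sqn_ge0// FB.
Qed.

Lemma csq_cintble F : csq F -> cintble F.
Proof.
move=> cF; have c1 : csq (fun=> 1) by apply: (csq_bounded (B := sqn 1)); [exact: cmeas_cst|].
by have := csq_mul cF c1; under eq_fun do rewrite mulr1.
Qed.

End complex_integral.
Arguments eq_cint {d T R mu D F G}.
Arguments eq_nsq {d T R mu D F G}.

(** * Bessel's inequality and the Riesz-Fischer theorem *)

Section almost_everywhere_limit.
Context d (T : measurableType d) (R : realType).
Variables (mu : {measure set T -> \bar R}) (D : set T).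
Hypothesis mD : measurable D.

Lemma cvg_of_summable_increments (w : R ^nat) :
  (\sum_(j <oo) `|w j.+1 - w j|%:E < +oo)%E -> cvgn w.
Proof.
move=> S; have S0 j : (0 <= `|w j.+1 - w j|%:E)%E by rewrite lee_fin.
have Sfin : (\sum_(j <oo) `|w j.+1 - w j|%:E)%E \is a fin_num.
  by rewrite ge0_fin_numE// nneseries_ge0.
have : cvgn (series (telescope w)).
  suff : cvgn (series (fun j => `|telescope w j|)) by move/normed_cvg.
  apply: nondecreasing_is_cvgn.
    by apply/nondecreasing_seqP => k; rewrite /series/= big_nat_recr//= lerDl.
  exists (fine (\sum_(j <oo) `|w j.+1 - w j|%:E)%E) => _ [k _ <-].
  rewrite -lee_fin fineK// /series/= -sumEFin.
  exact: (nneseries_lim_ge k (fun j _ _ => S0 j)).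
rewrite telescopeK => cw.
rewrite (_ : w = (fun k => w 0%N + [sequence w k - w 0%N]_k k)); last first.
  by apply/funext => k /=; rewrite addrC subrK.
by apply: is_cvgD => //; exact: is_cvg_cst.
Qed.

(** The integrals of the increments are bounded by a geometric series, so by monotone convergence
    the sum of the increments is integrable, hence finite almost everywhere, and the sequence
    converges there. *)
Lemma ae_cvg_of_increments (w : nat -> T -> R) (K : R) :
  (forall j, measurable_fun D (w j)) ->
  (forall j, (\int[mu]_(z in D) `|w j.+1 z - w j z|%:E <= (K / (2 ^ j.+1)%:R)%:E)%E) ->
  exists2 f : T -> R, measurable_fun D f & {ae mu, forall z, D z -> w^~ z @ \oo --> f z}.
Proof.
move=> mw iw; pose g j z : \bar R := `|w j.+1 z - w j z|%:E.
have mg j : measurable_fun D (g j).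
  by apply/measurable_EFinP; apply: measurableT_comp => //; exact: measurable_funB.
have g0 j z : D z -> (0 <= g j z)%E by move=> _; rewrite lee_fin.
(* The upper limit is measurable without any convergence, and it is the limit wherever the sequence
   converges. *)
exists (fun z => fine (limn_esup (fun j => (w j z)%:E))).
  apply: (measurableT_comp (f := fine)); first exact: fine_measurable.
  by apply: measurable_fun_limn_esup => j; exact/measurable_EFinP.
have ig : mu.-integrable D (fun z => \sum_(j <oo) g j z)%E.
  apply/integrableP; split.
    by apply: ge0_emeasurable_sum => // j z Dz _; exact: g0.
  rewrite (eq_integral (fun z => \sum_(j <oo) g j z)%E); last first.
    by move=> z /set_mem Dz; rewrite gee0_abs// nneseries_ge0// => j _ _; exact: g0.
  rewrite integral_nneseries//.
  apply: (@le_lt_trans _ _ K%:E); last exact: ltry.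
  have := @cvg_geometric_eseries_half R K 0; rewrite expr0 divr1 => /cvg_lim <- //.
  apply: lee_nneseries => j _; first by move=> _; apply: integral_ge0 => z; exact: g0.
  by rewrite addn1; exact: iw.
have := integrable_ae mD ig; apply: filterS => z /[apply] fz.
have cw : cvgn (w^~ z).
  apply: cvg_of_summable_increments.
  by rewrite -ge0_fin_numE// nneseries_ge0.
rewrite [X in _ --> X](_ : _ = limn (w^~ z))//.
rewrite is_cvg_limn_esupE; last by apply: cvgP; apply: cvg_EFin cw; exact: nearW.
by have := EFin_lim cw; rewrite /comp => ->.
Qed.

(** Fatou's lemma for the squared moduli, off the union of the two null sets where the real or the
    imaginary parts may fail to converge. *)
Lemma fatou_nsq (w : nat -> T -> R[i]) (F : T -> R[i]) (b : R ^nat) (b0 : R) :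
  (forall j, csq mu D (w j)) -> cmeas D F ->
  {ae mu, forall z, D z -> (fun j => cRe (w j z)) @ \oo --> cRe (F z)} ->
  {ae mu, forall z, D z -> (fun j => cIm (w j z)) @ \oo --> cIm (F z)} ->
  (forall j, nsq mu D (w j) <= b j) -> b @ \oo --> b0 ->
  csq mu D F /\ nsq mu D F <= b0.
Proof.
move=> cw mF reF imF wb bb0.
have [N1 [mN1 N10 reN]] := reF; have [N2 [mN2 N20 imN]] := imF.
pose N := N1 `|` N2; have mN : measurable N by exact: measurableU.
have N0 : mu N = 0%E by apply: null_set_setU.
have FN z : (D `\` N) z -> (fun j => sqn (w j z)) @ \oo --> sqn (F z).
  move=> [Dz /not_orP[N1z N2z]].
  have c1 : (fun j => cRe (w j z)) @ \oo --> cRe (F z).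
    by move/subsetCl : reN => /(_ z N1z); exact.
  have c2 : (fun j => cIm (w j z)) @ \oo --> cIm (F z).
    by move/subsetCl : imN => /(_ z N2z); exact.
  exact: cvgD (cvgM c1 c1) (cvgM c2 c2).
have mw j : measurable_fun D (fun z => (sqn (w j z))%:E).
  by apply/measurable_EFinP; exact: cmeas_sqn (cw j).1.
have msF : measurable_fun D (fun z => (sqn (F z))%:E).
  by apply/measurable_EFinP; exact: cmeas_sqn.
have DN : measurable (D `\` N) by exact: measurableD.
have F_le : (\int[mu]_(z in D) (sqn (F z))%:E <= b0%:E)%E.
  have E j : (\int[mu]_(z in D) (sqn (w j z))%:E <= (b j)%:E)%E.
    rewrite (_ : (\int[mu]_(_ in _) _)%E = (nsq mu D (w j))%:E) ?lee_fin//.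
    by rewrite /nsq /Rintegral fineK//; exact: (integrable_fin_num mD (cw j).2).
  rewrite (ge0_negligible_integral _ _ _ _ N0)//; last by move=> z _; rewrite lee_fin sqn_ge0.
  rewrite (eq_integral (fun z => limn_einf (fun j => (sqn (w j z))%:E))); last first.
    move=> z /set_mem DNz.
    have c : (fun j => (sqn (w j z))%:E) @ \oo --> (sqn (F z))%:E.
      exact: (cvg_comp _ _ (FN z DNz)).
    by rewrite is_cvg_limn_einfE; [rewrite (cvg_lim _ c)|apply: cvgP c].
  apply: le_trans (fatou mu DN _ _) _; first by move=> j; exact: measurable_funS (mw j).
    by move=> j z _; rewrite lee_fin sqn_ge0.
  (* The lower limit is a limit of infima over tails. Each infimum is at most any member of its
     tail, and every tail has a member with [b j <= b0 + e]. *)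
  rewrite limn_einf_lim; apply: lime_le; first exact: is_cvg_einfs.
  apply: nearW => k; apply/lee_addgt0Pr => e e0.
  have [j /= kj bj] : exists2 j, (k <= j)%N & b j <= b0 + e.
    have /(@cvgrPdist_le _ R^o) /(_ e e0) [j0 _ /(_ (maxn j0 k) (leq_maxl _ _)) /= h] := bb0.
    exists (maxn j0 k); first exact: leq_maxr.
    by rewrite addrC -lerBlDr (le_trans (ler_norm _))// distrC.
  apply: (@le_trans _ _ (\int[mu]_(z in D `\` N) (sqn (w j z))%:E)%E).
    by apply: ereal_inf_lbound; exists j.
  apply: le_trans (_ : (\int[mu]_(z in D) (sqn (w j z))%:E <= _)%E); last first.
    by apply: le_trans (E j) _; rewrite -EFinD lee_fin.
  apply: ge0_subset_integral => //; first by move=> z _; rewrite lee_fin sqn_ge0.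
have iF : rintble mu D (fun z => sqn (F z)).
  apply/integrableP; split => //.
  rewrite (eq_integral (fun z => (sqn (F z))%:E)); last first.
    by move=> z _ /=; rewrite ger0_norm ?sqn_ge0.
  exact: le_lt_trans F_le (ltry _).
split => //; rewrite -lee_fin /nsq /Rintegral fineK//.
exact: (integrable_fin_num mD iF).
Qed.

End almost_everywhere_limit.

Section orthonormal_family.
Context d (T : measurableType d) (R : realType).
Variables (mu : {measure set T -> \bar R}) (D : set T).
Hypothesis mD : measurable D.
Hypothesis muD : (mu D < +oo)%E.
Variables (I : eqType) (e : I -> T -> R[i]).
Hypothesis ce : forall i, csq mu D (e i).
Hypothesis orthonormal :
  forall i j, cintegral mu D (fun z => e i z * conjc (e j z)) = (i == j)%:R.
Implicit Types (c : I -> R[i]) (A : seq I) (F : T -> R[i]).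

(** Finite index sets are represented by sequences; the norm identities below therefore ask for
    [uniq]. *)
Definition fsum c A z := \sum_(i <- A) c i * e i z.

Lemma csq_fsum c A : csq mu D (fsum c A).
Proof. by apply: csq_sum => // i _; exact: csqZ. Qed.

Lemma cint_mulJ_fsum F c A : csq mu D F ->
  cintegral mu D (fun z => F z * conjc (fsum c A z)) =
  \sum_(i <- A) conjc (c i) * cintegral mu D (fun z => F z * conjc (e i z)).
Proof.
move=> cF; have iFe i : cintble mu D (fun z => F z * conjc (e i z)).
  by apply: csq_mul => //; exact: csqJ.
rewrite (eq_cint (G := fun z => \sum_(i <- A) conjc (c i) * (F z * conjc (e i z)))).
  by rewrite cint_sum//; [apply: eq_bigr => i _; rewrite cintZ|move=> i _; exact: cintbleZ].
move=> z _; rewrite /fsum rmorph_sum/= mulr_sumr; apply: eq_bigr => i _.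
by rewrite conjcM mulrCA.
Qed.

Lemma cint_fsum_mulJ c A i : uniq A ->
  cintegral mu D (fun z => fsum c A z * conjc (e i z)) = if i \in A then c i else 0.
Proof.
move=> uA; have iee j : cintble mu D (fun z => e j z * conjc (e i z)).
  by apply: csq_mul => //; exact: csqJ.
rewrite (eq_cint (G := fun z => \sum_(j <- A) c j * (e j z * conjc (e i z)))); last first.
  by move=> z _; rewrite /fsum mulr_suml; apply: eq_bigr => j _; rewrite mulrA.
rewrite cint_sum//; last by move=> j _; exact: cintbleZ.
case: ifPn => iA.
  rewrite (bigD1_seq i)//= cintZ// orthonormal eqxx mulr1 big1 ?addr0// => j ji.
  by rewrite cintZ// orthonormal (negbTE ji) mulr0.
rewrite big_seq big1// => j jA; rewrite cintZ// orthonormal; case: eqP => [ji|_].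
  by rewrite -ji jA in iA.
by rewrite mulr0.
Qed.

Lemma nsq_cRe F : nsq mu D F = cRe (cintegral mu D (fun z => F z * conjc (F z))).
Proof. by rewrite /nsq/=; apply: eq_Rintegral => z _; rewrite mulcJ. Qed.

Lemma nsq_fsum c A : uniq A -> nsq mu D (fsum c A) = \sum_(i <- A) sqn (c i).
Proof.
move=> uA; rewrite nsq_cRe cint_mulJ_fsum; last exact: csq_fsum.
rewrite cRe_sum; apply: eq_big_seq => i iA.
by rewrite cint_fsum_mulJ// iA mulrC mulcJ.
Qed.

Lemma nsq_fsumB c A B : uniq A -> uniq B ->
  nsq mu D (fun z => fsum c A z - fsum c B z) =
  \sum_(i <- A | i \notin B) sqn (c i) + \sum_(i <- B | i \notin A) sqn (c i).
Proof.
move=> uA uB; rewrite nsqB//; [|exact: csq_fsum..].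
rewrite !nsq_fsum// cint_mulJ_fsum; last exact: csq_fsum.
rewrite cRe_sum [X in 2 * X](eq_bigr (fun i => if i \in A then sqn (c i) else 0)); last first.
  move=> i _; rewrite (cint_fsum_mulJ _ _ uA); case: ifP => _; last by rewrite mulr0.
  by rewrite mulrC mulcJ.
rewrite -big_mkcond/= (bigID (fun i => i \in B) xpredT)/= (bigID (fun i => i \in A) xpredT (fun i => sqn (c i)))/=.
suff -> : \sum_(i <- A | i \in B) sqn (c i) = \sum_(i <- B | i \in A) sqn (c i) by ring.
rewrite -[LHS]big_filter -[RHS]big_filter; apply: perm_big.
by apply: uniq_perm; rewrite ?filter_uniq// => i; rewrite !mem_filter andbC.
Qed.

Lemma bessel F A : csq mu D F -> uniq A ->
  \sum_(i <- A) sqn (cintegral mu D (fun z => F z * conjc (e i z))) <= nsq mu D F.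
Proof.
move=> cF uA; pose c i := cintegral mu D (fun z => F z * conjc (e i z)).
have := nsq_ge0 mu D (fun z => F z - fsum c A z).
rewrite nsqB//; last exact: csq_fsum.
rewrite nsq_fsum// cint_mulJ_fsum// cRe_sum -/(c _).
under [X in _ - 2 * X]eq_bigr => i _ do rewrite -/(c i) mulrC mulcJ/=.
by rewrite -/c; lra.
Qed.

(** A weighted inequality with a free parameter [t]: on a set of finite measure it bounds an L^1
    norm by a squared L^2 norm, and [t] is adapted to the size of the latter. *)
Lemma norm_le_sqr (t x : R) : 0 < t -> `|x| <= t * x ^+ 2 + t^-1.
Proof.
move=> t0; rewrite -[x ^+ 2]real_normK ?num_real//.
have [xt|xt] := leP `|x| t^-1.
  by rewrite ler_wpDl// mulr_ge0 ?sqr_ge0// ltW.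
rewrite ler_wpDr ?invr_ge0 ?(ltW t0)// expr2 mulrA ler_peMl//.
by rewrite -(mulfV (lt0r_neq0 t0)) ler_wpM2l// ltW.
Qed.

Lemma int_norm_le_nsq (f : T -> R) F (t b : R) : 0 < t -> measurable_fun D f ->
  csq mu D F -> (forall z, `|f z| ^+ 2 <= sqn (F z)) -> nsq mu D F <= b ->
  (\int[mu]_(z in D) `|f z|%:E <= (t * b + t^-1 * fine (mu D))%:E)%E.
Proof.
move=> t0 mf cF fF Fb.
have i1 : rintble mu D (fun z => t * sqn (F z) + t^-1).
  by apply: rintbleD => //; [apply: rintbleZ => //; exact: cF.2|exact: rintble_cst].
apply: (@le_trans _ _ (\int[mu]_(z in D) (t * sqn (F z) + t^-1)%:E)%E).
  apply: ge0_le_integral => //.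
  - by apply/measurable_EFinP; exact: measurableT_comp.
  - exact: measurable_int i1.
  - move=> z _; rewrite lee_fin; apply: le_trans (norm_le_sqr (f z) t0) _.
    by rewrite lerD2r ler_wpM2l ?(ltW t0)// -[f z ^+ 2]real_normK ?num_real.
rewrite -[leLHS]fineK; last exact: integrable_fin_num.
rewrite lee_fin -/(Rintegral mu D _) RintegralD//; last 2 first.
- by apply: rintbleZ => //; exact: cF.2.
- exact: rintble_cst.
rewrite RintegralZl//; last exact: cF.2.
by rewrite Rintegral_cst// lerD2r ler_wpM2l// ltW.
Qed.

(* [s] is the sum of the series of the [sqn (c i)]. *)
Lemma riesz_fischer c (B : R) :
  (forall A, uniq A -> \sum_(i <- A) sqn (c i) <= B) ->
  exists F (s : R), [/\ csq mu D F, s <= B,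
    forall eps, 0 < eps -> exists2 A, uniq A & s - eps < \sum_(i <- A) sqn (c i),
    forall A, uniq A -> \sum_(i <- A) sqn (c i) <= s &
    forall A, uniq A -> nsq mu D (fun z => F z - fsum c A z) <= s - \sum_(i <- A) sqn (c i)].
Proof.
move=> cB; pose E := [set \sum_(i <- A) sqn (c i) | A in [set A | uniq A]].
have E0 : E !=set0 by exists (\sum_(i <- [::]) sqn (c i)); exists [::].
have EB : ubound E B by move=> _ [A uA <-]; exact: cB.
have hE : has_sup E by split => //; exists B.
pose s := sup E.
have s_ub A : uniq A -> \sum_(i <- A) sqn (c i) <= s.
  by move=> uA; apply: sup_upper_bound => //; exists A.
have s_adh eps : 0 < eps -> exists2 A, uniq A & s - eps < \sum_(i <- A) sqn (c i).
  by move=> e0; have [_ [A uA <-] ?] := sup_adherent e0 hE; exists A.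
(* Finite sets that miss at most [4 ^ - j] of the total mass [s]: partial sums over them then differ
   by [O(2 ^ - j)] in norm, which is summable. *)
have [A_ A_P] : {A_ : nat -> seq I & forall j, uniq (A_ j) /\
    s - 4^-1 ^+ j < \sum_(i <- A_ j) sqn (c i)}.
  apply: (@boolp.choice _ _ (fun j A => uniq A /\ s - 4^-1 ^+ j < \sum_(i <- A) sqn (c i))) => j; have := s_adh (4^-1 ^+ j).
  by rewrite exprn_gt0// => /(_ isT) [A ? ?]; exists A.
have uA j := (A_P j).1.
have dist A B' : uniq A -> uniq B' -> nsq mu D (fun z => fsum c A z - fsum c B' z) <=
    (s - \sum_(i <- A) sqn (c i)) + (s - \sum_(i <- B') sqn (c i)).
  move=> uA' uB'; rewrite nsq_fsumB// addrC.
  (* [A1] together with the part of [A2] outside [A1] is again a finite set without repetition, so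
     its mass is at most [s]. *)
  have half A1 A2 : uniq A1 -> uniq A2 ->
      \sum_(i <- A2 | i \notin A1) sqn (c i) <= s - \sum_(i <- A1) sqn (c i).
    move=> u1 u2; rewrite lerBrDr addrC -[X in _ + X]big_filter -big_cat; apply: s_ub.
    rewrite cat_uniq u1 filter_uniq// andbT; apply/hasPn => i.
    by rewrite mem_filter => /andP[].
  by rewrite lerD// half.
pose w j := fsum c (A_ j).
have cw j : csq mu D (w j) by exact: csq_fsum.
have dw j : nsq mu D (fun z => w j.+1 z - w j z) <= 2 * 4^-1 ^+ j.
  apply: le_trans (dist _ _ (uA _) (uA _)) _; rewrite mulr_natl mulr2n.
  have := (A_P j).2; have := (A_P j.+1).2.
  rewrite !ltrBlDr => h1 h2; apply: lerD; last by rewrite lerBlDr addrC ltW.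
  rewrite lerBlDr addrC (le_trans (ltW h1))// lerD2l exprS ler_piMl ?exprn_ge0//.
  by rewrite invf_le1// ler1n.
(* With squared norm at most [2 * 4 ^ - j] and weight [t = 2 ^ j], the L^1 bound is
   [(2 + mu D) / 2 ^ j], that is [K / 2 ^ j.+1]. *)
pose K : R := 2 * (2 + fine (mu D)).
have iw (f : nat -> T -> R) : (forall j, measurable_fun D (f j)) ->
    (forall j z, `|f j.+1 z - f j z| ^+ 2 <= sqn (w j.+1 z - w j z)) ->
    forall j, (\int[mu]_(z in D) `|f j.+1 z - f j z|%:E <= (K / (2 ^ j.+1)%:R)%:E)%E.
  move=> mf fw j; have := @int_norm_le_nsq (fun z => f j.+1 z - f j z)
    (fun z => w j.+1 z - w j z) (2 ^+ j) _ _ _ _ (fw j) (dw j).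
  rewrite exprn_gt0// => /(_ isT (measurable_funB (mf _) (mf _)) (csqB mD (cw _) (cw _))).
  move=> /le_trans; apply; rewrite lee_fin le_eqVlt; apply/orP; left; apply/eqP.
  have -> : 4^-1 ^+ j = ((2 ^+ j) ^+ 2)^-1 :> R.
    by rewrite exprVn -exprM mulnC exprM expr2 -natrM.
  rewrite /K natrX [2 ^+ j.+1]exprS; have : 2 ^+ j != 0 :> R by rewrite expf_neq0.
  by move: (2 ^+ j) (fine _) => a b a0; field.
have [fr mfr cfr] := ae_cvg_of_increments mD (fun j => (cw j).1.1) (iw (fun j z => cRe (w j z))
   (fun j => (cw j).1.1) (fun j z => ltac:(by rewrite real_normK ?num_real// -cReB lerDl sqr_ge0))).
have [fi mfi cfi] := ae_cvg_of_increments mD (fun j => (cw j).1.2) (iw (fun j z => cIm (w j z))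
   (fun j => (cw j).1.2) (fun j z => ltac:(by rewrite real_normK ?num_real// -cImB lerDr sqr_ge0))).
pose F z := Complex (fr z) (fi z).
have mF : cmeas D F by split.
(* Passage to the limit in [dist (A_ j) A], where the mass missed by [A_ j] tends to 0. *)
have lim A : uniq A -> csq mu D (fun z => F z - fsum c A z) /\
    nsq mu D (fun z => F z - fsum c A z) <= s - \sum_(i <- A) sqn (c i).
  move=> uA'; apply: (@fatou_nsq _ _ _ mu D mD (fun j z => w j z - fsum c A z) _
    (fun j => 4^-1 ^+ j + (s - \sum_(i <- A) sqn (c i)))).
  - by move=> j; apply: csqB => //; exact: csq_fsum.
  - by apply: cmeasB => //; exact: (csq_fsum c A).1.
  - apply: filterS cfr => z /[apply] h; rewrite cReB.
    by under eq_fun do rewrite cReB; apply: cvgB => //; exact: cvg_cst.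
  - apply: filterS cfi => z /[apply] h; rewrite cImB.
    by under eq_fun do rewrite cImB; apply: cvgB => //; exact: cvg_cst.
  - move=> j; apply: le_trans (dist _ _ (uA j) uA') _; rewrite lerD2r lerBlDr addrC -lerBlDr ltW//.
    exact: (A_P j).2.
  - rewrite -[X in _ --> X]add0r; apply: cvgD; last exact: cvg_cst.
    by apply: cvg_expr; rewrite ger0_norm// invf_lt1// ltr1n.
exists F, s; split => //.
- have [cF _] := lim [::] isT.
  by apply: eq_csq cF => // z _; rewrite /fsum big_nil subr0.
- by apply: sup_le_ub.
- by move=> A /lim[].
Qed.

End orthonormal_family.

(** * Integration and totality on products *)

Section fubini_on_products.
Context d1 d2 (T1 : measurableType d1) (T2 : measurableType d2) (R : realType).
Variables (m1 : {sigma_finite_measure set T1 -> \bar R}).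
Variables (m2 : {sigma_finite_measure set T2 -> \bar R}).
Variables (D1 : set T1) (D2 : set T2).
Hypotheses (mD1 : measurable D1) (mD2 : measurable D2).

Let mm : {measure set (T1 * T2) -> \bar R} := (m1 \x m2)%E.
Let mD12 : measurable (D1 `*` D2). Proof. exact: measurableX. Qed.

Let patch_slice (f : T1 * T2 -> \bar R) x y :
  (f \_ (D1 `*` D2)) (x, y) = if x \in D1 then ((fun y => f (x, y)) \_ D2) y else 0%E.
Proof. by rewrite /patch in_setX; case: (x \in D1). Qed.

Let int_patch_slice (f : T1 * T2 -> \bar R) x :
  (\int[m2]_y (f \_ (D1 `*` D2)) (x, y))%E =
  ((fun x => \int[m2]_(y in D2) f (x, y))%E \_ D1) x.
Proof.
under eq_integral do rewrite patch_slice.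
by rewrite /patch; case: ifP => xD1; [rewrite [RHS]integral_mkcond|rewrite integral0].
Qed.

(** Extension of [f] by 0 outside the rectangle reduces to the whole product space; the inner
    integral is then itself an extension by 0. *)
Lemma tonelli_on (f : T1 * T2 -> \bar R) : measurable_fun (D1 `*` D2) f ->
  (forall z, (D1 `*` D2) z -> (0 <= f z)%E) ->
  measurable_fun D1 (fun x => \int[m2]_(y in D2) f (x, y))%E /\
  (\int[m1 \x m2]_(z in D1 `*` D2) f z = \int[m1]_(x in D1) \int[m2]_(y in D2) f (x, y))%E.
Proof.
move=> mf f0; have mg := (measurable_restrictT f mD12).1 mf.
have g0 z : (0 <= (f \_ (D1 `*` D2)) z)%E by apply: erestrict_ge0 => ? ?; exact: f0.
split.
  apply/(measurable_restrictT _ mD1).2.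
  have := measurable_fun_fubini_tonelli_F (m2 := m2) _ mg g0.
  by rewrite /fubini_F; under eq_fun do rewrite int_patch_slice.
rewrite integral_mkcond fubini_tonelli1// /fubini_F.
by under eq_integral do rewrite int_patch_slice; rewrite -integral_mkcond.
Qed.

(** The inner integral is finite for almost every [x] only. [Rintegral] replaces an infinite value
    by 0, which changes the outer integrand on a null set. *)
Lemma rfubini_on (f : T1 * T2 -> R) : rintble mm (D1 `*` D2) f ->
  [/\ rintble m1 D1 (fun x => \int[m2]_(y in D2) f (x, y)),
      \int[mm]_(z in D1 `*` D2) f z = \int[m1]_(x in D1) \int[m2]_(y in D2) f (x, y) &
      {ae m1, forall x, D1 x -> rintble m2 D2 (fun y => f (x, y))}].
Proof.
move=> fi; have gi := (integrable_mkcond _ mD12).1 fi.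
pose Phi x := (\int[m2]_(y in D2) (f (x, y))%:E)%E.
have Phi_i : m1.-integrable D1 Phi.
  apply/(integrable_mkcond _ mD1); have := integrable_fubini_F gi.
  by rewrite /fubini_F (_ : (fun x => _) = Phi \_ D1)//; apply/funext => x; exact: int_patch_slice.
have Phi_fin := integrable_ae mD1 Phi_i.
have fPhi_i : rintble m1 D1 (fun x => \int[m2]_(y in D2) f (x, y)).
  apply: (@le_integrable _ _ _ _ _ mD1 _ Phi _ _ Phi_i).
    by apply/measurable_EFinP; apply: (measurableT_comp (f := fine)) => //; exact: measurable_int Phi_i.
  move=> x _; rewrite /= /Rintegral -/(Phi x).
  by case: (Phi x) => [r| |]; rewrite /= ?normr0 ?leey.
split => //.
- rewrite /Rintegral integral_mkcond.
  rewrite -(integral12_prod_meas1 gi) /fubini_F.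
  rewrite [X in fine X = _](eq_integral (Phi \_ D1)); last by move=> x _; exact: int_patch_slice.
  rewrite -integral_mkcond; congr fine; apply: ae_eq_integral => //.
  + exact: measurable_int Phi_i.
  + exact: measurable_int fPhi_i.
  + by apply: filterS Phi_fin => x h D1x; rewrite fineK ?h.
- have := ae_integrable1 gi; apply: filterS => x h D1x.
  apply/(integrable_mkcond _ mD2); apply: eq_integrable h => // y _.
  by rewrite patch_slice mem_set.
Qed.

Lemma cfubini_on (F : T1 * T2 -> R[i]) : cintble mm (D1 `*` D2) F ->
  [/\ cintble m1 D1 (fun x => cintegral m2 D2 (fun y => F (x, y))),
      cintegral mm (D1 `*` D2) F = cintegral m1 D1 (fun x => cintegral m2 D2 (fun y => F (x, y))) &
      {ae m1, forall x, D1 x -> cintble m2 D2 (fun y => F (x, y))}].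
Proof.
move=> [/rfubini_on[i1 e1 a1] /rfubini_on[i2 e2 a2]]; split => //.
  by rewrite /cintegral e1 e2.
by apply: filterS2 a1 a2 => x h1 h2 D1x; split; [exact: h1|exact: h2].
Qed.

End fubini_on_products.

Section fubini_swap.
Context d1 d2 (T1 : measurableType d1) (T2 : measurableType d2) (R : realType).
Variables (m1 : {sigma_finite_measure set T1 -> \bar R}).
Variables (m2 : {sigma_finite_measure set T2 -> \bar R}).
Variables (D1 : set T1) (D2 : set T2).
Hypotheses (mD1 : measurable D1) (mD2 : measurable D2).

Let mm : {measure set (T1 * T2) -> \bar R} := (m1 \x m2)%E.

Lemma rfubini_on_swap (f : T1 * T2 -> R) : rintble mm (D1 `*` D2) f ->
  [/\ rintble m2 D2 (fun y => \int[m1]_(x in D1) f (x, y)),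
      \int[mm]_(z in D1 `*` D2) f z = \int[m2]_(y in D2) \int[m1]_(x in D1) f (x, y) &
      {ae m2, forall y, D2 y -> rintble m1 D1 (fun x => f (x, y))}].
Proof.
move=> fi; have gi := (integrable_mkcond _ (measurableX mD1 mD2)).1 fi.
have mg := measurable_int _ gi.
pose Phi y := (\int[m1]_(x in D1) (f (x, y))%:E)%E.
have slice y : (\int[m1]_x ((EFin \o f) \_ (D1 `*` D2)) (x, y))%E = (Phi \_ D2) y.
  rewrite /patch; case: ifPn => yD2.
    rewrite /Phi [RHS]integral_mkcond; apply: eq_integral => x _.
    by rewrite /patch in_setX yD2 andbT.
  rewrite -[RHS](@integral0 _ _ _ m1 setT); apply: eq_integral => x _.
  by rewrite in_setX (negbTE yD2) andbF.
have Phi_i : m2.-integrable D2 Phi.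
  apply/(integrable_mkcond _ mD2); rewrite (_ : Phi \_ D2 = fubini_G m1 ((EFin \o f) \_ (D1 `*` D2))); last first.
    by apply/funext => y; exact/esym/slice.
  apply/integrableP; split; first exact: measurable_fubini_G gi.
  apply: le_lt_trans ((integrable21ltyP m1 m2 mg).1 gi).
  apply: ge0_le_integral; [by []|by []|..].
  - by apply: measurableT_comp => //; exact: measurable_fubini_G gi.
  - by apply: (@measurable_fun_fubini_tonelli_G _ _ _ _ _ m1 (abse \o ((EFin \o f) \_ (D1 `*` D2)))) => //;
      [exact: measurableT_comp|move=> z; exact: abse_ge0].
  - move=> y _; apply: le_abse_integral => //.
    exact: (measurableT_comp mg (measurable_pair2 y)).
have mPhi := measurable_int _ Phi_i.
have Phi_fin := integrable_ae mD2 Phi_i.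
have fPhi_i : rintble m2 D2 (fun y => \int[m1]_(x in D1) f (x, y)).
  apply: (@le_integrable _ _ _ _ _ mD2 _ Phi _ _ Phi_i).
    by apply/measurable_EFinP; apply: (measurableT_comp (f := fine)).
  move=> y _; rewrite /= /Rintegral -/(Phi y).
  by case: (Phi y) => [r| |]; rewrite /= ?normr0 ?leey.
split => //; last first.
  have := ae_integrable2 gi; apply: filterS => y h D2y.
  apply/(integrable_mkcond _ mD1); apply: eq_integrable h => // x _.
  by rewrite /patch in_setX [y \in D2]mem_set// andbT.
rewrite /Rintegral integral_mkcond -(integral21_prod_meas1 gi) /fubini_G.
rewrite [X in fine X = _](eq_integral (Phi \_ D2)); last by move=> y _; exact: slice.
rewrite -integral_mkcond; congr fine; apply: ae_eq_integral => //.
- exact: measurable_int fPhi_i.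
- by apply: filterS Phi_fin => y h D2y; rewrite fineK ?h.
Qed.

Lemma cfubini_on_swap (F : T1 * T2 -> R[i]) : cintble mm (D1 `*` D2) F ->
  [/\ cintble m2 D2 (fun y => cintegral m1 D1 (fun x => F (x, y))),
      cintegral mm (D1 `*` D2) F = cintegral m2 D2 (fun y => cintegral m1 D1 (fun x => F (x, y))) &
      {ae m2, forall y, D2 y -> cintble m1 D1 (fun x => F (x, y))}].
Proof.
move=> [/rfubini_on_swap[i1 e1 a1] /rfubini_on_swap[i2 e2 a2]]; split => //.
  by rewrite /cintegral e1 e2.
by apply: filterS2 a1 a2 => y h1 h2 D2y; split; [exact: h1|exact: h2].
Qed.

End fubini_swap.

Section totality.
Context d (T : measurableType d) (R : realType).

(** The test ranges over integrable functions, a class preserved by integrating out one variable.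
    There is no conjugation: the characters used later are closed under it. *)
Definition ctotal (mu : {measure set T -> \bar R}) (D : set T) (I : Type)
    (e : I -> T -> R[i]) :=
  forall F, cintble mu D F -> (forall i, cintegral mu D (fun z => F z * e i z) = 0) ->
  {ae mu, forall z, D z -> F z = 0}.

End totality.

Section product_totality.
Context d1 d2 (T1 : measurableType d1) (T2 : measurableType d2) (R : realType).
Variables (m1 : {sigma_finite_measure set T1 -> \bar R}).
Variables (m2 : {sigma_finite_measure set T2 -> \bar R}).
Variables (D1 : set T1) (D2 : set T2).
Hypotheses (mD1 : measurable D1) (mD2 : measurable D2).

Let mm : {measure set (T1 * T2) -> \bar R} := (m1 \x m2)%E.
Let mD12 : measurable (D1 `*` D2). Proof. exact: measurableX. Qed.

(** By Tonelli the integral of the modulus of [f] is an iterated integral whose inner integral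
    vanishes almost everywhere. *)
Lemma ae_zero_prod (f : T1 * T2 -> R) : rintble mm (D1 `*` D2) f ->
  {ae m1, forall x, D1 x -> {ae m2, forall y, D2 y -> f (x, y) = 0}} ->
  {ae mm, forall z, (D1 `*` D2) z -> f z = 0}.
Proof.
move=> fi ae0; have mf := measurable_int _ fi.
have mnf : measurable_fun (D1 `*` D2) (fun z => `|(f z)%:E|%E).
  by apply: measurableT_comp => //; exact: mf.
have [mI E] := tonelli_on m1 m2 mD1 mD2 mnf (fun z _ => abse_ge0 (f z)%:E).
have I0 : (\int[mm]_(z in D1 `*` D2) `|(f z)%:E| = 0)%E.
  rewrite E; apply/eqP; rewrite eq_le integral_ge0 ?andbT; last first.
    by move=> x _; apply: integral_ge0 => y _; rewrite lee_fin.
  rewrite [leLHS](ae_eq_integral (fun=> 0%E)) ?integral0//.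
  have [i1 _ a1] := rfubini_on mD1 mD2 fi.
  apply: filterS2 ae0 a1 => x h1 h2 D1x.
  apply/(ae_eq_integral_abs m2 mD2 (measurable_int _ (h2 D1x))).
  by apply: filterS (h1 D1x) => y h D2y; rewrite /= h.
have /(ae_eq_integral_abs _ mD12 mf) := I0.
by apply: filterS => z /[apply] /= [[]].
Qed.

(** For each [j] the partial pairing [G j] in the second variable is annihilated by all [e1 i],
    hence vanishes almost everywhere. For almost every [x] the slice [F (x, .)] is then annihilated
    by all [e2 j]. *)
Lemma ctotal_prod (I1 : Type) (I2 : countType) (e1 : I1 -> T1 -> R[i]) (e2 : I2 -> T2 -> R[i]) :
  (forall i, cmeas D1 (e1 i)) -> (forall i x, D1 x -> sqn (e1 i x) <= 1) ->
  (forall j, cmeas D2 (e2 j)) -> (forall j y, D2 y -> sqn (e2 j y) <= 1) ->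
  ctotal m1 D1 e1 -> ctotal m2 D2 e2 ->
  ctotal mm (D1 `*` D2) (fun (ij : I1 * I2) z => e1 ij.1 z.1 * e2 ij.2 z.2).
Proof.
move=> me1 e1_1 me2 e2_1 tot1 tot2 F iF F0.
have me2' j : cmeas (D1 `*` D2) (fun z : T1 * T2 => e2 j z.2).
  have [m3 m4] := me2 j; split.
    by apply: (measurable_comp mD2 _ m3) => [_ [z [_ ?] <-]//|]; exact: measurable_funTS measurable_snd.
  by apply: (measurable_comp mD2 _ m4) => [_ [z [_ ?] <-]//|]; exact: measurable_funTS measurable_snd.
have iFe j : cintble mm (D1 `*` D2) (fun z => F z * e2 j z.2).
  by apply: cintbleM1 => // z [_ ?]; exact: e2_1.
have me1' i : cmeas (D1 `*` D2) (fun z : T1 * T2 => e1 i z.1).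
  have [m3 m4] := me1 i; split.
    by apply: (measurable_comp mD1 _ m3) => [_ [z [? _] <-]//|]; exact: measurable_funTS measurable_fst.
  by apply: (measurable_comp mD1 _ m4) => [_ [z [? _] <-]//|]; exact: measurable_funTS measurable_fst.
have iFee i j : cintble mm (D1 `*` D2) (fun z => F z * e2 j z.2 * e1 i z.1).
  by apply: cintbleM1 => // z [? _]; exact: e1_1.
pose G j x := cintegral m2 D2 (fun y => F (x, y) * e2 j y).
have G0 j : {ae m1, forall x, D1 x -> G j x = 0}.
  have [iG _ aG] := cfubini_on mD1 mD2 (iFe j); apply: tot1 => // i.
  have [iH EH aH] := cfubini_on mD1 mD2 (iFee i j).
  rewrite -(F0 (i, j)) (eq_cint (G := fun z => F z * e2 j z.2 * e1 i z.1)); last first.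
    by move=> z _; rewrite -mulrA [e1 _ _ * _]mulrC.
  rewrite EH; apply: ae_eq_cint => //.
  - by apply: cmeasM => //; exact: cintble_meas iG.
  - exact: cintble_meas iH.
  - apply: filterS aG => x h D1x; rewrite /= mulrC -(cintZ mD2 _ (h D1x)).
    by apply: eq_cint => y _; rewrite mulrC.
(* The exceptional null sets depend on [j]; countability of [I2], through [pickle], gives a common
   one. *)
have aG0 : {ae m1, forall x, D1 x -> forall j, G j x = 0}.
  have : {ae m1, forall x, forall k : nat, D1 x -> forall j, unpickle k = Some j -> G j x = 0}.
    apply: ae_foralln => k; case E : (unpickle k) => [j|]; last exact: nearW.
    by apply: filterS (G0 j) => x h D1x _ [<-]; exact: h.
  by apply: filterS => x h D1x j; apply: (h (pickle j) D1x); rewrite pickleK.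
have [_ _ aF] := cfubini_on mD1 mD2 iF.
have aF0 : {ae m1, forall x, D1 x -> {ae m2, forall y, D2 y -> F (x, y) = 0}}.
  apply: filterS2 aG0 aF => x h1 h2 D1x.
  by apply: tot2 (h2 D1x) _ => j; exact: h1.
have ar : {ae mm, forall z, (D1 `*` D2) z -> cRe (F z) = 0}.
  apply: ae_zero_prod; first exact: iF.1.
  by apply: filterS aF0 => x h D1x; apply: filterS (h D1x) => y {}h D2y; rewrite h.
have ai : {ae mm, forall z, (D1 `*` D2) z -> cIm (F z) = 0}.
  apply: ae_zero_prod; first exact: iF.2.
  by apply: filterS aF0 => x h D1x; apply: filterS (h D1x) => y {}h D2y; rewrite h.
by apply: filterS2 ar ai => z h1 h2 Dz; apply: eq_cparts; [rewrite h1|rewrite h2].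
Qed.

End product_totality.

(** * Totality of the trigonometric system *)

Section expi.
Context (R : realType).
Implicit Types a b : R.

Definition expi a : R[i] := Complex (cos a) (sin a).

Lemma expi0 : expi 0 = 1. Proof. by rewrite /expi cos0 sin0. Qed.

Lemma expiD a b : expi (a + b) = expi a * expi b.
Proof. by apply: eq_cparts; rewrite !cpartE /= ?cosD ?sinD// addrC. Qed.

Lemma conjc_expi a : conjc (expi a) = expi (- a).
Proof. by rewrite /expi cosN sinN. Qed.

Lemma sqn_expi a : sqn (expi a) = 1.
Proof. exact: cos2Dsin2. Qed.

Lemma expi2pi (k : int) : expi (2 * pi * k%:~R) = 1.
Proof.
have expi_nat (n : nat) : expi (2 * pi * n%:R) = 1.
  elim: n => [|n IH]; first by rewrite mulr0 expi0.
  rewrite -(natr1 n) mulrDr expiD IH mul1r mulr1 mulr_natl.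
  by rewrite /expi cos2pi sin2pi.
case: k => n; first exact: expi_nat.
by rewrite NegzE rmorphN/= mulrN -conjc_expi (expi_nat n.+1) conjc1.
Qed.

Lemma cos_expi a : (cos a)%:C%C = 2^-1%:C%C * (expi a + expi (- a)).
Proof.
apply: eq_cparts; rewrite !cpartE /= ?cosN ?sinN; first by field.
by ring.
Qed.

Lemma cmeas_expi d (T : measurableType d) (D : set T) (th : T -> R) :
  measurable_fun D th -> cmeas D (fun z => expi (th z)).
Proof.
move=> mth; split.
  apply: (measurableT_comp (f := @cos R)) => //.
  exact: (continuous_measurable_fun (@continuous_cos R)).
apply: (measurableT_comp (f := @sin R)) => //.
exact: (continuous_measurable_fun (@continuous_sin R)).
Qed.

End expi.

Section step_sequence.
Context (R : realType).

(* Tends to the indicator of [[0, 1/2[] off the point [1/2]. *)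
Definition step_seq (v : R) (n : nat) : R := (1 - v ^+ n) ^+ (2 ^ n).

Lemma bernoulli_ge (x : R) n : -1 <= x -> 1 + n%:R * x <= (1 + x) ^+ n.
Proof.
move=> x1; elim: n => [|n IH]; first by rewrite mul0r addr0 expr0.
rewrite exprS; apply: (@le_trans _ _ ((1 + x) * (1 + n%:R * x))); last first.
  by rewrite ler_wpM2l// -lerBlDl sub0r.
rewrite -subr_ge0 -(natr1 n) (_ : _ - _ = n%:R * x ^+ 2); last by ring.
by rewrite mulr_ge0// sqr_ge0.
Qed.

Lemma step_seq01 (v : R) n : 0 <= v <= 1 -> 0 <= step_seq v n <= 1.
Proof.
move=> /andP[v0 v1]; have vn1 : v ^+ n <= 1 by rewrite exprn_ile1.
by rewrite /step_seq exprn_ge0 ?subr_ge0//= exprn_ile1 ?subr_ge0// gerBl exprn_ge0.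
Qed.

(** Bernoulli's inequality gives [(1 - v ^ n) ^ (2 ^ n) >= 1 - (2 v) ^ n], and [2 v < 1]. *)
Lemma step_seq_cvg1 (v : R) : 0 <= v < 2^-1 -> step_seq v @ \oo --> (1 : R).
Proof.
move=> /andP[v0 v2]; have v1 : v <= 1.
  by rewrite (le_trans (ltW v2))// invf_le1// ler1n.
apply: (@squeeze_cvgr _ _ _ _ (fun n => 1 - (2 * v) ^+ n) (fun=> 1)); last 2 first.
- rewrite -[X in _ --> X]subr0; apply: cvgB; first exact: cvg_cst.
  apply: cvg_expr; rewrite ger0_norm ?mulr_ge0//.
  by rewrite -ltr_pdivlMl// mulr1.
- exact: cvg_cst.
apply: nearW => n; have /andP[_ ->] := @step_seq01 v n (introT andP (conj v0 v1)).
rewrite andbT /step_seq; have := @bernoulli_ge (- v ^+ n) (2 ^ n).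
rewrite lerN2 exprn_ile1// => /(_ isT); rewrite mulrN natrX -exprMn.
exact.
Qed.

(** Since [(1 - v ^ n) (1 + v ^ n) <= 1], the sequence is at most the inverse of
    [(1 + v ^ n) ^ (2 ^ n)], and Bernoulli's inequality bounds that power below by [(2 v) ^ n], with
    [2 v > 1]. *)
Lemma step_seq_cvg0 (v : R) : 2^-1 < v <= 1 -> step_seq v @ \oo --> (0 : R).
Proof.
move=> /andP[v2 v1]; have v0 : 0 < v by rewrite (lt_trans _ v2)// invr_gt0.
apply: (@squeeze_cvgr _ _ _ _ (fun=> 0) (fun n => ((2 * v)^-1) ^+ n)); last 2 first.
- exact: cvg_cst.
- apply: cvg_expr; rewrite ger0_norm ?invr_ge0 ?mulr_ge0 ?ltW//.
  by rewrite invf_lt1 ?mulr_gt0// -ltr_pdivrMl// mulr1.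
apply: nearW => n.
have v01 : 0 <= v <= 1 by rewrite ltW.
have /andP[-> _] /= := step_seq01 n v01.
have vn1 : v ^+ n <= 1 by rewrite exprn_ile1// ltW.
have vn0 : 0 < v ^+ n by rewrite exprn_gt0.
have B : (2 * v) ^+ n <= (1 + v ^+ n) ^+ (2 ^ n).
  apply: le_trans (@bernoulli_ge (v ^+ n) (2 ^ n) _); last first.
    by rewrite (le_trans _ (ltW vn0))// lerN10.
  by rewrite exprMn natrX lerDr.
rewrite exprVn -[leRHS]mul1r ler_pdivlMr ?exprn_gt0 ?mulr_gt0//.
apply: (@le_trans _ _ (step_seq v n * (1 + v ^+ n) ^+ (2 ^ n))).
  by rewrite ler_wpM2l// exprn_ge0// subr_ge0.
rewrite /step_seq -exprMn exprn_ile1//.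
  by rewrite mulr_ge0 ?subr_ge0// addr_ge0// ltW.
rewrite -subr_sqr expr1n gerBl exprn_ge0// ltW//.
Qed.

End step_sequence.

Section arcs.
Context (R : realType).
Implicit Types x y del : R.

Lemma ae_neq a : {ae @lebesgue_measure R, forall x : R, x != a}.
Proof.
exists [set a]; split; first exact: measurable_set1.
  by rewrite lebesgue_measure_set1.
by move=> x /= /negP; rewrite negbK => /eqP.
Qed.

Let pi2 (y : R) : 0 <= y <= 2^-1 -> 2 * pi * y \in `[0, pi].
Proof.
move=> /andP[y0 y1]; rewrite in_itv/= !mulr_ge0 ?pi_ge0//=.
by rewrite mulrAC -[leRHS]mul1r ler_wpM2r ?pi_ge0// -ler_pdivlMl// mulr1.
Qed.

Let cos_norm2pi y : cos (2 * pi * `|y|) = cos (2 * pi * y).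
Proof. by have := cos_norm (2 * pi * y); rewrite !normrM ger0_norm// ger0_norm ?pi_ge0. Qed.

Let lt_cos2pi y del : 0 <= y <= 2^-1 -> 0 <= del <= 2^-1 ->
  (cos (2 * pi * del) < cos (2 * pi * y)) = (y < del).
Proof.
move=> hy hd; rewrite ltr_cos ?pi2//.
by rewrite ltr_pM2l// mulr_gt0 ?pi_gt0.
Qed.

Lemma cos_arc_lt y del : 0 < del <= 2^-1 -> `|y| < del ->
  cos (2 * pi * del) < cos (2 * pi * y).
Proof.
move=> /andP[d0 d1] yd; rewrite -(cos_norm2pi y) lt_cos2pi ?normr_ge0 ?(ltW d0)//=.
exact: le_trans (ltW yd) d1.
Qed.

Lemma cos_arc_gt y del : 0 < del <= 2^-1 -> del < `|y| < 1 - del ->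
  cos (2 * pi * y) < cos (2 * pi * del).
Proof.
move=> /andP[d0 d1] /andP[dy yd].
have hd : 0 <= del <= 2^-1 by rewrite (ltW d0).
rewrite -(cos_norm2pi y); have [y2|y2] := leP `|y| 2^-1.
  by rewrite lt_cos2pi// normr_ge0.
(* Beyond the half period, [|y|] is reflected to [1 - |y|], which lies between [del] and [1 / 2],
   where the cosine is monotone. *)
have -> : cos (2 * pi * `|y|) = cos (2 * pi * (1 - `|y|)).
  by rewrite mulrBr mulr1 -[RHS]cosN opprB -(cosD2pi (_ - _)) mulr_natl subrK.
rewrite lt_cos2pi//; first by rewrite ltrBrDr addrC -ltrBrDr.
rewrite subr_ge0 (le_trans (ltW yd)) ?gerBl ?(ltW d0)//=.
by rewrite lerBlDr -lerBlDl; move: y2; lra.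
Qed.

End arcs.

Section trig_totality1.
Context (R : realType).
Local Notation leb := (@lebesgue_measure R).
Let D : set R := `[0, 1[%classic.
Let mD : measurable (D : set (measurableTypeR R)). Proof. exact: measurable_itv. Qed.
Let e (k : int) (x : R) : R[i] := expi (2 * pi * k%:~R * x).

Let cmeas_e k : cmeas D (e k).
Proof.
apply: (@cmeas_expi _ _ _ D (fun x => 2 * pi * k%:~R * x)).
exact: measurable_funM.
Qed.

Variable F : R -> R[i].
Hypothesis iF : cintble leb D F.
Hypothesis F0 : forall k, cintegral leb D (fun x => F x * e k x) = 0.

(* [phi] annihilates [F] together with all its modulations. *)
Let P (phi : R -> R) := cintble leb D (fun x => F x * (phi x)%:C%C) /\
  forall k, cintegral leb D (fun x => F x * (phi x)%:C%C * e k x) = 0.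

Let iPe phi k : P phi -> cintble leb D (fun x => F x * (phi x)%:C%C * e k x).
Proof.
move=> [iphi _]; apply: cintbleM1 => //; first exact: cmeas_e.
by move=> x _; rewrite sqn_expi.
Qed.

Let P1 : P (fun=> 1).
Proof.
split; first by apply: eq_cintble iF => // x _; rewrite mulr1.
by move=> k; rewrite -(F0 k); apply: eq_cint => x _; rewrite mulr1.
Qed.

Let P_lin a b phi psi : P phi -> P psi -> P (fun x => a * phi x + b * psi x).
Proof.
move=> Pphi Ppsi.
have E x : F x * (a * phi x + b * psi x)%:C%C =
    a%:C%C * (F x * (phi x)%:C%C) + b%:C%C * (F x * (psi x)%:C%C).
  by rewrite rmorphD !rmorphM/=; ring.
split.
  have h := cintbleD mD (cintbleZ mD a%:C%C Pphi.1) (cintbleZ mD b%:C%C Ppsi.1).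
  by apply: eq_cintble h => // x _; exact/esym/E.
move=> k; rewrite (eq_cint (G := fun x : measurableTypeR R => a%:C%C * (F x * (phi x)%:C%C * e k x) +
   b%:C%C * (F x * (psi x)%:C%C * e k x))); last by move=> x _; rewrite E; ring.
rewrite cintD//; [|by apply: cintbleZ => //; exact: iPe..].
by rewrite !cintZ//; [|exact: iPe..]; rewrite Pphi.2 Ppsi.2 !mulr0 addr0.
Qed.

(** Multiplication by a shifted cosine combines the frequencies [k + 1] and [k - 1], against which
    [F phi] is annihilated as well. *)
Let P_cos x0 phi : P phi -> P (fun x => phi x * cos (2 * pi * (x - x0))).
Proof.
move=> Pphi; have mcos : measurable_fun D (fun x => cos (2 * pi * (x - x0))).
  apply: (measurableT_comp (f := @cos R)).
    exact: (continuous_measurable_fun (@continuous_cos R)).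
  by apply: measurable_funM => //; exact: measurable_funB.
have E x k : (cos (2 * pi * (x - x0)))%:C%C * e k x =
   (2^-1%:C%C * expi (- (2 * pi * x0))) * e (k + 1) x +
   (2^-1%:C%C * expi (2 * pi * x0)) * e (k - 1) x.
  have h1 : expi (2 * pi * (x - x0)) * e k x = expi (- (2 * pi * x0)) * e (k + 1) x.
    by rewrite -!expiD rmorphD/=; congr expi; ring.
  have h2 : expi (- (2 * pi * (x - x0))) * e k x = expi (2 * pi * x0) * e (k - 1) x.
    by rewrite -!expiD rmorphB/=; congr expi; ring.
  by rewrite cos_expi -[X in _ = X + _]mulrA -[X in _ = _ + X]mulrA -h1 -h2; ring.
split.
  apply: (@eq_cintble _ _ _ _ _ mD (fun x => F x * (phi x)%:C%C * (cos (2 * pi * (x - x0)))%:C%C)).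
    by move=> x _; rewrite rmorphM mulrA.
  apply: cintbleM1 => //; first exact: Pphi.1.
  move=> x _; rewrite sqnC -real_normK ?num_real// exprn_ile1//.
  exact: cos_max.
move=> k; set c1 := 2^-1%:C%C * expi (- (2 * pi * x0)); set c2 := 2^-1%:C%C * expi (2 * pi * x0).
rewrite (eq_cint (G := fun x : measurableTypeR R => c1 * (F x * (phi x)%:C%C * e (k + 1) x) +
   c2 * (F x * (phi x)%:C%C * e (k - 1) x))); last first.
  by move=> x _; rewrite rmorphM/= (mulrA (F x)) -[LHS]mulrA E -/c1 -/c2; ring.
rewrite cintD//; [|by apply: cintbleZ => //; exact: iPe..].
by rewrite !cintZ//; [|exact: iPe..]; rewrite !Pphi.2 !mulr0 addr0.
Qed.

(** For fixed [n] this is a polynomial in a shifted cosine, so the closure properties of [P] reach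
    it. *)
Let P_step x0 t n : P (fun x => step_seq (t * (1 + cos (2 * pi * (x - x0)))) n).
Proof.
pose v x := t * (1 + cos (2 * pi * (x - x0))).
have P_ext phi psi : phi =1 psi -> P phi -> P psi by move=> /funext ->.
have Pv phi : P phi -> P (fun x => phi x * v x).
  move=> Pphi; apply: P_ext (P_lin t t Pphi (P_cos x0 Pphi)) => x.
  by rewrite /v; ring.
have Pvn k phi : P phi -> P (fun x => phi x * v x ^+ k).
  elim: k phi => [|k IH] phi Pphi; first by apply: P_ext Pphi => x; rewrite mulr1.
  by apply: P_ext (IH _ (Pv _ Pphi)) => x; rewrite exprS mulrA.
have P1v phi : P phi -> P (fun x => phi x * (1 - v x ^+ n)).
  move=> Pphi; apply: P_ext (P_lin 1 (-1) Pphi (Pvn n _ Pphi)) => x.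
  by ring.
rewrite /step_seq; elim: (2 ^ n)%N => [|k IH]; first exact: P1.
by apply: P_ext (P1v _ IH) => x; rewrite exprSr.
Qed.

(** One minus the step functions tends to the indicator of the arc of radius [del] around [x0], so
    dominated convergence transfers the vanishing of the pairings to the integral over the arc. *)
Let int_arc (f : R -> R) (x0 del : R) :
  rintble leb D f ->
  (forall t n, \int[leb]_(x in D) (f x * step_seq (t * (1 + cos (2 * pi * (x - x0)))) n) = 0) ->
  \int[leb]_(x in D) f x = 0 ->
  0 < del <= 4^-1 -> del < x0 < 1 - del ->
  (\int[leb]_(y in ball x0 del) ((f \_ D) y)%:E = 0)%E.
Proof.
move=> fi f0 fD0 /andP[d0 d4] /andP[dx xd].
have d2 : 0 < del <= 2^-1 by rewrite d0 (le_trans d4)// lef_pV2 ?posrE// ler_nat.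
(* [t] makes [v = 1 / 2] exactly at distance [del] from [x0]. The bound [v <= 1] requires [c >= 0],
   whence the condition [del <= 1 / 4]. *)
pose c := cos (2 * pi * del); pose t := (2 * (1 + c))^-1.
have c0 : 0 <= c.
  rewrite cos_ge0_pihalf//; apply/andP; split.
    by rewrite (@le_trans _ _ 0) ?oppr_le0 ?divr_ge0 ?pi_ge0// !mulr_ge0 ?pi_ge0// ltW.
  by rewrite mulrAC mulrC ler_wpM2l ?pi_ge0//; move: d4; lra.
have t0 : 0 < t by rewrite invr_gt0 mulr_gt0// ltr_pwDl.
pose v x := t * (1 + cos (2 * pi * (x - x0))).
have c2 : 2^-1 * (2 * (1 + c)) = 1 + c by field.
have t2 : 0 < 2 * (1 + c) by rewrite mulr_gt0// ltr_pwDl.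
have v01 x : 0 <= v x <= 1.
  apply/andP; split.
    by apply: mulr_ge0; [exact: ltW|have := cos_geN1 (2 * pi * (x - x0)); lra].
  rewrite /v /t mulrC ler_pdivrMr// mul1r.
  by have := cos_le1 (2 * pi * (x - x0)); move: c0; lra.
have v_lt y : ((v y < 2^-1) = (cos (2 * pi * (y - x0)) < c))%B.
  by rewrite /v /t mulrC ltr_pdivrMr// c2 ltrD2l.
have v_gt y : ((2^-1 < v y) = (c < cos (2 * pi * (y - x0))))%B.
  by rewrite /v /t mulrC ltr_pdivlMr// c2 ltrD2l.
pose f_ n y := f y * (1 - step_seq (v y) n).
pose g y := f y * \1_(ball x0 del) y.
have mf : measurable_fun D f by apply/measurable_EFinP; exact: measurable_int fi.
have mv : measurable_fun D v.
  apply: measurable_funM => //; apply: measurable_funD => //.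
  apply: (measurableT_comp (f := @cos R)).
    exact: (continuous_measurable_fun (@continuous_cos R)).
  by apply: measurable_funM => //; exact: measurable_funB.
have mf_ n : measurable_fun D (EFin \o f_ n).
  apply/measurable_EFinP; apply: measurable_funM => //; apply: measurable_funB => //.
  by apply: measurable_funX; apply: measurable_funB => //; exact: measurable_funX.
have mg : measurable_fun D (EFin \o g).
  apply/measurable_EFinP; apply: measurable_funM => //.
  by apply: measurable_funTS; apply: measurable_indic; exact: measurable_ball.
have f_g : {ae leb, forall x, D x -> (EFin \o f_^~ x) @ \oo --> (EFin \o g) x}.
  have AF : Filter (almost_everywhere leb) by exact: (ae_filter_ringOfSetsType leb).
  (* At the two ends of the arc [v = 1 / 2] and the step sequence is not controlled; they form a
     null set. *)
  apply: filterS2 (ae_neq (x0 + del)) (ae_neq (x0 - del)).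
  move=> x n1 n2.
  rewrite /D /= in_itv/= => /andP[x_0 x_1].
  suff H : f_^~ x @ \oo --> g x by exact: (cvg_comp _ _ H).
  rewrite /g; apply: cvgM; first exact: cvg_cst.
  have [xb|xb] := ltP `|x - x0| del.
    rewrite indicE mem_set; last by rewrite /ball/= distrC.
    rewrite -[X in _ --> X](subr0 (1 : R)); apply: cvgB; first exact: cvg_cst.
    apply: step_seq_cvg0; rewrite v_gt cos_arc_lt//=.
    by have /andP[] := v01 x.
  rewrite indicE memNset; last by rewrite /ball/= distrC; apply/negP; rewrite -leNgt.
  rewrite -[X in _ --> X](subrr (1 : R)); apply: cvgB; first exact: cvg_cst.
  apply: step_seq_cvg1; rewrite v_lt; have /andP[-> _] /= := v01 x.
  apply: cos_arc_gt => //; apply/andP; split.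
    rewrite lt_neqAle xb andbT; apply/negP => /eqP E.
    have [h|h] := leP 0 (x - x0).
      by move/negP: n1; apply; rewrite E ger0_norm// addrC subrK.
    by move/negP: n2; apply; rewrite E ltr0_norm// opprK addrC subrK.
  by rewrite ltr_norml; apply/andP; split; lra.
have nf : leb.-integrable D (fun x => `|f x|%:E) by exact: integrable_norm.
have bnd : {ae leb, forall x n, D x -> (`|(EFin \o f_ n) x| <= `|f x|%:E)%E}.
  apply: nearW => x n Dx; rewrite /= lee_fin /f_ normrM ler_piMr//.
  have /andP[s0 s1] := step_seq01 n (v01 x).
  by rewrite ger0_norm ?subr_ge0// gerBl.
have [gi _ lim] := dominated_convergence mD mf_ mg f_g nf bnd.
have f_0 n : (\int[leb]_(x in D) (EFin \o f_ n) x = 0)%E.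
  have ms : measurable_fun D (fun x => step_seq (v x) n).
    by apply: measurable_funX; apply: measurable_funB => //; exact: measurable_funX.
  have i1 : rintble leb D (fun x => f x * step_seq (v x) n).
    apply: rintble_le nf => //; first exact: measurable_funM.
    move=> x Dx; rewrite normrM ler_piMr//.
    by have /andP[s0 s1] := step_seq01 n (v01 x); rewrite ger0_norm.
  have i2 : rintble leb D (f_ n).
    by apply: eq_rintble (rintbleB mD fi i1) => // x _; rewrite /f_ mulrBr mulr1.
  rewrite -[LHS]fineK; last exact: (integrable_fin_num mD i2).
  rewrite -/(Rintegral leb D (f_ n)).
  have -> : \int[leb]_(x in D) f_ n x = \int[leb]_(x in D) (f x - f x * step_seq (v x) n).
    by apply: eq_Rintegral => x _; rewrite /f_ mulrBr mulr1.
  by rewrite RintegralB// fD0 f0 subr0.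
have g0 : (\int[leb]_(x in D) (EFin \o g) x = 0)%E.
  rewrite -(cvg_lim _ lim)// (_ : (fun n => _) = fun=> 0%E) ?lim_cst//.
  by apply/funext => n; exact: f_0.
rewrite -g0 [LHS]integral_mkcond [RHS]integral_mkcond; apply: eq_integral => x _.
rewrite /patch; case: ifPn => xb; case: ifPn => xD //=; rewrite /g indicE.
- by rewrite mem_set ?mulr1//; exact/set_mem.
- by rewrite memNset ?mulr0//; move/negP: xb; apply: contra_not => /mem_set.
Qed.

(** Lebesgue differentiation: around almost every interior point, all small balls are arcs with
    vanishing integral, so the averages, which converge to [f x], are eventually 0. *)
Let re_zero (f : R -> R) : rintble leb D f ->
  (forall t x0 n, \int[leb]_(x in D) (f x * step_seq (t * (1 + cos (2 * pi * (x - x0)))) n) = 0) ->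
  \int[leb]_(x in D) f x = 0 -> {ae leb, forall x, D x -> f x = 0}.
Proof.
move=> fi f0 fD0.
have AF : Filter (almost_everywhere leb) by exact: (ae_filter_ringOfSetsType leb).
have loc := integrable_locally_restrict mD fi.
pose E (x : R) (n : nat) := ball x (n.+1%:R^-1 : R).
have hE x : nicely_shrinking x (E x).
  split; first by move=> n; exact: measurable_ball.
  exists (1, fun n => (n.+1%:R^-1)%:pos); split => //=.
  - exact: cvg_harmonic.
  - by move=> n y.
  - by move=> n; rewrite mul1e.
have ld := lebesgue_differentiation loc.
apply: (@filterS2 _ _ AF _ _ _ _ (ae_neq 0) ld) => x x0 lx.
rewrite /D /= in_itv/= => /andP[x_0 x_1].
have xgt0 : 0 < x by rewrite lt_neqAle eq_sym x0.
have := nice_lebesgue_differentiation hE loc lx.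
have c0 : (fun n => (leb (E x n))^-1 * \int[leb]_(y in E x n) ((f \_ D) y)%:E)%E @ \oo --> 0%E.
  apply: cvg_near_cst.
  have min0 : 0 < Num.min x (1 - x) by rewrite lt_min xgt0 subr_gt0.
  near=> n.
  have [n1 n2] : (n.+1%:R^-1 : R) <= 4^-1 /\ (n.+1%:R^-1 : R) < Num.min x (1 - x).
    by split; [apply/ltW; near: n; exact: (near_infty_natSinv_lt (4^-1)%:pos)|
      near: n; exact: (near_infty_natSinv_lt (PosNum min0))].
  rewrite int_arc ?mule0//; first by rewrite invr_gt0 ltr0n.
  by move: n2; rewrite lt_min => /andP[-> ?] /=; rewrite ltrBrDr addrC -ltrBrDr.
move=> /(cvg_lim (@ereal_hausdorff R)); rewrite (cvg_lim (@ereal_hausdorff R) c0).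
rewrite patchE mem_set; last by rewrite /D /= in_itv/= x_0.
by move/(congr1 fine) => /= <-.
Unshelve. all: by end_near. Qed.

Lemma trig_total1_aux : {ae leb, forall x, D x -> F x = 0}.
Proof.
have AF : Filter (almost_everywhere leb) by exact: (ae_filter_ringOfSetsType leb).
have e0 x : e 0 x = 1 by rewrite /e mulr0z mulr0 mul0r expi0.
have Fs t x0 n : cintegral leb D (fun x => F x *
    (step_seq (t * (1 + cos (2 * pi * (x - x0)))) n)%:C%C) = 0.
  by rewrite -((P_step x0 t n).2 0); apply: eq_cint => x _; rewrite e0 mulr1.
have FD0 : cintegral leb D F = 0.
  by rewrite -(F0 0); apply: eq_cint => x _; rewrite e0 mulr1.
have hr : {ae leb, forall x, D x -> cRe (F x) = 0}.
  apply: re_zero; first exact: iF.1.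
    move=> t x0 n; have /(congr1 (fun z => cRe z)) /= <- := Fs t x0 n.
    by apply: eq_Rintegral => x _; rewrite cpartE /= mulr0 subr0.
  by have /(congr1 (fun z => cRe z)) := FD0.
have hi : {ae leb, forall x, D x -> cIm (F x) = 0}.
  apply: re_zero; first exact: iF.2.
    move=> t x0 n; have /(congr1 (fun z => cIm z)) /= <- := Fs t x0 n.
    by apply: eq_Rintegral => x _; rewrite cpartE /= mulr0 add0r.
  by have /(congr1 (fun z => cIm z)) := FD0.
by apply: filterS2 hr hi => x h1 h2 Dx; apply: eq_cparts; [exact: h1|exact: h2].
Qed.

End trig_totality1.

Section trig_totality1.
Context (R : realType).

Lemma ctotal_trig1 : ctotal (@lebesgue_measure R) (`[0, 1[%classic : set (measurableTypeR R))
  (fun (k : int) x => expi (2 * pi * k%:~R * x)).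
Proof. by move=> F iF F0; exact: trig_total1_aux. Qed.

End trig_totality1.

(** * Integration on R^(n+1), by induction on the dimension *)

Section lebesgue_rV_succ_integral.
Context (R : realType) (n : nat).
Local Notation leb := (@lebesgue_measure R).
Let prodm : {measure set (measurableTypeR R * 'rV[R]_n) -> \bar R} :=
  (leb \x lebesgue_rV R n)%E.
Implicit Types (D : set 'rV[R]_n.+1).

Lemma uncons_rVK : cancel (@uncons_rV R n) (@cons_rV R n).
Proof.
move=> u; apply/rowP => i; have [->|[j ->]] : i = 0 \/ exists j, i = lift 0 j.
  by case: (unliftP 0 i) => [j ->|->]; [right; exists j|left].
- by rewrite cons_rV0.
- by rewrite cons_rVS mxE.
Qed.

Lemma measurable_fun_cons_rV d (T : measurableType d) D (f : 'rV[R]_n.+1 -> T) :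
  measurable D -> measurable_fun D f ->
  measurable_fun (@cons_rV R n @^-1` D : set (measurableTypeR R * 'rV[R]_n))
    (f \o @cons_rV R n).
Proof.
move=> mD mf; apply: (measurable_comp mD) mf _ => //; first by move=> _ [z Dz <-].
by apply: measurable_funTS; exact: measurable_cons_rV.
Qed.

Lemma ge0_integral_rV_succ D (f : 'rV[R]_n.+1 -> \bar R) :
  measurable D -> measurable_fun D f -> (forall u, D u -> (0 <= f u)%E) ->
  (\int[lebesgue_rV R n.+1]_(u in D) f u =
   \int[prodm]_(z in @cons_rV R n @^-1` D) f (cons_rV z))%E.
Proof.
move=> mD mf f0.
have := ge0_integral_pushforward (@measurable_cons_rV R n) prodm mD mf.
move=> <-; last by move=> u /set_mem; exact: f0.
apply: eq_measure_integral; first exact: measurable_cons_rV.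
by move=> mcons A _ _.
Qed.

Lemma integral_rV_succ D (f : 'rV[R]_n.+1 -> \bar R) :
  measurable D -> measurable_fun D f ->
  (\int[lebesgue_rV R n.+1]_(u in D) f u =
   \int[prodm]_(z in @cons_rV R n @^-1` D) f (cons_rV z))%E.
Proof.
move=> mD mf; rewrite integralE [RHS]integralE; congr (_ - _)%E.
  rewrite (ge0_integral_rV_succ mD (measurable_funepos mf)); last by move=> u _; exact: funepos_ge0.
  by have := funepos_comp f (@cons_rV R n); rewrite /comp => ->.
rewrite (ge0_integral_rV_succ mD (measurable_funeneg mf)); last by move=> u _; exact: funeneg_ge0.
by have := funeneg_comp f (@cons_rV R n); rewrite /comp => ->.
Qed.

Lemma rintble_rV_succ D (f : 'rV[R]_n.+1 -> R) : measurable D ->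
  rintble (lebesgue_rV R n.+1) D f ->
  rintble prodm (@cons_rV R n @^-1` D) (fun z => f (cons_rV z)).
Proof.
move=> mD /integrableP[mf foo]; apply/integrableP; split.
  exact: (measurable_fun_cons_rV mD mf).
by move: foo; rewrite ge0_integral_rV_succ//; apply: measurableT_comp.
Qed.

Lemma cintble_rV_succ D (F : 'rV[R]_n.+1 -> R[i]) : measurable D ->
  cintble (lebesgue_rV R n.+1) D F ->
  cintble prodm (@cons_rV R n @^-1` D) (fun z => F (cons_rV z)).
Proof. by move=> mD [h1 h2]; split; [exact: rintble_rV_succ mD h1|exact: rintble_rV_succ mD h2]. Qed.

Lemma cintegral_rV_succ D (F : 'rV[R]_n.+1 -> R[i]) : measurable D -> cmeas D F ->
  cintegral (lebesgue_rV R n.+1) D F =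
  cintegral prodm (@cons_rV R n @^-1` D) (fun z => F (cons_rV z)).
Proof.
move=> mD [? ?]; congr Complex; congr fine; apply: integral_rV_succ => //;
  exact/measurable_EFinP.
Qed.

Lemma ae_rV_succ (P : 'rV[R]_n.+1 -> Prop) :
  {ae prodm, forall z, P (cons_rV z)} -> {ae lebesgue_rV R n.+1, forall u, P u}.
Proof.
move=> [N [mN N0 PN]]; exists (@uncons_rV R n @^-1` N); split.
- by rewrite -[X in measurable X]setTI; exact: measurable_uncons_rV.
- rewrite [LHS](_ : _ = prodm (@cons_rV R n @^-1` (@uncons_rV R n @^-1` N)))//.
  rewrite (_ : _ @^-1` _ = N)//; apply/seteqP; split => z; rewrite /preimage/= cons_rVK//.
- by move=> u Pu; apply: PN => /=; rewrite uncons_rVK.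
Qed.

End lebesgue_rV_succ_integral.

Section cube.
Context (R : realType).

Lemma preimage_cube n : @cons_rV R n @^-1` (@cube R n.+1) =
  `[0, 1[%classic `*` @cube R n.
Proof.
apply/seteqP; split => [[x y] /= h|[x y] /= [x01 y01] i].
  split => /=; first by have := h 0; rewrite cons_rV0 in_itv.
  by move=> j; have := h (lift 0 j); rewrite cons_rVS.
have [->|[j ->]] : i = 0 \/ exists j, i = lift 0 j.
  by case: (unliftP 0 i) => [j ->|->]; [right; exists j|left].
- by rewrite cons_rV0; move: x01; rewrite in_itv.
- by rewrite cons_rVS; exact: y01.
Qed.

Lemma measurable_cube n : measurable (@cube R n).
Proof.
rewrite (_ : @cube R n = \bigcap_(i in [set: 'I_n]) ((fun u : 'rV[R]_n => u 0 i) @^-1` `[0, 1[)).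
  apply: fin_bigcap_measurable => // i _; rewrite -[X in measurable X]setTI.
  exact: measurable_coord.
apply/seteqP; split => u h i; first by move=> _; rewrite /= in_itv; exact: h.
by have := h i I; rewrite /= in_itv.
Qed.

Lemma measurable_cell n : measurable (@cell R n : set (measurableTypeR R * 'rV[R]_n)).
Proof. by apply: measurableX; [exact: measurable_itv|exact: measurable_cube]. Qed.

Lemma lebesgue_cube n : lebesgue_rV R n (@cube R n) = 1%E.
Proof.
elim: n => [|n IH].
  rewrite /= diracE mem_set//; by case.
rewrite [LHS](_ : _ = (@lebesgue_measure R \x lebesgue_rV R n)%E
  (@cons_rV R n @^-1` (@cube R n.+1)))// preimage_cube.
rewrite product_measure1E; [|exact: measurable_itv|exact: measurable_cube].
have h : @lebesgue_measure R `[0, 1[%classic = 1%E.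
  by rewrite lebesgue_measure_itv/= lte_fin ltr01 oppr0 adde0.
by rewrite [X in (X * _)%E](_ : _ = 1%E)// mul1e; exact: IH.
Qed.

Lemma lebesgue_cube_lty n : (lebesgue_rV R n (@cube R n) < +oo)%E.
Proof. by rewrite lebesgue_cube ltry. Qed.

Lemma lebesgue_itv01 : @lebesgue_measure R `[0, 1]%classic = 1%E.
Proof. by rewrite lebesgue_measure_itv/= lte_fin ltr01 oppr0 adde0. Qed.

Lemma volM_cell n : volM R n (@cell R n) = 1%E.
Proof.
rewrite /volM /= product_measure1E; [|exact: measurable_itv|exact: measurable_cube].
rewrite [X in (_ * X)%E](_ : _ = 1%E); last exact: lebesgue_cube.
by rewrite mule1; exact: lebesgue_itv01.
Qed.

End cube.

Section torus_characters.
Context (R : realType).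

Definition chiq n (w : 'rV[R]_n) (y : 'rV[R]_n) : R[i] :=
  expi (2 * pi * \sum_j w 0 j * y 0 j).

(** Both frequencies are real. Integrality is imposed only where periodicity matters; nonintegral
    [s] occurs in the X-ray pairing and in the study of the trace. *)
Definition chi n (s : R) (w : 'rV[R]_n) (z : R * 'rV[R]_n) : R[i] :=
  expi (2 * pi * s * z.1) * chiq w z.2.

Lemma chi_expi n (s : R) (w : 'rV[R]_n) z :
  chi s w z = expi (2 * pi * (s * z.1 + \sum_j w 0 j * z.2 0 j)).
Proof. by rewrite /chi /chiq -expiD; congr expi; ring. Qed.

Lemma sqn_chiq n (w y : 'rV[R]_n) : sqn (chiq w y) = 1.
Proof. exact: sqn_expi. Qed.

Lemma sqn_chi n s (w : 'rV[R]_n) z : sqn (chi s w z) = 1.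
Proof. by rewrite sqnM sqn_expi sqn_chiq mulr1. Qed.

Lemma cmeas_chiq n (w : 'rV[R]_n) D : cmeas D (chiq w).
Proof.
apply: (@cmeas_expi R _ _ D (fun y : 'rV[R]_n => 2 * pi * \sum_j w 0 j * y 0 j)).
apply: measurable_funM => //; apply: measurable_sum => j.
by apply: measurable_funM => //; apply: measurable_funTS; exact: measurable_coord.
Qed.

Lemma cmeas_expi_lin (s : R) (D : set (measurableTypeR R)) :
  cmeas D (fun x : measurableTypeR R => expi (2 * pi * s * x)).
Proof.
apply: (@cmeas_expi R _ _ D (fun x : measurableTypeR R => 2 * pi * s * x)).
exact: measurable_funM.
Qed.

Lemma cmeas_chi n s (w : 'rV[R]_n) (D : set (measurableTypeR R * 'rV[R]_n)) :
  cmeas D (chi s w).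
Proof.
apply: cmeasM.
  have [m1 m2] := @cmeas_expi_lin s setT.
  by split; apply: measurable_funTS;
    [apply: (measurableT_comp m1)|apply: (measurableT_comp m2)]; exact: measurable_fst.
have [m1 m2] := @cmeas_chiq n w setT.
by split; apply: measurable_funTS;
  [apply: (measurableT_comp m1)|apply: (measurableT_comp m2)]; exact: measurable_snd.
Qed.

Lemma conjc_chi n s (w : 'rV[R]_n) z : conjc (chi s w z) = chi (- s) (- w) z.
Proof.
rewrite !chi_expi conjc_expi; congr expi; rewrite -mulrN opprD mulNr; congr (_ * (_ + _)).
by rewrite -sumrN; apply: eq_bigr => j _; rewrite mxE mulNr.
Qed.

Lemma chiM n s t (w v : 'rV[R]_n) z : chi s w z * chi t v z = chi (s + t) (w + v) z.
Proof.
rewrite !chi_expi -expiD; congr expi; rewrite -mulrDr; congr (_ * _).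
rewrite mulrDl addrACA; congr (_ + _); rewrite -big_split/=.
by apply: eq_bigr => j _; rewrite mxE mulrDl.
Qed.

(** Induction on the dimension with [ctotal_prod]. In dimension 0 the measure is a unit mass at the
    only point and the only character is 1. *)
Lemma ctotal_cube n : ctotal (lebesgue_rV R n) (@cube R n)
  (fun (k : 'rV[int]_n) => chiq (map_mx intr k)).
Proof.
elim: n => [|n IH] F iF F0.
  suff F00 : F 0 = 0 by apply: nearW => y _; rewrite (_ : y = 0)//; apply/rowP => -[].
  have := F0 0; rewrite (eq_cint (G := F)); last first.
    by move=> y _; rewrite /chiq big_ord0 mulr0 expi0 mulr1.
  have c0 : cube (0 : 'rV[R]_0) by case.
  have [mF1 mF2] := cintble_meas iF.
  rewrite /cintegral /Rintegral /= !integral_dirac//; [|exact: measurable_cube|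
    exact/measurable_EFinP|exact: measurable_cube|exact/measurable_EFinP].
  by rewrite diracE mem_set// !mul1e /=; case: (F 0).
apply: ae_rV_succ; set D := `[0, 1[%classic : set (measurableTypeR R).
have mD : measurable D by exact: measurable_itv.
have mQ := @measurable_cube R n.
have iFc := cintble_rV_succ (@measurable_cube R n.+1) iF.
rewrite preimage_cube in iFc.
have := ctotal_prod mD mQ (fun k : int => cmeas_expi_lin k%:~R D)
  (fun k x _ => ltac:(by rewrite sqn_expi)) (fun k : 'rV[int]_n => cmeas_chiq (map_mx intr k) (@cube R n))
  (fun k y _ => ltac:(by rewrite sqn_chiq)) (@ctotal_trig1 R) IH iFc.
move=> H; have {}H : {ae (@lebesgue_measure R \x lebesgue_rV R n)%E, forall z,
    (D `*` @cube R n) z -> F (cons_rV z) = 0}.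
  apply: H => -[k1 k2] /=.
  rewrite -(F0 (row_mx (k1%:M : 'rV_1) k2)) cintegral_rV_succ; last 2 first.
  - exact: measurable_cube.
  - by apply: cmeasM; [exact: cintble_meas iF|exact: cmeas_chiq].
  rewrite preimage_cube; apply: eq_cint => -[x y] _; congr (_ * _).
  have -> : map_mx intr (row_mx (k1%:M : 'rV_1) k2) = cons_rV (k1%:~R : R, map_mx intr k2).
    apply/rowP => i; rewrite /cons_rV !mxE; case: splitP => j _; rewrite !mxE//.
    by rewrite ord1.
  rewrite /chiq -expiD big_ord_recl !cons_rV0 /=; congr expi; rewrite [RHS]mulrDr [in RHS]mulrA.
  congr (_ + _ * _); apply: eq_bigr => j _; congr (_ * _); exact/esym/cons_rVS.
apply: filterS H => z /= H Dz; apply: H.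
by have : (@cons_rV R n @^-1` @cube R n.+1) z by []; rewrite preimage_cube.
Qed.

End torus_characters.

Section cell_totality.
Context (R : realType).
Local Notation leb := (@lebesgue_measure R).
Let Dc : set (measurableTypeR R) := `[0, 1]%classic.
Let Do : set (measurableTypeR R) := `[0, 1[%classic.

Lemma measurable_itv01 : measurable Dc. Proof. exact: measurable_itv. Qed.

Let sub_oc : Do `<=` Dc.
Proof. by move=> x; rewrite /Do /Dc /= !in_itv/= => /andP[-> /ltW]. Qed.

(** The closed interval differs from the half-open one by the null set consisting of the point 1. *)
Lemma ctotal_trig1_closed : ctotal leb Dc
  (fun (k : int) (x : measurableTypeR R) => expi (2 * pi * k%:~R * x)).
Proof.
move=> F [iF1 iF2] F0.
have mo : measurable Do by exact: measurable_itv.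
have io G : cintble leb Dc G -> cintble leb Do G.
  by move=> [i1 i2]; split; [exact: integrableS measurable_itv01 mo sub_oc i1|
    exact: integrableS measurable_itv01 mo sub_oc i2].
have e G : cintble leb Dc G -> cintegral leb Do G = cintegral leb Dc G.
  move=> /io[i1 i2]; congr Complex; exact: Rintegral_itv_bndo_bndc.
have AF : Filter (almost_everywhere leb) by exact: (ae_filter_ringOfSetsType leb).
have iFo := io F (conj iF1 iF2).
have h := ctotal_trig1 iFo _.
have {}h : {ae leb, forall z, Do z -> F z = 0}.
  apply: h => k; rewrite e ?F0//; apply: cintbleM1 => //; first exact: measurable_itv01.
    exact: cmeas_expi_lin.
  by move=> x _; rewrite sqn_expi.
apply: (@filterS2 _ _ AF _ _ _ _ h (ae_neq 1)) => x {}h x1 Dx; apply: h.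
by move: Dx; rewrite /Dc /Do /= !in_itv/= => /andP[->]; rewrite le_eqVlt (negbTE x1).
Qed.

Definition chiZ n (ka : int * 'rV[int]_n) : R * 'rV[R]_n -> R[i] :=
  chi ka.1%:~R (map_mx intr ka.2).

Lemma ctotal_cell n : ctotal (volM R n) (@cell R n) (@chiZ n).
Proof.
move=> F iF F0; have mQ := @measurable_cube R n.
have := ctotal_prod measurable_itv01 mQ (fun k : int => cmeas_expi_lin k%:~R Dc)
  (fun k x _ => ltac:(by rewrite sqn_expi)) (fun k : 'rV[int]_n => cmeas_chiq (map_mx intr k) (@cube R n))
  (fun k y _ => ltac:(by rewrite sqn_chiq)) ctotal_trig1_closed (@ctotal_cube R n) iF.
by apply=> ka; rewrite -(F0 ka).
Qed.

End cell_totality.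

(** * Calculus on the torus *)

Section continuous_on_R_rV.
Context (R : realType) (n : nat).
Local Notation V := (R * 'rV[R]_n)%type.
Local Notation mV := (measurableTypeR R * 'rV[R]_n)%type.

Let grid (N : nat) (z : V) : int * 'rV[int]_n :=
  (Num.floor (N.+1%:R * z.1), \row_j Num.floor (N.+1%:R * z.2 0 j)).
Let point (N : nat) (q : int * 'rV[int]_n) : V :=
  (q.1%:~R / N.+1%:R, \row_j ((q.2 0 j)%:~R / N.+1%:R)).

Let measurable_floor (N : nat) (k : int) :
  measurable [set x : measurableTypeR R | Num.floor (N.+1%:R * x) = k].
Proof.
rewrite (_ : [set _ | _] = `[k%:~R / N.+1%:R, (k + 1)%:~R / N.+1%:R[%classic).
  exact: measurable_itv.
apply/seteqP; split => x /=; rewrite in_itv/= ler_pdivrMr// ltr_pdivlMr// [x * _]mulrC.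
  by move=> <-; exact: floor_itv.
by move=> h; apply/eqP; rewrite floor_eq.
Qed.

Let measurable_grid N (q : int * 'rV[int]_n) : measurable [set z : mV | grid N z = q].
Proof.
rewrite (_ : [set _ | _] =
  (fst @^-1` [set x : measurableTypeR R | Num.floor (N.+1%:R * x) = q.1]) `&`
  \bigcap_(j in [set: 'I_n]) ((fun z : mV => z.2 0 j) @^-1`
    [set x : measurableTypeR R | Num.floor (N.+1%:R * x) = q.2 0 j])).
  apply: measurableI.
    by rewrite -[X in measurable X]setTI; apply: measurable_fst => //; exact: measurable_floor.
  apply: fin_bigcap_measurable => // j _; rewrite -[X in measurable X]setTI.
  have mj : measurable_fun setT (fun z : mV => z.2 0 j).
    by apply: (measurableT_comp (@measurable_coord R n j)); exact: measurable_snd.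
  by apply: mj => //; exact: measurable_floor.
case: q => q1 q2; apply/seteqP; split => z /=.
  by move=> [<- <-]; split => // j _ /=; rewrite mxE.
move=> [<- h]; congr (_, _); apply/rowP => j; rewrite mxE.
exact: h.
Qed.

Let grid_close N (z : V) (e : R) : N.+1%:R^-1 < e -> ball z e (point N (grid N z)).
Proof.
move=> Ne; have close (x : R) : `|x - (Num.floor (N.+1%:R * x))%:~R / N.+1%:R| < e.
  apply: le_lt_trans Ne; have := floor_itv (N.+1%:R * x).
  move: (Num.floor _) => k /andP[k1 k2].
  rewrite (_ : x - _ = (N.+1%:R * x - k%:~R) / N.+1%:R); last first.
    by rewrite mulrBl mulrAC mulfV// mul1r.
  rewrite ger0_norm; last by rewrite divr_ge0// subr_ge0.
  rewrite ler_pdivrMr// mulVf// lerBlDr ltW//.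
  by move: k2; rewrite intrD addrC.
split => /=; first exact: close.
split; first by rewrite (lt_trans _ Ne).
by move=> i j; rewrite ord1 !mxE; exact: close.
Qed.

(** The sigma-algebra is generated by the coordinates, not by the open sets. A continuous function
    is the limit of functions constant on the cells of a grid of mesh [1 / N.+1], and each of these
    is a countable gluing over measurable cells. *)
Lemma continuous_measurable_RrV (phi : V -> R) : continuous phi ->
  measurable_fun [set: mV] phi.
Proof.
move=> cphi; pose h N z := phi (point N (grid N z)).
apply: (@measurable_fun_cvg _ _ _ _ h).
  move=> N _ Y mY; rewrite setTI.
  rewrite (_ : _ @^-1` _ = \bigcup_k (if unpickle k is Some q then
     if phi (point N q) \in Y then [set z : mV | grid N z = q] else set0 else set0)).
    apply: bigcupT_measurable => k; case: (unpickle k) => [q|//].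
    by case: ifP => // _; exact: measurable_grid.
  apply/seteqP; split => z /=.
    move=> hz; exists (pickle (grid N z)); first exact: Logic.I.
    by rewrite pickleK mem_set.
  by move=> [k _]; case: (unpickle k) => // q; case: ifP => // /set_mem hq /= gz; rewrite /h gz.
move=> z _; apply/cvgrPdist_lt => e e0.
have /cvgrPdist_lt/(_ e e0) := cphi z; rewrite /= => /nbhs_ballP[r /= r0 hr].
near=> N; apply: hr; apply: grid_close; near: N.
exact: (near_infty_natSinv_lt (PosNum r0)).
Unshelve. all: by end_near. Qed.

Lemma continuous_bounded_cell (phi : V -> R) : continuous phi ->
  exists B : R, forall z : V, `[0, 1]%classic z.1 -> (forall j, 0 <= z.2 0 j <= 1) -> `|phi z| <= B.
Proof.
move=> cphi.
(* The cell is only half open in [y]; boundedness comes from the compact closed cell. *)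
pose K : set V := `[0, 1]%classic `*` [set v : 'rV[R]_n | forall j, `[0, 1]%classic (v 0 j)].
have cK : compact K.
  apply: compact_setX; first exact: segment_compact.
  by apply: (@rV_compact R n (fun=> `[0, 1]%classic)) => j; exact: segment_compact.
have /compact_bounded : compact (phi @` K).
  apply: (@continuous_compact V R phi K) => //; exact: continuous_subspaceT.
move=> [B [_ hB]]; exists (B + 1) => z z1 z2.
apply: (hB (B + 1)); first by rewrite ltrDl.
by exists z => //; split => // j; rewrite /= in_itv/= z2.
Qed.

End continuous_on_R_rV.

Section C1_along_a_direction.
Context (R : realType) (V : normedModType R).
Implicit Types (v : V) (a b Da Db : V -> R).

(** The derivative is taken in the real parameter along the whole line through [z], which is the
    form used by the one-variable chain rule and by the fundamental theorem of calculus. *)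
Definition C1dir v a Da := [/\ continuous a, continuous Da &
  forall z (t : R), is_derive t (1 : R) (fun s : R => a (z + s *: v)) (Da (z + t *: v))].

Lemma C1dir_cst v (c : R) : C1dir v (fun=> c) (fun=> 0).
Proof. by split; [exact: cst_continuous|exact: cst_continuous|move=> z t; exact: is_derive_cst]. Qed.

Lemma C1dirD v a b Da Db : C1dir v a Da -> C1dir v b Db ->
  C1dir v (fun z => a z + b z) (fun z => Da z + Db z).
Proof.
move=> [ca cDa da] [cb cDb db]; split.
- by move=> z; apply: cvgD; [exact: ca|exact: cb].
- by move=> z; apply: cvgD; [exact: cDa|exact: cDb].
- by move=> z t; exact: is_deriveD.
Qed.

Lemma C1dirM v a b Da Db : C1dir v a Da -> C1dir v b Db ->
  C1dir v (fun z => a z * b z) (fun z => Da z * b z + a z * Db z).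
Proof.
move=> [ca cDa da] [cb cDb db]; split.
- by move=> z; apply: cvgM; [exact: ca|exact: cb].
- move=> z; apply: cvgD; apply: cvgM.
  + exact: cDa.
  + exact: cb.
  + exact: ca.
  + exact: cDb.
- move=> z t; have := is_deriveM (da z t) (db z t).
  move/is_derive_eq; apply; rewrite /GRing.scale/= addrC; congr (_ + _).
  by rewrite mulrC.
Qed.

Lemma C1dirN v a Da : C1dir v a Da -> C1dir v (fun z => - a z) (fun z => - Da z).
Proof.
move=> /(C1dirM (C1dir_cst v (-1))) [c1 c2 d]; split.
- by move: c1; under eq_fun do rewrite mulN1r.
- by move: c2; under eq_fun do rewrite mul0r add0r mulN1r.
- move=> z t; have := d z t; under eq_fun do rewrite mulN1r.
  by rewrite mul0r add0r mulN1r.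
Qed.

Lemma C1dir_Ck1 v a : Ck 1 a -> C1dir v a ('D_v a).
Proof.
move=> [ca /(_ v) [da [cDa _]]]; split => //.
move=> z t; have E : (fun h : R => h^-1 *: (((fun s : R => a (z + s *: v)) \o shift t) (h *: (1 : R)) - a (z + t *: v))) =
   (fun h : R => h^-1 *: ((a \o shift (z + t *: v)) (h *: v) - a (z + t *: v))).
  apply/funext => h /=; congr (_ *: (a _ - _)).
  by rewrite /shift/= [h *: 1]mulr1 scalerDl addrCA.
have d : derivable (fun s : R => a (z + s *: v)) t 1.
  by rewrite /derivable E; exact: da.
split => //; by rewrite /derive E.
Qed.

Lemma C1dir_trig v (L : V -> R) (c : R) : continuous L ->
  (forall z t, L (z + t *: v) = L z + t * c) ->
  C1dir v (fun z => cos (L z)) (fun z => - c * sin (L z)) /\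
  C1dir v (fun z => sin (L z)) (fun z => c * cos (L z)).
Proof.
move=> cL Lv.
have ccos : continuous (fun z => cos (L z)).
  by move=> z; apply: continuous_comp; [exact: cL|exact: continuous_cos].
have csin : continuous (fun z => sin (L z)).
  by move=> z; apply: continuous_comp; [exact: cL|exact: continuous_sin].
have dL z t : is_derive (t : R) (1 : R) (fun s : R => L z + s * c) c.
  apply: is_derive_eq; rewrite /GRing.scale/=; ring.
split; split => //.
- by move=> z; apply: cvgM; [exact: cst_continuous|exact: csin].
- move=> z t; under eq_fun do rewrite Lv; rewrite Lv.
  have := @is_derive1_comp R cos (fun s => L z + s * c) t _ _ (is_derive_cos _) (dL z t).
  by move/is_derive_eq; apply; rewrite mulrC mulrN mulNr.
- by move=> z; apply: cvgM; [exact: cst_continuous|exact: ccos].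
- move=> z t; under eq_fun do rewrite Lv; rewrite Lv.
  have := @is_derive1_comp R sin (fun s => L z + s * c) t _ _ (is_derive_sin _) (dL z t).
  by move/is_derive_eq; apply; rewrite mulrC.
Qed.

End C1_along_a_direction.

Section FTC_unit_interval.
Context (R : realType).

Lemma FTC_unit (F f : R -> R) : continuous f -> (forall x : R, is_derive x (1 : R) F (f x)) ->
  \int[@lebesgue_measure R]_(x in `[0, 1]) f x = F 1 - F 0.
Proof.
move=> cf dF; have cF : continuous F.
  by move=> x; apply/differentiable_continuous/derivable1_diffP; have [] := dF x.
rewrite /Rintegral (@continuous_FTC2 _ f F)//.
- exact: continuous_subspaceT.
- split; first by move=> x _; have [] := dF x.
    by apply: cvg_at_right_filter; exact: cF.
  by apply: cvg_at_left_filter; exact: cF.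
- by move=> x _; rewrite derive1E; have [] := dF x.
Qed.

End FTC_unit_interval.

(** * Invariance of integrals under measure-preserving maps *)

Section measure_preserving.
Context d (T : measurableType d) (R : realType) (mu : {measure set T -> \bar R}).
Variables (D : set T) (phi : T -> T).
Hypotheses (mD : measurable D) (mphi : measurable_fun [set: T] phi).
Hypothesis phiD : forall z, D z -> D (phi z).
Hypothesis ge0_phi : forall G : T -> \bar R, measurable_fun [set: T] G ->
  (forall z, 0 <= G z)%E -> (\int[mu]_(z in D) G (phi z) = \int[mu]_(z in D) G z)%E.

Let ge0_phi_on (G : T -> \bar R) : measurable_fun D G -> (forall z, 0 <= G z)%E ->
  (\int[mu]_(z in D) G (phi z) = \int[mu]_(z in D) G z)%E.
Proof.
move=> mG G0; have E z : D z -> (G \_ D) z = G z by move=> Dz; rewrite patchE mem_set.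
transitivity (\int[mu]_(z in D) (G \_ D) (phi z))%E.
  by apply: eq_integral => z /set_mem Dz; rewrite E//; exact: phiD.
rewrite ge0_phi; first by apply: eq_integral => z /set_mem Dz; rewrite E.
- exact/(measurable_restrictT _ mD).1.
- by move=> z; apply: erestrict_ge0.
Qed.

Lemma measurable_preserving (f : T -> R) : measurable_fun D f ->
  measurable_fun D (fun z => f (phi z)).
Proof.
move=> mf; apply: (measurable_comp mD) mf _; first by move=> _ [z Dz <-]; exact: phiD.
exact: measurable_funTS.
Qed.

Lemma integral_preserving (f : T -> R) : measurable_fun D f ->
  \int[mu]_(z in D) f (phi z) = \int[mu]_(z in D) f z.
Proof.
move=> mf; have mEf : measurable_fun D (EFin \o f) by exact/measurable_EFinP.
rewrite /Rintegral; congr fine; rewrite integralE [RHS]integralE; congr (_ - _)%E.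
  have := funepos_comp (EFin \o f) phi; rewrite /comp => ->.
  by rewrite ge0_phi_on//; exact: measurable_funepos.
have := funeneg_comp (EFin \o f) phi; rewrite /comp => ->.
by rewrite ge0_phi_on//; exact: measurable_funeneg.
Qed.

Lemma rintble_preserving (f : T -> R) : rintble mu D f ->
  rintble mu D (fun z => f (phi z)).
Proof.
move=> /integrableP[/measurable_EFinP mf foo]; apply/integrableP; split.
  exact/measurable_EFinP/measurable_preserving.
by rewrite (ge0_phi_on (G := fun z => `|(f z)%:E|%E))//; apply: measurableT_comp => //; exact/measurable_EFinP.
Qed.

Lemma cintegral_preserving (F : T -> R[i]) : cmeas D F ->
  cintegral mu D (fun z => F (phi z)) = cintegral mu D F.
Proof. by move=> [m1 m2]; rewrite /cintegral !(integral_preserving (f := fun z => _ (F z))). Qed.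

Lemma cintble_preserving (F : T -> R[i]) : cintble mu D F ->
  cintble mu D (fun z => F (phi z)).
Proof. by move=> [m1 m2]; split; exact: (rintble_preserving (f := fun z => _ (F z))). Qed.

End measure_preserving.

Section translations_of_the_torus.
Context (R : realType).
Local Notation leb := (@lebesgue_measure R).
Local Notation mR := (measurableTypeR R).

Definition frac (x : R) : R := x - (Num.floor x)%:~R.

Lemma frac_itv x : 0 <= frac x < 1.
Proof. by have := floor_itv x; rewrite /frac subr_ge0 ltrBlDl intrD => /andP[-> ->]. Qed.

Lemma frac_id x : 0 <= x < 1 -> frac x = x.
Proof.
by move=> h; rewrite /frac (_ : Num.floor x = 0) ?subr0//; apply/eqP; rewrite floor_eq.
Qed.

Lemma frac_int x (k : int) : frac (x + k%:~R) = frac x.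
Proof.
by rewrite /frac [X in _ - X%:~R = _]floorDrz ?intr_int// intrKfloor intrD opprD addrACA subrr addr0.
Qed.

Lemma measurable_frac : measurable_fun [set: mR] (frac : mR -> R).
Proof.
apply: measurable_funB => //.
apply: (@nondecreasing_measurable _ [set: mR] (fun x : R => (Num.floor x)%:~R)) => //.
by move=> x y xy; rewrite ler_int; exact: le_floor.
Qed.

(** Uniqueness of Lebesgue measure: the image measure has the right value on intervals. *)
Lemma lebesgue_translation (c : R) (A : set mR) : measurable A ->
  leb A = pushforward leb ((fun x => x + c) : mR -> mR) A.
Proof.
have mc : measurable_fun [set: mR] ((fun x => x + c) : mR -> mR).
  by apply: measurable_funD.
pose push := measure_function_pushforward__canonical__measure_function_Measure leb mc.
apply: (lebesgue_measure_unique (mu := push)) => X [[a b] _ <-] /=.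
rewrite /pushforward (_ : _ @^-1` _ = `]a - c, b - c]%classic).
  rewrite !lebesgue_measure_itv/= !lte_fin ltrD2r; case: ifP => // _.
  by rewrite -!EFinD; congr EFin; ring.
by apply/seteqP; split => x /=; rewrite !in_itv/= ltrBlDr lerBrDr.
Qed.

Lemma ge0_integral_translation (c : R) (D : set mR) (g : mR -> \bar R) : measurable D ->
  measurable_fun D g -> (forall x, 0 <= g x)%E ->
  (\int[leb]_(x in (fun x : mR => x + c)%R @^-1` D) g (x + c)%R = \int[leb]_(x in D) g x)%E.
Proof.
move=> mD mg g0.
have mc : measurable_fun [set: mR] ((fun x => x + c) : mR -> mR).
  by apply: measurable_funD.
have := ge0_integral_pushforward mc leb mD mg; rewrite /comp => <-//.
by apply: eq_measure_integral => A mA _; exact/esym/lebesgue_translation.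
Qed.

(** A rotation of the circle exchanges two intervals: with [c0] the fractional part of [c], [[0, 1 -
    c0[] is translated onto [[c0, 1[] and [[1 - c0, 1[] onto [[0, c0[]. *)
Lemma ge0_integral_frac (c : R) (g : mR -> \bar R) : measurable_fun [set: mR] g ->
  (forall x, 0 <= g x)%E ->
  (\int[leb]_(x in `[0%R, 1%R[) g (frac (x + c)%R) = \int[leb]_(x in `[0%R, 1%R[) g x)%E.
Proof.
move=> mg g0; set c0 := frac c; have /andP[c00 c01] : 0 <= c0 < 1 := frac_itv c.
have split_at (a : R) (h : mR -> \bar R) : 0 <= a <= 1 ->
    measurable_fun [set: mR] h -> (forall x, 0 <= h x)%E ->
    (\int[leb]_(x in `[0%R, 1%R[) h x =
     \int[leb]_(x in `[0%R, a[) h x + \int[leb]_(x in `[a, 1%R[) h x)%E.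
  move=> /andP[a0 a1] mh h0; rewrite -ge0_integral_setU//=.
  - congr (integral _ _ _); apply/seteqP; split => x /=; rewrite !in_itv/=.
      by move=> /andP[x0 x1]; case: (ltP x a) => xa; [left|right]; rewrite ?x0 ?x1.
    by case=> /andP[x0 x1]; apply/andP; split => //; [exact: lt_le_trans a1|exact: le_trans x0].
  - exact: measurable_funTS.
  - apply/disj_setPS => x [] /=; rewrite !in_itv/= => /andP[_ xa] /andP[ax _].
    by move: (lt_le_trans xa ax); rewrite ltxx.
have mgf : measurable_fun [set: mR] (fun x : mR => g (frac (x + c))).
  apply: (measurableT_comp mg); apply: (measurableT_comp measurable_frac).
  exact: measurable_funD.
rewrite (split_at (1 - c0))//; last by rewrite subr_ge0 ltW//= lerBlDr lerDl.
rewrite [RHS](split_at c0)//; last by rewrite c00 ltW.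
have fracE (k : int) (x : R) : 0 <= x + c0 + k%:~R < 1 -> frac (x + c) = x + c0 + k%:~R.
  move=> h; rewrite -(frac_id h) frac_int (_ : x + c0 = x + c + (- Num.floor c)%:~R) ?frac_int//.
  by rewrite /c0 {1}/frac addrA intrN.
rewrite addeC; congr (_ + _)%E.
- rewrite -(@ge0_integral_translation (c0 - 1) `[0%R, c0[%classic)//; last exact: measurable_funTS.
  rewrite (_ : _ @^-1` _ = `[1 - c0, 1[%classic); last first.
    by apply/seteqP; split => x /=; rewrite !in_itv/= => /andP[h1 h2]; apply/andP; split; lra.
  apply: eq_integral => x; rewrite inE/= in_itv/= => /andP[h1 h2].
  have h : 0 <= (x : R) + c0 + (-1)%:~R < 1.
    by rewrite mulrN1z; apply/andP; split; move: h1 h2 c00 c01; clear; lra.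
  by rewrite (fracE _ _ h) -addrA.
- rewrite -(@ge0_integral_translation c0 `[c0, 1%R[%classic)//; last exact: measurable_funTS.
  rewrite (_ : _ @^-1` _ = `[0, 1 - c0[%classic); last first.
    by apply/seteqP; split => x /=; rewrite !in_itv/= => /andP[h1 h2]; apply/andP; split; lra.
  apply: eq_integral => x; rewrite inE/= in_itv/= => /andP[h1 h2].
  have h : 0 <= (x : R) + c0 + 0%:~R < 1.
    by rewrite addr0; apply/andP; split; move: h1 h2 c00 c01; clear; lra.
  by rewrite (fracE _ _ h) addr0.
Qed.

(** The sum is brought back to the fundamental cube, so that this is a translation of the torus. *)
Definition translate n (c y : 'rV[R]_n) : 'rV[R]_n := \row_j frac (y 0 j + c 0 j).

Lemma translate_cube n (c y : 'rV[R]_n) : cube (translate c y).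
Proof. by move=> j; rewrite mxE; exact: frac_itv. Qed.

Lemma translate_int n (c y : 'rV[R]_n) :
  y + c = translate c y + map_mx intr (\row_j Num.floor (y 0 j + c 0 j)).
Proof. by apply/rowP => j; rewrite !mxE subrK. Qed.

Lemma measurable_translate n d (T : measurableType d) (c y : T -> 'rV[R]_n) :
  measurable_fun [set: T] c -> measurable_fun [set: T] y ->
  measurable_fun [set: T] (fun z => translate (c z) (y z)).
Proof.
move=> mc my; apply: measurable_fun_rV => j; under eq_fun do rewrite mxE.
apply: (measurableT_comp measurable_frac); apply: measurable_funD.
- exact: (measurableT_comp (@measurable_coord R n j) my).
- exact: (measurableT_comp (@measurable_coord R n j) mc).
Qed.

Lemma ge0_integral_translate n (c : 'rV[R]_n) (G : 'rV[R]_n -> \bar R) :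
  measurable_fun [set: 'rV[R]_n] G -> (forall z, 0 <= G z)%E ->
  (\int[lebesgue_rV R n]_(y in @cube R n) G (translate c y) =
   \int[lebesgue_rV R n]_(y in @cube R n) G y)%E.
Proof.
elim: n c G => [|n IH] c G mG G0.
  by apply: eq_integral => y _; congr G; apply/rowP => -[].
have mGc : measurable_fun [set: 'rV[R]_n.+1] (fun y => G (translate c y)).
  by apply: (measurableT_comp mG); apply: measurable_translate => //; exact: measurable_cst.
have m01 : measurable (`[0, 1[%classic : set mR) by exact: measurable_itv.
have mcu : measurable (@cube R n) by exact: measurable_cube.
have mGcons : measurable_fun [set: (mR * 'rV[R]_n)%type] (fun z => G (cons_rV z)).
  exact: (measurableT_comp mG (@measurable_cons_rV R n)).
have mGTcons : measurable_fun [set: (mR * 'rV[R]_n)%type] (fun z => G (translate c (cons_rV z))).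
  exact: (measurableT_comp mGc (@measurable_cons_rV R n)).
rewrite !ge0_integral_rV_succ//; [|exact: measurable_cube|exact: measurable_funTS
  |exact: measurable_cube|exact: measurable_funTS].
rewrite preimage_cube.
rewrite (tonelli_on leb (lebesgue_rV R n) m01 mcu (measurable_funTS mGcons) (fun z _ => G0 _)).2.
rewrite (tonelli_on leb (lebesgue_rV R n) m01 mcu (measurable_funTS mGTcons) (fun z _ => G0 _)).2.
pose c' : 'rV[R]_n := \row_j c 0 (lift 0 j).
pose Phi (x : mR) := (\int[lebesgue_rV R n]_(y in @cube R n) G (cons_rV (x, y)))%E.
have mPhi : measurable_fun [set: mR] Phi.
  apply: (tonelli_on leb (lebesgue_rV R n) measurableT mcu _ (fun z _ => G0 _)).1.
  exact: (measurable_funTS mGcons).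
have Phi0 x : (0 <= Phi x)%E by apply: integral_ge0 => y _; exact: G0.
rewrite -(ge0_integral_frac (c 0 0) mPhi Phi0); apply: eq_integral => x _.
rewrite /Phi -(IH c'); last by move=> y; exact: G0.
  apply: eq_integral => y _; congr G; apply/rowP => i; rewrite mxE.
  have [->|[j ->]] : i = 0 \/ exists j, i = lift 0 j.
    by case: (unliftP 0 i) => [j ->|->]; [right; exists j|left].
  - by rewrite !cons_rV0.
  - by rewrite !cons_rVS !mxE.
apply: (measurableT_comp mG); apply: (measurableT_comp (@measurable_cons_rV R n)).
exact: measurable_pair1.
Qed.

(** Straightens the rays of direction [(1, b)]: the point at time [t] on the ray from [a] is the
    image of [(t, a)]. For each [t] it is a translation of the torus, hence it preserves the
    volume. *)
Definition shear n (b : 'rV[R]_n) (z : mR * 'rV[R]_n) : mR * 'rV[R]_n :=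
  (z.1, translate (z.1 *: b) z.2).

Lemma measurable_shear n (b : 'rV[R]_n) : measurable_fun [set: mR * 'rV[R]_n] (shear b).
Proof.
apply/measurable_fun_pairP; split; first exact: measurable_fst.
apply: measurable_translate; last exact: measurable_snd.
apply: measurable_fun_rV => j; under eq_fun do rewrite mxE.
by apply: measurable_funM => //; exact: measurable_fst.
Qed.

Lemma shear_cell n (b : 'rV[R]_n) z : cell z -> cell (shear b z).
Proof. by move=> [z1 _]; split => //; exact: translate_cube. Qed.

Lemma ge0_integral_shear n (b : 'rV[R]_n) (G : mR * 'rV[R]_n -> \bar R) :
  measurable_fun [set: mR * 'rV[R]_n] G -> (forall z, 0 <= G z)%E ->
  (\int[volM R n]_(z in @cell R n) G (shear b z) = \int[volM R n]_(z in @cell R n) G z)%E.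
Proof.
move=> mG G0; have m01 : measurable (`[0, 1]%classic : set mR) by exact: measurable_itv.
have mcu : measurable (@cube R n) by exact: measurable_cube.
have mGs := measurableT_comp mG (measurable_shear b).
rewrite (tonelli_on leb (lebesgue_rV R n) m01 mcu (measurable_funTS mG) (fun z _ => G0 _)).2.
rewrite (tonelli_on leb (lebesgue_rV R n) m01 mcu (measurable_funTS mGs) (fun z _ => G0 _)).2.
apply: eq_integral => x _; rewrite /= /shear/=.
rewrite (ge0_integral_translate (x *: b) (G := fun y => G (x, y)))//.
exact: (measurableT_comp mG (measurable_pair1 x)).
Qed.

End translations_of_the_torus.

Lemma continuous_pair (T U W : topologicalType) (f : T -> U) (g : T -> W) :
  continuous f -> continuous g -> continuous (fun z => (f z, g z)).
Proof. by move=> cf cg z; exact: (cvg_pair (cf z) (cg z)). Qed.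

Section integration_by_parts.
Context (R : realType) (n : nat).
Local Notation V := (R * 'rV[R]_n)%type.
Local Notation mV := (measurableTypeR R * 'rV[R]_n)%type.
Local Notation leb := (@lebesgue_measure R).
Local Notation lebn := (lebesgue_rV R n).
Local Notation cellM := (@cell R n : set mV).
Local Notation cubeM := (@cube R n).
Let mC : measurable cellM. Proof. exact: measurable_cell. Qed.
Let mQ : measurable cubeM. Proof. exact: measurable_cube. Qed.
Let mI : measurable (`[0, 1]%classic : set (measurableTypeR R)).
Proof. exact: measurable_itv. Qed.

Lemma continuous_rintble_cell (a : V -> R) : continuous a -> rintble (volM R n) cellM a.
Proof.
move=> ca; have [B aB] := continuous_bounded_cell ca.
have vC : (volM R n cellM < +oo)%E by rewrite volM_cell ltry.
apply: (rintble_le mC _ _ (rintble_cst mC vC B)).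
  by apply: measurable_funTS; exact: continuous_measurable_RrV.
move=> z [z1 z2]; by apply: aB => // j; have /andP[-> /ltW ->] := z2 j.
Qed.

Lemma continuous_measurable_rV (a : 'rV[R]_n -> R) : continuous a ->
  measurable_fun [set: 'rV[R]_n] a.
Proof.
move=> ca; have /continuous_measurable_RrV ma : continuous (fun z : V => a z.2).
  by move=> z; apply: continuous_comp; [exact: cvg_snd|exact: ca].
by have := measurableT_comp ma (measurable_pair1 (0 : measurableTypeR R)).
Qed.

Lemma coordM_lift j : coordM R (lift 0 j) = (0, delta_mx 0 j) :> R * 'rV[R]_n.
Proof.
rewrite /coordM /uncons_rV mxE /=; congr (_, _); apply/rowP => k; rewrite !mxE /=.
by rewrite (inj_eq lift_inj).
Qed.

Lemma coordM0 : coordM R 0 = (1, 0) :> R * 'rV[R]_n.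
Proof. by rewrite /coordM /uncons_rV mxE; congr (_, _); apply/rowP => k; rewrite !mxE. Qed.

Lemma C1dir_periodic v (a Da : V -> R) : C1dir v a Da -> periodic_on setT a ->
  periodic_on setT Da.
Proof.
move=> [_ _ da] pa z q _.
have D y : Da y = derive (fun s : R => a (y + s *: v)) (0 : R) (1 : R).
  by have [_] := da y 0; rewrite scale0r addr0 => <-.
rewrite !D; congr (derive _ (0 : R) (1 : R)); apply/funext => s.
rewrite -(pa (z + s *: v) q)//; congr a.
by apply: injective_projections => //=; rewrite addrAC.
Qed.

Lemma translate_periodic (a : V -> R) x c y : periodic_on setT a ->
  a (x, y + c) = a (x, translate c y).
Proof. by move=> pa; rewrite translate_int (pa (x, _)). Qed.

(** By invariance the integral equals its average over the translations by [t] times the [j]-th unit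
    vector, [t] in [[0, 1]]. After exchanging the integrals, the integral over [t] is the increment
    of [a] over a full period, which is 0. *)
Lemma integral_dy j (a Da : V -> R) : C1dir (coordM R (lift 0 j)) a Da ->
  periodic_on setT a -> \int[volM R n]_(z in cellM) Da z = 0.
Proof.
move=> C1a pa; have pDa := C1dir_periodic C1a pa; have [ca cDa da] := C1a.
have [_ -> _] := rfubini_on mI mQ (continuous_rintble_cell cDa).
suff slice0 (x : R) : \int[lebn]_(y in cubeM) Da (x, y) = 0.
  transitivity (\int[leb]_(x in `[0, 1]) (0 : R)); last by rewrite Rintegral_cst ?mul0r.
  by apply: eq_Rintegral => x _; exact: slice0.
(* The first component of [z] serves here as the translation parameter [t], with [x] fixed, so that
   the Fubini theorems for the cell can be reused. *)
pose H (z : V) := Da (x, z.2 + z.1 *: delta_mx 0 j).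
have cH : continuous H.
  move=> z; apply: (continuous_comp (f := fun z : V => (x, z.2 + z.1 *: delta_mx 0 j))); last exact: cDa.
  apply: (@continuous_pair V _ _ (fun=> x)); first exact: cst_continuous.
  by move=> {}z; apply: cvgD; [exact: cvg_snd|apply: cvgZr_tmp; exact: cvg_fst].
have iH := continuous_rintble_cell cH.
have [_ E1 _] := rfubini_on mI mQ iH.
have [_ E2 _] := rfubini_on_swap mI mQ iH.
have inner (t : R) : \int[lebn]_(y in cubeM) H (t, y) = \int[lebn]_(y in cubeM) Da (x, y).
  pose c : 'rV[R]_n := t *: delta_mx 0 j.
  have mDx : measurable_fun cubeM (fun y => Da (x, y)).
    apply: measurable_funTS.
    exact: (measurableT_comp (continuous_measurable_RrV cDa) (measurable_pair1 (x : measurableTypeR R))).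
  rewrite -(integral_preserving mQ (phi := translate c) _ _ mDx).
  - by apply: eq_Rintegral => y _; rewrite /H /= translate_periodic.
  - by move=> y _; exact: translate_cube.
  - by move=> G mG G0; exact: ge0_integral_translate.
transitivity (\int[leb]_(t in `[0, 1]) \int[lebn]_(y in cubeM) Da (x, y)).
  by rewrite Rintegral_cst// [X in fine X](lebesgue_itv01 R) /= mulr1.
transitivity (\int[leb]_(t in `[0, 1]) \int[lebn]_(y in cubeM) H (t, y)).
  by apply: eq_Rintegral => t _; exact/esym/inner.
rewrite -[LHS]E1 [LHS]E2.
transitivity (\int[lebn]_(y in cubeM) (0 : R)); last by rewrite Rintegral_cst ?mul0r.
apply: eq_Rintegral => y _.
transitivity ((fun t : R => a (x, y + t *: delta_mx 0 j)) 1 - (fun t : R => a (x, y + t *: delta_mx 0 j)) 0).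
  apply: (FTC_unit (F := fun t : R => a (x, y + t *: delta_mx 0 j))); last first.
    move=> t; have := da (x, y) t; rewrite /H coordM_lift /=.
    have E s : (x, y) + s *: ((0 : R), delta_mx 0 j) = (x, y + s *: delta_mx 0 j) :> V.
      by apply: injective_projections => //=; rewrite scaler0 addr0.
    by under eq_fun do rewrite E; rewrite E.
  move=> t; apply: (continuous_comp (f := fun t : R => (x, y + t *: delta_mx 0 j))); last exact: cDa.
  apply: (@continuous_pair R _ _ (fun=> x)); first exact: cst_continuous.
  by move=> {}t; apply: cvgD; [exact: cvg_cst|apply: cvgZr_tmp; exact: cvg_id].
rewrite /= scale1r scale0r addr0; apply/eqP; rewrite subr_eq0; apply/eqP.
rewrite -(pa (x, y) (delta_mx 0 j) Logic.I) /=.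
by congr (a (_, _ + _)); apply/rowP => k; rewrite !mxE; case: (_ && _).
Qed.

Lemma integral_dx (a Da : V -> R) : C1dir (coordM R 0) a Da ->
  \int[volM R n]_(z in cellM) Da z = \int[lebn]_(y in cubeM) (a (1, y) - a (0, y)).
Proof.
move=> [ca cDa da].
have [_ -> _] := rfubini_on_swap mI mQ (continuous_rintble_cell cDa); apply: eq_Rintegral => y _.
apply: (FTC_unit (F := fun t : R => a (t, y))).
  move=> t; apply: (continuous_comp (f := fun t : R => (t, y))); last exact: cDa.
  by apply: (@continuous_pair R _ _ id); [move=> {}t; exact: cvg_id|exact: cst_continuous].
move=> t; have := da (0, y) t; rewrite coordM0 /=.
have E s : (0, y) + s *: ((1 : R), 0) = (s, y) :> V.
  by apply: injective_projections => /=; rewrite ?scaler0 ?addr0// add0r [LHS]mulr1.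
by under eq_fun do rewrite E; rewrite E.
Qed.

Definition cC1dir v (F DF : V -> R[i]) :=
  C1dir v (fun z => cRe (F z)) (fun z => cRe (DF z)) /\
  C1dir v (fun z => cIm (F z)) (fun z => cIm (DF z)).

Lemma eq_cC1dir v F G DF DG : F =1 G -> DF =1 DG -> cC1dir v F DF -> cC1dir v G DG.
Proof. by move=> /funext -> /funext ->. Qed.

Lemma cC1dirM v F G DF DG : cC1dir v F DF -> cC1dir v G DG ->
  cC1dir v (fun z => F z * G z) (fun z => DF z * G z + F z * DG z).
Proof.
move=> [F1 F2] [G1 G2]; split.
  have := C1dirD (C1dirM F1 G1) (C1dirN (C1dirM F2 G2)); congr C1dir; apply/funext => z; rewrite cpartE//.
  by rewrite !cpartE; ring.
have := C1dirD (C1dirM F1 G2) (C1dirM F2 G1); congr C1dir; apply/funext => z; rewrite cpartE//.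
by rewrite !cpartE; ring.
Qed.

Lemma cC1dir_real v (a Da : V -> R) : C1dir v a Da ->
  cC1dir v (fun z => (a z)%:C%C) (fun z => (Da z)%:C%C).
Proof. by move=> da; split => //; exact: C1dir_cst. Qed.

Lemma cC1dir_cst v c : cC1dir v (fun=> c) (fun=> 0).
Proof. by split; exact: C1dir_cst. Qed.

Lemma cC1dirD v F G DF DG : cC1dir v F DF -> cC1dir v G DG ->
  cC1dir v (fun z => F z + G z) (fun z => DF z + DG z).
Proof.
move=> [F1 F2] [G1 G2]; split.
  by have := C1dirD F1 G1; congr C1dir; apply/funext => z; rewrite cpartE.
by have := C1dirD F2 G2; congr C1dir; apply/funext => z; rewrite cpartE.
Qed.

Lemma cC1dir_sum v (I : Type) (r : seq I) (F DF : I -> V -> R[i]) :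
  (forall i, cC1dir v (F i) (DF i)) ->
  cC1dir v (fun z => \sum_(i <- r) F i z) (fun z => \sum_(i <- r) DF i z).
Proof.
move=> h; elim: r => [|i r IH].
  by apply: eq_cC1dir (cC1dir_cst v 0) => z; rewrite big_nil.
by apply: eq_cC1dir (cC1dirD (h i) IH) => z; rewrite big_cons.
Qed.

Lemma cC1dirZ v c F DF : cC1dir v F DF -> cC1dir v (fun z => c * F z) (fun z => c * DF z).
Proof.
move=> h; apply: eq_cC1dir (cC1dirM (cC1dir_cst v c) h) => z //.
by rewrite mul0r add0r.
Qed.

(** The number [2 pi i]. *)
Definition tpi : R[i] := Complex 0 (2 * pi).

Lemma cC1dir_chi (i : 'I_n.+1) s (w : 'rV[R]_n) :
  cC1dir (coordM R i) (chi s w) (fun z => tpi * (cons_rV (s, w) 0 i)%:C%C * chi s w z).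
Proof.
pose L (z : V) := 2 * pi * (s * z.1 + \sum_j w 0 j * z.2 0 j).
have cL : continuous L.
  have -> : L = (fun z : V => 2 * pi * (s * z.1 + \sum_(j <- enum 'I_n) w 0 j * z.2 0 j)).
    by apply/funext => z; rewrite /L big_enum.
  move=> z; apply: cvgM; first exact: cvg_cst.
  apply: cvgD; first by apply: cvgM; [exact: cvg_cst|exact: cvg_fst].
  elim: (enum 'I_n) => [|j r IH].
    rewrite big_nil; under eq_fun do rewrite big_nil; exact: cvg_cst.
  rewrite big_cons; under eq_fun do rewrite big_cons; apply: cvgD => //.
  apply: cvgM; first exact: cvg_cst.
  apply: (continuous_comp (f := snd) (g := fun y : 'rV[R]_n => y 0 j)); first exact: cvg_snd.
  exact: coord_continuous.
have Lv z t : L (z + t *: coordM R i) = L z + t * (2 * pi * cons_rV (s, w) 0 i).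
  rewrite /L; case: (unliftP 0 i) => [j ->|->].
    rewrite coordM_lift cons_rVS /= scaler0 addr0.
    under eq_bigr do rewrite mxE mulrDr.
    rewrite big_split/= (_ : \sum_i w 0 i * (t *: delta_mx 0 j) 0 i = t * w 0 j); first by ring.
    rewrite (bigD1 j)//= big1 ?addr0; first by rewrite !mxE !eqxx mulr1 mulrC.
    by move=> k kj; rewrite !mxE (negbTE kj) andbF mulr0 mulr0.
  rewrite coordM0 cons_rV0 /= [t *: 1]mulr1.
  under eq_bigr => k _ do rewrite !mxE mulr0 addr0.
  ring.
have [C1 C2] := C1dir_trig cL Lv.
apply: (@eq_cC1dir _ (fun z => expi (L z)) _ (fun z => tpi * (cons_rV (s, w) 0 i)%:C%C * expi (L z))).
- by move=> z; rewrite chi_expi.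
- by move=> z; rewrite chi_expi.
split; [move: C1|move: C2]; congr C1dir; apply/funext => z; rewrite !cpartE /=; ring.
Qed.

Lemma cintegral_dy j F DF : cC1dir (coordM R (lift 0 j)) F DF ->
  periodic_on setT F -> cintegral (volM R n) cellM DF = 0.
Proof.
move=> [h1 h2] pF; rewrite /cintegral (integral_dy h1) ?(integral_dy h2)// => z q _.
- by rewrite pF.
- by rewrite pF.
Qed.

Lemma cC1dir_csq v F DF : cC1dir v F DF -> csq (volM R n) cellM F.
Proof.
move=> [[c1 _ _] [c2 _ _]]; split.
  by split; apply: measurable_funTS; exact: continuous_measurable_RrV.
apply: (@continuous_rintble_cell (fun z => sqn (F z))) => z; rewrite /sqn.
by apply: cvgD; [exact: (cvgM (c1 z) (c1 z))|exact: (cvgM (c2 z) (c2 z))].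
Qed.

Lemma cintegral_dx F DF : cC1dir (coordM R 0) F DF ->
  cintegral (volM R n) cellM DF = cintegral lebn cubeM (fun y => F (1, y) - F (0, y)).
Proof.
move=> [h1 h2]; rewrite /cintegral (integral_dx h1) (integral_dx h2).
by congr Complex; apply: eq_Rintegral => y _; rewrite !cpartE.
Qed.

End integration_by_parts.
Arguments tpi {R}.

(** * The X-ray transform on the Fourier side *)

Section xray_pairing.
Context (R : realType) (n : nat).
Local Notation V := (R * 'rV[R]_n)%type.
Local Notation mV := (measurableTypeR R * 'rV[R]_n)%type.
Local Notation leb := (@lebesgue_measure R).
Local Notation lebn := (lebesgue_rV R n).
Local Notation cellM := (@cell R n : set mV).
Local Notation cubeM := (@cube R n).
Let mC : measurable cellM. Proof. exact: measurable_cell. Qed.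
Let mQ : measurable cubeM. Proof. exact: measurable_cube. Qed.
Let mI : measurable (`[0, 1]%classic : set (measurableTypeR R)).
Proof. exact: measurable_itv. Qed.

Definition dotp (w y : 'rV[R]_n) : R := \sum_j w 0 j * y 0 j.

Lemma chiqE w y : chiq w y = expi (2 * pi * dotp w y) :> R[i].
Proof. by []. Qed.

Lemma chiE s w z : chi s w z = expi (2 * pi * (s * z.1 + dotp w z.2)) :> R[i].
Proof. exact: chi_expi. Qed.

Lemma dotpDr w y y' : dotp w (y + y') = dotp w y + dotp w y'.
Proof. by rewrite -big_split; apply: eq_bigr => j _; rewrite mxE mulrDr. Qed.

Lemma dotpZr w c y : dotp w (c *: y) = c * dotp w y.
Proof. by rewrite mulr_sumr; apply: eq_bigr => j _; rewrite mxE; ring. Qed.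

Lemma dotp_intr (k q : 'rV[int]_n) : dotp (map_mx intr k) (map_mx intr q) = (\sum_j k 0 j * q 0 j)%:~R.
Proof. by rewrite rmorph_sum/=; apply: eq_bigr => j _; rewrite !mxE rmorphM. Qed.

Lemma chiq_periodic (k q : 'rV[int]_n) y :
  chiq (map_mx intr k) (y + map_mx intr q) = chiq (map_mx intr k) y :> R[i].
Proof. by rewrite !chiqE dotpDr mulrDr expiD dotp_intr expi2pi mulr1. Qed.

Lemma chi_periodic s (k : 'rV[int]_n) : periodic_on setT (chi s (map_mx intr k) : V -> R[i]).
Proof. by move=> z q _; rewrite /chi chiq_periodic. Qed.

(** The X-ray transform of a scalar function; it is applied to [G = f (.; 1, b)] with [b] fixed. *)
Definition xray_fun (G : V -> R[i]) (b a : 'rV[R]_n) : R[i] :=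
  cintegral leb `[0, 1] (fun t => G (t, a + t *: b)).

Lemma shear_periodic T (G : V -> T) (b : 'rV[R]_n) z : slab z -> periodic_on (@slab R n) G ->
  G (z.1, z.2 + z.1 *: b) = G (shear b z).
Proof. by move=> [z1 _] pG; rewrite translate_int (pG (z.1, _)). Qed.

Lemma shear_cintble G b : cintble (volM R n) cellM G ->
  cintble (volM R n) cellM (fun z => G (shear b z)).
Proof.
apply: cintble_preserving => //; first exact: measurable_shear.
- by move=> z; exact: shear_cell.
- exact: ge0_integral_shear.
Qed.

Lemma shear_cintegral G b : cintble (volM R n) cellM G ->
  cintegral (volM R n) cellM (fun z => G (shear b z)) = cintegral (volM R n) cellM G.
Proof.
move=> iG; apply: cintegral_preserving => //; last exact: cintble_meas iG.
- by move=> z; exact: shear_cell.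
- exact: ge0_integral_shear.
Qed.

Lemma xray_funE G b a : periodic_on (@slab R n) G ->
  xray_fun G b a = cintegral leb `[0, 1] (fun t : measurableTypeR R => G (shear b (t, a))).
Proof.
move=> pG; apply: (eq_cint (G := fun t : measurableTypeR R => _)) => t /set_mem t01.
by rewrite -(shear_periodic b _ pG).
Qed.

(** The Fourier coefficient of the transform is an integral over the cell in the variables [(t, a)].
    The shear carries it to the variables [(t, y)] with [a = y - t b], where [chiq k a] becomes
    [chi (- k . b) k (t, y)]. *)
Lemma xray_fun_pairing G b (k : 'rV[int]_n) : periodic_on (@slab R n) G ->
  cintble (volM R n) cellM G ->
  cintble lebn cubeM (xray_fun G b) /\
  cintegral lebn cubeM (fun a => xray_fun G b a * chiq (map_mx intr k) a) =
  cintegral (volM R n) cellM (fun z => G z * chi (- dotp (map_mx intr k) b) (map_mx intr k) z).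
Proof.
move=> pG iG; have iGs := shear_cintble b iG.
pose ch (z : mV) := chi (- dotp (map_mx intr k) b) (map_mx intr k) z.
have iGc : cintble (volM R n) cellM (fun z => G z * ch z).
  apply: (cintbleM1 mC iG); first exact: cmeas_chi.
  by move=> z _; rewrite /ch sqn_chi.
have [i1 _ a1] := cfubini_on_swap mI mQ iGs.
have ix : cintble lebn cubeM (xray_fun G b) by apply: (eq_cintble mQ _ i1) => a _; rewrite xray_funE.
split => //.
rewrite -(shear_cintegral b iGc); have [i2 -> _] := cfubini_on_swap mI mQ (shear_cintble b iGc).
apply: ae_eq_cint => //.
- by apply: cmeasM; [exact: cintble_meas ix|exact: cmeas_chiq].
- exact: cintble_meas i2.
(* Along the ray from [a] the character [chi (- k . b) k] is constant, equal to [chiq k a], so it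
   leaves the integral over [t]. *)
- apply: filterS a1 => a /[swap] Qa /(_ Qa) ia; rewrite xray_funE// mulrC -(cintZ mI _ ia).
  apply: (eq_cint (G := fun t : measurableTypeR R => _)) => t _; rewrite mulrC; congr (_ * _).
  rewrite /ch /shear/= -[in RHS](@chi_periodic _ k (t, translate (t *: b) a)
    (\row_j Num.floor (a 0 j + (t *: b) 0 j)) Logic.I) /= chiE/= -translate_int chiqE.
  by rewrite dotpDr dotpZr; congr expi; ring.
Qed.

(** Totality of the characters of the torus: the transform, integrable in [a], vanishes almost
    everywhere exactly when its Fourier coefficients do. *)
Lemma xray_fun_vanishes G b : periodic_on (@slab R n) G ->
  cintble (volM R n) cellM G ->
  (forall k : 'rV[int]_n, cintegral (volM R n) cellM
    (fun z => G z * chi (- dotp (map_mx intr k) b) (map_mx intr k) z) = 0) <->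
  {ae lebn, forall a, cubeM a -> xray_fun G b a = 0}.
Proof.
move=> pG iG; have [ix _] := xray_fun_pairing b 0 pG iG; split=> H.
  apply: (ctotal_cube ix) => k.
  by have [_ ->] := xray_fun_pairing b k pG iG.
move=> k; have [_ <-] := xray_fun_pairing b k pG iG.
transitivity (cintegral lebn cubeM (fun=> 0 : R[i])); last by rewrite cint0.
apply: ae_eq_cint => //.
  by apply: cmeasM; [exact: cintble_meas ix|exact: cmeas_chiq].
by apply: filterS H => a h Qa; rewrite h// mul0r.
Qed.

End xray_pairing.

(** * The norm of L^2(S^n) and the coefficients *)

Section coefficient_bound.
Context d (T : measurableType d) (R : realType) (mu : {measure set T -> \bar R}).
Variables (D : set T) (mD : measurable D) (K : nat) (e : 'I_K -> T -> R[i]).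
Hypothesis ce : forall i, csq mu D (e i).
Hypothesis free : forall c : 'I_K -> R[i],
  nsq mu D (fun z => \sum_i c i * e i z) = 0 -> forall i, c i = 0.

(* The Gram matrix is invertible, so the e_i have a dual family in their span. *)
Lemma coefficient_bound : exists2 C : R, 0 <= C &
  forall (c : 'I_K -> R[i]) i, sqn (c i) <= C * nsq mu D (fun z => \sum_i c i * e i z).
Proof.
pose S c z : R[i] := \sum_(i < K) c i * e i z.
have cS c : csq mu D (S c) by apply: csq_sum => // i _; exact: csqZ.
pose G : 'M[R[i]]_K := \matrix_(i, j) cintegral mu D (fun z => e i z * conjc (e j z)).
have SG c j : cintegral mu D (fun z => S c z * conjc (e j z)) = \sum_i c i * G i j.
  under [RHS]eq_bigr => i _ do rewrite mxE -(cintZ mD _ (csq_mul mD (ce i) (csqJ mD (ce j)))).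
  rewrite -cint_sum//; last first.
    by move=> i _; apply: cintbleZ => //; apply: csq_mul => //; exact: csqJ.
  by apply: eq_cint => z _; rewrite mulr_suml; apply: eq_bigr => i _; rewrite mulrA.
have Gu : G \in unitmx.
  (* A vector in the left kernel of the Gram matrix gives a combination orthogonal to every [e j],
     hence to itself; freeness makes the vector 0. *)
  rewrite -row_free_unit; apply: inj_row_free => v vG.
  have SG0 j : cintegral mu D (fun z => S (v 0) z * conjc (e j z)) = 0.
    by rewrite SG; move/rowP/(_ j): vG; rewrite !mxE.
  suff /free v0 : nsq mu D (S (v 0)) = 0 by apply/rowP => i; rewrite v0 mxE.
  rewrite nsq_cRe.
  rewrite (eq_cint (G := fun z => \sum_j conjc (v 0 j) * (S (v 0) z * conjc (e j z)))); last first.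
    move=> z _; rewrite [X in _ * conjc X]/S rmorph_sum/= mulr_sumr; apply: eq_bigr => j _.
    by rewrite conjcM; ring.
  rewrite cint_sum//; last first.
    by move=> i _; apply: cintbleZ => //; apply: csq_mul => //; exact: csqJ.
  rewrite big1// => j _; rewrite cintZ ?SG0 ?mulr0//.
  by apply: csq_mul => //; exact: csqJ.
pose F i z : R[i] := \sum_j invmx G j i * conjc (e j z).
have cF i : csq mu D (F i) by apply: csq_sum => // j _; apply: csqZ => //; exact: csqJ.
have dual c i : cintegral mu D (fun z => S c z * F i z) = c i.
  rewrite (eq_cint (G := fun z => \sum_j invmx G j i * (S c z * conjc (e j z)))); last first.
    by move=> z _; rewrite mulr_sumr; apply: eq_bigr => j _; ring.
  rewrite cint_sum//; last first.
    by move=> j _; apply: cintbleZ => //; apply: csq_mul => //; exact: csqJ.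
  under eq_bigr => j _.
    rewrite cintZ ?SG//; last by apply: csq_mul => //; exact: csqJ.
    over.
  have /matrixP/(_ 0 i) : (\row_i c i) *m (G *m invmx G) = \row_i c i by rewrite mulmxV// mulmx1.
  rewrite mulmxA !mxE => <-; apply: eq_bigr => j _; rewrite mxE mulrC; congr (_ * _).
  by apply: eq_bigr => l _; rewrite !mxE.
(* Cauchy-Schwarz against the dual function [F i]; the sum over all [i] makes the constant
   uniform. *)
exists (\sum_i 2 * nsq mu D (F i)); first by apply: sumr_ge0 => i _; rewrite mulr_ge0// nsq_ge0.
move=> c i; rewrite -{1}(dual c i) (le_trans (cauchy_schwarz mD (cS c) (cF i)))//.
rewrite mulrCA mulrC; apply: ler_wpM2r; first exact: nsq_ge0.
rewrite (bigD1 i)//= lerDl; apply: sumr_ge0 => j _; by rewrite mulr_ge0// nsq_ge0.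
Qed.

End coefficient_bound.

(** A crude constant, which depends on the number of terms alone. *)
Lemma sqn_sum_le (R : realType) (I : Type) (r : seq I) (x : I -> R[i]) :
  sqn (\sum_(i <- r) x i) <= 2 ^+ size r * \sum_(i <- r) sqn (x i).
Proof.
elim: r => [|i r IH]; first by rewrite !big_nil sqn0 mulr0.
rewrite !big_cons; apply: le_trans (sqnD_le _ _) _ => /=.
have h1 : 1 <= 2 ^+ size r :> R by rewrite exprn_ege1// ler1n.
have h2 := sqn_ge0 (x i).
by rewrite exprS; nra.
Qed.

Section lebesgue_rV_box.
Context (R : realType).

Lemma lebesgue_rV_box n (c : 'rV[R]_n) (e : R) : 0 < e ->
  measurable [set u : 'rV[R]_n | forall i, c 0 i <= u 0 i <= c 0 i + e] /\
  lebesgue_rV R n [set u | forall i, c 0 i <= u 0 i <= c 0 i + e] = (e ^+ n)%:E.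
Proof.
move=> e0; have mB k (c' : 'rV[R]_k) :
    measurable [set u : 'rV[R]_k | forall i, c' 0 i <= u 0 i <= c' 0 i + e].
  rewrite (_ : [set u | _] = \bigcap_(i in [set: 'I_k]) ((fun u : 'rV[R]_k => u 0 i) @^-1`
      `[c' 0 i, c' 0 i + e])).
    apply: fin_bigcap_measurable => // i _; rewrite -[X in measurable X]setTI.
    exact: measurable_coord.
  apply/seteqP; split => u h i; first by move=> _; rewrite /= in_itv; exact: h.
  by have := h i Logic.I; rewrite /= in_itv.
split => //; elim: n c => [|n IH] c.
  by rewrite /= diracE mem_set//; case.
rewrite [LHS](_ : _ = (@lebesgue_measure R \x lebesgue_rV R n)%E
  (@cons_rV R n @^-1` [set u | forall i, c 0 i <= u 0 i <= c 0 i + e]))//.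
rewrite (_ : _ @^-1` _ = (`[c 0 0, c 0 0 + e] `*` [set u : 'rV[R]_n | forall i, (\row_j c 0 (lift 0 j)) 0 i <= u 0 i
     <= (\row_j c 0 (lift 0 j)) 0 i + e])); last first.
  apply/seteqP; split => [[x y] /= h|[x y] /= [x01 y01] i].
    split => /=; first by have := h 0; rewrite cons_rV0 in_itv.
    by move=> j; have := h (lift 0 j); rewrite cons_rVS mxE.
  have [->|[j ->]] : i = 0 \/ exists j, i = lift 0 j.
    by case: (unliftP 0 i) => [j ->|->]; [right; exists j|left].
  - by rewrite cons_rV0; move: x01; rewrite in_itv.
  - by rewrite cons_rVS; have := y01 j; rewrite mxE.
rewrite product_measure1E; [|exact: measurable_itv|exact: mB].
have h : @lebesgue_measure R `[c 0 0, c 0 0 + e]%classic = e%:E.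
  by rewrite lebesgue_measure_itv/= lte_fin ltrDl e0 -EFinD addrAC subrr add0r.
by rewrite [X in (X * _)%E](_ : _ = e%:E)// IH -EFinM exprS.
Qed.

End lebesgue_rV_box.

Section continuity_of_evalP.
Context (R : realType) (n : nat).

Let cont (F : 'rV[R]_n.+1 -> R[i]) := continuous (fun u => cRe (F u)) /\ continuous (fun u => cIm (F u)).

Let contM F G : cont F -> cont G -> cont (fun u => F u * G u).
Proof.
move=> [F1 F2] [G1 G2]; split.
  rewrite (_ : (fun u => _) = fun u => cRe (F u) * cRe (G u) - cIm (F u) * cIm (G u)).
    by move=> u; exact: (@continuousB _ R^o _ _ _ _ (continuousM (F1 u) (G1 u)) (continuousM (F2 u) (G2 u))).
  by apply/funext => u; rewrite cpartE.
rewrite (_ : (fun u => _) = fun u => cRe (F u) * cIm (G u) + cIm (F u) * cRe (G u)).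
  by move=> u; exact: (@continuousD _ R^o _ _ _ _ (continuousM (F1 u) (G2 u)) (continuousM (F2 u) (G1 u))).
by apply/funext => u; rewrite cpartE.
Qed.

Let contD F G : cont F -> cont G -> cont (fun u => F u + G u).
Proof.
move=> [F1 F2] [G1 G2]; split.
  rewrite (_ : (fun u => _) = fun u => cRe (F u) + cRe (G u)).
    by move=> u; exact: (@continuousD _ R^o _ _ _ _ (F1 u) (G1 u)).
  by apply/funext => u; rewrite cpartE.
rewrite (_ : (fun u => _) = fun u => cIm (F u) + cIm (G u)).
  by move=> u; exact: (@continuousD _ R^o _ _ _ _ (F2 u) (G2 u)).
by apply/funext => u; rewrite cpartE.
Qed.

Let cont_cst c : cont (fun=> c). Proof. by split; exact: cst_continuous. Qed.

Let eq_cont F G : F =1 G -> cont F -> cont G.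
Proof. by move=> /funext ->. Qed.

Lemma continuous_evalP (p : mpoly n.+1 R[i]) :
  continuous (fun u => cRe (evalP p u)) /\ continuous (fun u => cIm (evalP p u)).
Proof.
suff : cont (evalP p) by [].
pose X i (u : 'rV[R]_n.+1) : R[i] := (u 0 i)%:C%C.
apply: (@eq_cont (fun u => \sum_(m <- msupp p) mcoeff m p * \prod_(i <- enum 'I_n.+1) X i u ^+ m i)).
  by move=> u; rewrite /evalP mevalE; apply: eq_bigr => m _; rewrite big_enum.
elim: (msupp p) => [|m r IH].
  by apply: (@eq_cont (fun=> 0)); [move=> u; rewrite big_nil|exact: cont_cst].
apply: (@eq_cont (fun u => mcoeff m p * \prod_(i <- enum 'I_n.+1) X i u ^+ m i +
   \sum_(m <- r) mcoeff m p * \prod_(i <- enum 'I_n.+1) X i u ^+ m i)).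
  by move=> u; rewrite big_cons.
apply: contD => //; apply: contM; first exact: cont_cst.
elim: (enum _) => [|i s IHs].
  by apply: (@eq_cont (fun=> 1)); [move=> u; rewrite big_nil|exact: cont_cst].
apply: (@eq_cont (fun u => X i u ^+ m i * \prod_(i <- s) X i u ^+ m i)).
  by move=> u; rewrite big_cons.
apply: contM => //; elim: (m i) => [|k IHk]; first exact: cont_cst.
apply: (@eq_cont (fun u => X i u * X i u ^+ k)); first by move=> u; rewrite exprS.
apply: contM => //; split; last exact: cst_continuous.
exact: coord_continuous.
Qed.

Lemma cmeas_evalP (p : mpoly n.+1 R[i]) (D : set 'rV[R]_n.+1) : cmeas D (evalP p).
Proof.
by have [c1 c2] := continuous_evalP p; split; apply: measurable_funTS; exact: continuous_measurable_rV.
Qed.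

End continuity_of_evalP.

Section normP_coefficients.
Context (R : realType) (n : nat).
Local Notation sph := (@sphere_measure R n).
Local Notation ball := (@euclid_ball R n.+1).
Local Notation P := (mpoly n.+1 R[i]).

Lemma euclid_coord (u : 'rV[R]_n.+1) i : `|u 0 i| <= euclid u.
Proof.
rewrite -sqrtr_sqr /euclid ler_wsqrtr// (bigD1 i)//= lerDl.
by apply: sumr_ge0 => j _; exact: sqr_ge0.
Qed.

Lemma euclidZ c (u : 'rV[R]_n.+1) : euclid (c *: u) = `|c| * euclid u.
Proof.
rewrite /euclid (eq_bigr (fun i => c ^+ 2 * u 0 i ^+ 2)); last by move=> i _; rewrite mxE exprMn.
by rewrite -mulr_sumr sqrtrM ?sqr_ge0// sqrtr_sqr.
Qed.

Lemma normalize_ball (u : 'rV[R]_n.+1) : ball (normalize u).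
Proof.
rewrite /euclid_ball /= /normalize euclidZ normfV ger0_norm ?sqrtr_ge0//.
by have [->|u0] := eqVneq (euclid u) 0; rewrite ?mulr0// mulVf.
Qed.

Lemma normalizeK (u : 'rV[R]_n.+1) : u = euclid u *: normalize u.
Proof.
rewrite /normalize scalerA; have [u0|u0] := eqVneq (euclid u) 0; last by rewrite mulfV// scale1r.
rewrite u0 mul0r scale0r; apply/rowP => i; rewrite mxE; apply/eqP.
by rewrite -normr_le0 -u0; exact: euclid_coord.
Qed.

Lemma measurable_unit_ball : measurable ball.
Proof. exact: measurable_euclid_ball. Qed.

(** Norms for the sphere measure can thus be computed on the closed ball, where monomials are
    bounded. The ball, unlike the sphere, contains every normalized vector, including
    [normalize 0 = 0], so the preimage of its complement is empty. *)
Lemma sphere_ballC : sph (~` ball) = 0%E.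
Proof.
rewrite /sphere_measure (_ : _ `&` _ = set0) ?measure0 ?mule0//.
by apply/seteqP; split => // u [/= h _]; apply: h; exact: normalize_ball.
Qed.

Lemma sphere_ball_lty : (sph ball < +oo)%E.
Proof.
rewrite /sphere_measure lte_mul_pinfty ?lee_fin//.
have [mb bE] := lebesgue_rV_box (const_mx (-1) : 'rV[R]_n.+1) (ltr0n R 2).
apply: (@le_lt_trans _ _ ((2%:R ^+ n.+1)%:E)); last exact: ltry.
rewrite -bE; apply: le_measure; rewrite ?inE//.
  apply: measurableI; last exact: measurable_unit_ball.
  by rewrite -[X in measurable X]setTI; apply: measurable_normalize => //; exact: measurable_unit_ball.
move=> u [_ /= u1] i; rewrite mxE (_ : -1 + 2%:R = 1); last by ring.
by rewrite -ler_norml (le_trans (euclid_coord u i)).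
Qed.

Lemma sqn_monomial_le al (u : 'rV[R]_n.+1) : ball u -> sqn (evalP (mpolyX R[i] al) u) <= 1.
Proof.
move=> u1; have sqn11 : sqn (1 : R[i]) = 1 by rewrite /sqn /= expr1n expr0n addr0.
have M (x y : R[i]) : sqn x <= 1 -> sqn y <= 1 -> sqn (x * y) <= 1.
  by move=> hx hy; rewrite sqnM mulr_ile1// sqn_ge0.
rewrite /evalP mevalX; apply: (big_ind (fun z => sqn z <= 1)).
- by rewrite sqn11.
- exact: M.
- move=> i _; elim: (al i) => [|k IH]; first by rewrite expr0 sqn11.
  rewrite exprS; apply: M => //; rewrite sqnC -real_normK ?num_real// expr_le1//.
  by rewrite (le_trans (euclid_coord u i)).
Qed.

Lemma evalP_monomials p (u : 'rV[R]_n.+1) :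
  evalP p u = \sum_(m <- msupp p) mcoeff m p * evalP (mpolyX R[i] m) u.
Proof. by rewrite /evalP mevalE; apply: eq_bigr => m _; rewrite mevalX. Qed.

Lemma csq_monomial al : csq sph ball (evalP (mpolyX R[i] al)).
Proof.
apply: (csq_bounded measurable_unit_ball sphere_ball_lty (B := 1)); first exact: cmeas_evalP.
by move=> u; exact: sqn_monomial_le.
Qed.

Lemma csq_evalP p : csq sph ball (evalP p).
Proof.
apply: (@eq_csq _ _ _ _ _ measurable_unit_ball (fun u => \sum_(m <- msupp p) mcoeff m p * evalP (mpolyX R[i] m) u)).
  by move=> u _; rewrite [RHS]evalP_monomials.
apply: csq_sum; first exact: measurable_unit_ball.
by move=> m _; apply: csqZ; [exact: measurable_unit_ball|exact: csq_monomial].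
Qed.

Lemma poweR_normc (c : R[i]) : (`|(ComplexField.Normc.normc c)%:E| `^ 2 = (sqn c)%:E)%E.
Proof.
have E x : `|x%:E|%E = `|x|%:E :> \bar R by [].
rewrite E poweR_EFin ger0_norm; last by case: c => a b; exact: sqrtr_ge0.
rewrite powR_mulrn; last by case: c => a b; exact: sqrtr_ge0.
by case: c => a b; rewrite /= sqr_sqrtr// addr_ge0// sqr_ge0.
Qed.

Lemma normP_sqrt (p : P) : normP p = Num.sqrt (nsq sph ball (evalP p)).
Proof.
have E f : ('N[sph]_2%:E[f] = (\int[sph]_x `|f x| `^ 2) `^ 2^-1)%E by rewrite unlock.
rewrite /normP E (eq_integral (fun u => (sqn (evalP p u))%:E)); last by move=> u _; exact: poweR_normc.
have mp : measurable_fun setT (fun u => (sqn (evalP p u))%:E).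
  by apply/measurable_EFinP; apply: cmeas_sqn => //; exact: cmeas_evalP.
rewrite (ge0_negligible_integral (N := ~` ball))//; last 3 first.
- by apply: measurableC; exact: measurable_unit_ball.
- by move=> u _; rewrite lee_fin sqn_ge0.
- exact: sphere_ballC.
rewrite setTD setCK /nsq /Rintegral.
have /integrable_fin_num : rintble sph ball (fun u => sqn (evalP p u)) := (csq_evalP p).2.
move=> /(_ measurable_unit_ball) fn.
rewrite -[X in fine (poweR X _)]fineK//= powR12_sqrt//; apply: fine_ge0.
by apply: integral_ge0 => u _; rewrite lee_fin sqn_ge0.
Qed.

Lemma normP_sqr (p : P) : normP p ^+ 2 = nsq sph ball (evalP p).
Proof. by rewrite normP_sqrt sqr_sqrtr//; apply: nsq_ge0; exact: measurable_unit_ball. Qed.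

(** A nonzero [p] is nonzero on a small box inside the unit ball. By homogeneity it is nonzero at
    the normalizations of these points as well, so the box lies in the cone over a null set of the
    sphere, against its positive volume. *)
Lemma nsq_sphere_eq0 d (p : P) : p \is ishomog1 d mdeg ->
  nsq sph ball (evalP p) = 0 -> p = 0.
Proof.
move=> hp np; apply/eqP; apply: contraT => /eqP p0.
(* With all coordinates at most [1 / n.+1] in modulus, a point lies in the unit ball. *)
pose r : R := n.+1%:R^-1; have r0 : 0 < r by rewrite invr_gt0.
have [u0 u0r pu0] : exists2 u : 'rV[R]_n.+1, forall i, `|u 0 i| <= r / 2 & evalP p u != 0.
  apply: contrapT => H; apply: p0.
  apply: (@evalP_box_eq0 _ _ p (fun=> - (r / 2)) r r0) => u hu; apply/eqP; apply: contraT => pu.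
  exfalso; apply: H; exists u => // i; rewrite ler_norml; have := hu i.
  by rewrite (_ : - (r / 2) + r = r / 2)//; field.
have [c1 c2] := continuous_evalP p.
have cs : continuous (fun u => sqn (evalP p u)).
  move=> u; rewrite /sqn.
  exact: (@continuousD _ R^o _ _ _ _ (continuousM (c1 u) (c1 u)) (continuousM (c2 u) (c2 u))).
have s0 : 0 < sqn (evalP p u0) by rewrite lt0r sqn_ge0 andbT; apply: contra_neq pu0 => /sqn_eq0.
have := cs u0 => /cvgrPdist_lt /(_ _ s0) /nbhs_ballP[e0 /= e00 he].
(* The side is small enough both for continuity of [sqn (p u)] at [u0] and for the box to stay in
   the cube of half-side [r]. *)
pose e := Num.min (e0 / 2) (r / 2).
have ep : 0 < e by rewrite lt_min !divr_gt0.
have [mb bE] := lebesgue_rV_box u0 ep.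
set b := [set u | _] in mb bE.
have ball_sub : b `<=` [set u | evalP p u != 0] `&` ball.
  move=> u bu; have du i : `|u0 0 i - u 0 i| <= e.
    have /andP[h1 h2] := bu i; rewrite ler_norml; apply/andP; split; lra.
  split.
    have /he : pseudometric_structure.ball u0 e0 u.
      split; first exact: e00.
      move=> i j; rewrite ord1; apply: le_lt_trans (du j) _.
      by rewrite gt_min ltr_pdivrMr// ltr_pMr// ltr1n.
    by apply: contraTneq => ->; rewrite sqn0 subr0 ger0_norm ?ltxx// ltW.
  have er : e <= r / 2 by rewrite ge_min lexx orbT.
  have ur i : `|u 0 i| <= r.
    rewrite -[u 0 i](subKr (u0 0 i)) (le_trans (ler_normB _ _))//.
    by have := u0r i; have := du i; lra.
  rewrite /euclid_ball/= -sqrtr1 ler_wsqrtr//.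
  apply: (@le_trans _ _ (\sum_(i < n.+1) r)).
    apply: ler_sum => i _; rewrite -real_normK ?num_real//.
    have := ur i; have : r <= 1 by rewrite invf_le1// ler1n.
    have := normr_ge0 (u 0 i); nra.
  by rewrite sumr_const card_ord -mulr_natl mulfV.
have mp : measurable_fun ball (fun u => (sqn (evalP p u))%:E).
  by apply/measurable_EFinP; apply: cmeas_sqn; exact: cmeas_evalP.
have I0 : (\int[sph]_(u in ball) `|(sqn (evalP p u))%:E| = 0)%E.
  under eq_integral => u _ do rewrite gee0_abs ?lee_fin ?sqn_ge0//.
  rewrite -[LHS]fineK; last exact: (integrable_fin_num measurable_unit_ball (csq_evalP p).2).
  by rewrite [X in X%:E]np.
have /(ae_eq_integral_abs _ measurable_unit_ball mp) [N [mN N0 HN]] := I0.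
have leb0 : (lebesgue_rV R n.+1 (@normalize R n.+1 @^-1` N `&` ball) = 0)%E.
  have := N0; rewrite /sphere_measure => /eqP; rewrite mule_eq0 eqe pnatr_eq0 /= => /eqP.
  exact.
have : (lebesgue_rV R n.+1 b <= lebesgue_rV R n.+1 (@normalize R n.+1 @^-1` N `&` ball))%E.
  apply: le_measure; rewrite ?inE//.
    apply: measurableI; last exact: measurable_unit_ball.
    by rewrite -[X in measurable X]setTI; exact: measurable_normalize.
  move=> u /ball_sub[/= pu bu]; split => //; apply: HN => /= H.
  have [/sqn_eq0 nu0] := H (normalize_ball u).
  by move/eqP: pu; apply; rewrite (normalizeK u) (evalP_scale _ _ hp) nu0 mulr0.
rewrite leb0 bE lee_fin; have : 0 < e ^+ n.+1 by rewrite exprn_gt0.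
by move=> /lt_le_trans h /h; rewrite ltxx.
Qed.

Lemma sqrt_poweR (x : \bar R) (B : R) : (0 <= x)%E -> 0 <= B ->
  (x `^ 2^-1 <= B%:E)%E = (x <= (B ^+ 2)%:E)%E.
Proof.
move=> x0 B0; case: x x0 => [r| |]// r0.
  rewrite poweR_EFin !lee_fin powR12_sqrt//.
  by rewrite -[in RHS](sqr_sqrtr r0) ler_sqr ?nnegrE ?sqrtr_ge0.
rewrite /poweR (_ : (2^-1 == 0 :> R) = false)//.
by apply/negbTE; rewrite invr_eq0.
Qed.

End normP_coefficients.

Section homogeneous_coefficients.
Context (R : realType) (n d : nat).
Local Notation P := (mpoly n.+1 R[i]).
Local Notation sph := (@sphere_measure R n).
Local Notation ball := (@euclid_ball R n.+1).
Local Notation mball := (@measurable_unit_ball R n).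

(** The dimension of the space of homogeneous polynomials of degree [d]; [mon] enumerates its
    monomial basis, found among the multi-indices of degree less than [d.+1]. *)
Definition nmons := #|[set m : bmultinom n.+1 d.+1 | mdeg (bmnm m) == d]|.
Definition mon (i : 'I_nmons) : multinom n.+1 := bmnm (enum_val i).

Lemma mdeg_mon i : mdeg (mon i) = d.
Proof. by have := enum_valP i; rewrite inE => /eqP. Qed.

Lemma mon_inj : injective mon.
Proof. by move=> i j /val_inj /enum_val_inj. Qed.

Lemma monP al : mdeg al = d -> exists i, al = mon i.
Proof.
move=> ad; have lt : (mdeg al < d.+1)%N by rewrite ad.
have inA : BMultinom lt \in [set m : bmultinom n.+1 d.+1 | mdeg (bmnm m) == d].
  by rewrite inE /= ad.
by exists (enum_rank_in inA (BMultinom lt)); rewrite /mon enum_rankK_in.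
Qed.

Lemma mcoeff_homog0 (p : P) al : p \is ishomog1 d mdeg -> mdeg al != d -> mcoeff al p = 0.
Proof. by move=> hp ad; apply: (dhomog_nemf_coeff hp). Qed.

Lemma homog_monE (p : P) : p \is ishomog1 d mdeg ->
  p = \sum_(i < nmons) mcoeff (mon i) p *: mpolyX R[i] (mon i).
Proof.
move=> hp; apply/mpolyP => al; rewrite raddf_sum/=.
have [/monP[i ->]|ad] := eqVneq (mdeg al) d.
  rewrite (bigD1 i)//= mcoeffZ mcoeffX eqxx mulr1 big1 ?addr0// => j ji.
  by rewrite mcoeffZ mcoeffX (inj_eq mon_inj) (negbTE ji) mulr0.
rewrite (mcoeff_homog0 hp ad) big1// => i _.
rewrite mcoeffZ mcoeffX; case: eqP => [E|_]; last by rewrite mulr0.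
by move: ad; rewrite -E mdeg_mon eqxx.
Qed.

Lemma evalP_monE (p : P) u : p \is ishomog1 d mdeg ->
  evalP p u = \sum_(i < nmons) mcoeff (mon i) p * evalP (mpolyX R[i] (mon i)) u.
Proof.
move=> hp; rewrite {1}(homog_monE hp) /evalP raddf_sum/=; apply: eq_bigr => i _.
by rewrite mevalZ.
Qed.

Lemma nsq_evalP_monE (p : P) : p \is ishomog1 d mdeg -> nsq sph ball (evalP p) =
  nsq sph ball (fun u => \sum_(i < nmons) mcoeff (mon i) p * evalP (mpolyX R[i] (mon i)) u).
Proof. by move=> hp; apply: eq_nsq => u _; rewrite -evalP_monE. Qed.

(** Homogeneous polynomials are determined by their restriction to the sphere, so the monomials of
    degree [d] are free in L^2 of the sphere and [coefficient_bound] applies. *)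
Lemma normP_lower : exists2 C : R, 0 <= C &
  forall p : P, p \is ishomog1 d mdeg -> forall al, sqn (mcoeff al p) <= C * normP p ^+ 2.
Proof.
have [|C C0 HC] := @coefficient_bound _ _ R sph _ mball nmons
  (fun i => evalP (mpolyX R[i] (mon i))) (fun i => csq_monomial _ _).
  move=> c nc i; pose p : P := \sum_(i < nmons) c i *: mpolyX R[i] (mon i).
  have hp : p \is ishomog1 d mdeg.
    by apply: rpred_sum => j _; apply: rpredZ; rewrite dhomogX; apply/eqP/mdeg_mon.
  have pc j : mcoeff (mon j) p = c j.
    rewrite raddf_sum/= (bigD1 j)//= mcoeffZ mcoeffX eqxx mulr1 big1 ?addr0// => k kj.
    by rewrite mcoeffZ mcoeffX (inj_eq mon_inj) (negbTE kj) mulr0.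
  rewrite -pc (nsq_sphere_eq0 hp) ?mcoeff0// nsq_evalP_monE// -[RHS]nc.
  by apply: eq_nsq => u _; apply: eq_bigr => j _; rewrite pc.
exists C => // p hp al; have [/monP[i ->]|ad] := eqVneq (mdeg al) d.
  by rewrite normP_sqr nsq_evalP_monE//; exact: (HC (fun i => mcoeff (mon i) p)).
by rewrite (mcoeff_homog0 hp ad) sqn0 mulr_ge0// sqr_ge0.
Qed.

Lemma normP_upper : exists2 C : R, 0 <= C &
  forall p : P, p \is ishomog1 d mdeg ->
  normP p ^+ 2 <= C * \sum_(i < nmons) sqn (mcoeff (mon i) p).
Proof.
exists (2 ^+ nmons * fine (sph ball)); first by rewrite mulr_ge0// fine_ge0.
move=> p hp; rewrite normP_sqr /nsq.
set S := \sum_(i < _) _.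
have S0 : 0 <= S by apply: sumr_ge0 => i _; exact: sqn_ge0.
apply: (@le_trans _ _ (\int[sph]_(u in ball) (2 ^+ nmons * S))); last first.
  by rewrite Rintegral_cst; [rewrite mulrAC|exact: mball].
apply: le_Rintegral; first exact: mball.
- exact: (csq_evalP p).2.
- by apply: rintble_cst; [exact: mball|exact: sphere_ball_lty].
move=> u bu; rewrite evalP_monE//; apply: le_trans (sqn_sum_le _ _) _.
rewrite -[X in _ ^+ size X]enumT size_enum_ord ler_wpM2l ?exprn_ge0//.
apply: ler_sum => i _; rewrite sqnM ler_piMr ?sqn_ge0//.
exact: sqn_monomial_le.
Qed.

Context dd (T : measurableType dd) (mu : {measure set T -> \bar R}) (D : set T).
Hypothesis mD : measurable D.
Variable f : T -> P.
Hypothesis hf : forall z, D z -> f z \is ishomog1 d mdeg.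

(** The squared norm is a Hermitian form in the coefficients, with the constant Gram matrix of the
    monomials. *)
Lemma measurable_normP : (forall al, cmeas D (fun z => mcoeff al (f z))) ->
  measurable_fun D (fun z => normP (f z) ^+ 2).
Proof.
move=> mf; pose e i := evalP (mpolyX R[i] (mon i)).
pose G i j := cintegral sph ball (fun u => e i u * conjc (e j u)).
have iG i j : cintble sph ball (fun u => e i u * conjc (e j u)).
  by apply: csq_mul; [exact: mball|exact: csq_monomial|apply: csqJ; [exact: mball|exact: csq_monomial]].
pose Q z := \sum_(i < nmons) \sum_(j < nmons) mcoeff (mon i) (f z) * conjc (mcoeff (mon j) (f z)) * G i j.
apply: (eq_measurable_fun (fun z => cRe (Q z))).
  move=> z /set_mem Dz; rewrite normP_sqr nsq_evalP_monE; last exact: hf.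
  rewrite nsq_cRe; congr cRe; rewrite /Q.
  under eq_bigr => i _ do under eq_bigr => j _ do rewrite -(cintZ mball _ (iG i j)).
  under eq_bigr => i _.
    rewrite -cint_sum; [|exact: mball|by move=> j _; apply: cintbleZ; [exact: mball|exact: iG]].
    over.
  rewrite -cint_sum; [|exact: mball|].
    apply: eq_cint => u _; rewrite rmorph_sum/= mulr_suml; apply: eq_bigr => i _.
    by rewrite mulr_sumr; apply: eq_bigr => j _; rewrite conjcM /e; ring.
  move=> i _; apply: cintble_sum; first exact: mball.
  by move=> j _; apply: cintbleZ; [exact: mball|exact: iG].
suff [] : cmeas D Q by [].
apply: cmeas_sum => // i _; apply: cmeas_sum => // j _; apply: cmeasM; last exact: cmeas_cst.
by apply: cmeasM => //; apply: cmeasJ.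
Qed.

Lemma L2normE : L2norm mu D f = ((\int[mu]_(z in D) (normP (f z) ^+ 2)%:E) `^ 2^-1)%E.
Proof.
rewrite /L2norm; set h := (_ \_ _).
have E : ('N[mu]_2%:E[h] = (\int[mu]_x `|h x| `^ 2) `^ 2^-1)%E by rewrite unlock.
rewrite E [in RHS]integral_mkcond; congr (_ `^ _)%E; apply: eq_integral => z _.
rewrite /h !patchE; case: ifP => _.
  have E' x : `|x%:E|%E = `|x|%:E :> \bar R by [].
  by rewrite E' poweR_EFin powR_mulrn// real_normK ?num_real.
by rewrite abse0 poweR_EFin powR0.
Qed.

Lemma L2norm_le (C B : R) : 0 <= C -> (forall al, csq mu D (fun z => mcoeff al (f z))) ->
  (forall p : P, p \is ishomog1 d mdeg ->
    normP p ^+ 2 <= C * \sum_(i < nmons) sqn (mcoeff (mon i) p)) ->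
  0 <= B -> C * \sum_(i < nmons) nsq mu D (fun z => mcoeff (mon i) (f z)) <= B ^+ 2 ->
  (L2norm mu D f <= B%:E)%E.
Proof.
move=> C0 cf HC B0 HB; rewrite L2normE sqrt_poweR//; last first.
  by apply: integral_ge0 => z _; rewrite lee_fin sqr_ge0.
have iSum (r : seq 'I_nmons) : rintble mu D (fun z => \sum_(i <- r) sqn (mcoeff (mon i) (f z))).
  elim: r => [|i r IH].
    by apply: (eq_integrable mD _ _ _ (integrable0 mu D)) => // z _ /=; rewrite big_nil.
  by apply: (eq_rintble mD _ (rintbleD mD (cf (mon i)).2 IH)) => z _; rewrite big_cons.
have EI (r : seq 'I_nmons) : \int[mu]_(z in D) (\sum_(i <- r) sqn (mcoeff (mon i) (f z))) =
    \sum_(i <- r) nsq mu D (fun z => mcoeff (mon i) (f z)).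
  elim: r => [|i r IH].
    by rewrite big_nil; under eq_Rintegral => z _ do rewrite big_nil; rewrite Rintegral_cst ?mul0r.
  rewrite big_cons -IH /nsq -(RintegralD mD (cf (mon i)).2 (iSum r)).
  by apply: eq_Rintegral => z _; rewrite big_cons.
have iS := rintbleZ mD C (iSum (index_enum _)).
apply: (@le_trans _ _ (\int[mu]_(z in D) (C * \sum_(i < nmons) sqn (mcoeff (mon i) (f z)))%:E)%E).
  apply: ge0_le_integral => //.
  - by move=> z _; rewrite lee_fin sqr_ge0.
  - by apply/measurable_EFinP; apply: measurable_normP => al; exact: (cf al).1.
  - exact: measurable_int iS.
  - by move=> z Dz; rewrite lee_fin; apply: HC; exact: hf.
rewrite -[X in (X <= _)%E]fineK; last exact: (integrable_fin_num mD iS).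
rewrite lee_fin; apply: le_trans HB; rewrite -/(Rintegral mu D _) RintegralZl//; last exact: iSum.
by rewrite EI.
Qed.

Lemma le_L2norm (C B : R) : 0 <= C -> (forall al, cmeas D (fun z => mcoeff al (f z))) ->
  (forall p : P, p \is ishomog1 d mdeg -> forall al, sqn (mcoeff al p) <= C * normP p ^+ 2) ->
  0 <= B -> (L2norm mu D f <= B%:E)%E ->
  forall al, csq mu D (fun z => mcoeff al (f z)) /\
    nsq mu D (fun z => mcoeff al (f z)) <= C * B ^+ 2.
Proof.
move=> C0 mf HC B0; rewrite L2normE sqrt_poweR//; last first.
  by apply: integral_ge0 => z _; rewrite lee_fin sqr_ge0.
move=> HB al.
have iN : rintble mu D (fun z => normP (f z) ^+ 2).
  apply/integrableP; split; first by apply/measurable_EFinP; exact: measurable_normP.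
  under eq_integral => z _ do rewrite gee0_abs ?lee_fin ?sqr_ge0//.
  exact: le_lt_trans HB (ltry _).
have cf : csq mu D (fun z => mcoeff al (f z)).
  split => //; apply: (rintble_le mD _ _ (rintbleZ mD C iN)); first exact: cmeas_sqn.
  by move=> z Dz; rewrite ger0_norm ?sqn_ge0//; apply: HC; exact: hf.
split => //; apply: (@le_trans _ _ (C * \int[mu]_(z in D) (normP (f z) ^+ 2))).
  rewrite /nsq -RintegralZl//; apply: le_Rintegral => //; first exact: cf.2.
    exact: rintbleZ.
  by move=> z Dz; apply: HC; exact: hf.
rewrite ler_wpM2l//; rewrite -lee_fin /Rintegral fineK//.
exact: (integrable_fin_num mD iN).
Qed.

End homogeneous_coefficients.

(** * Fourier series *)

Section fourier_series.
Context d (T : measurableType d) (R : realType).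
Variables (mu : {measure set T -> \bar R}) (D : set T).
Hypothesis mD : measurable D.
Hypothesis muD : (mu D < +oo)%E.

Lemma sqn_small_eq0 (a : R[i]) (K : R) : (forall eps, 0 < eps -> sqn a <= K * eps) -> a = 0.
Proof.
move=> H; apply: sqn_eq0; apply/eqP; rewrite eq_le sqn_ge0 andbT.
apply/ler_addgt0Pr => e e0; rewrite add0r.
have K1 : 0 < `|K| + 1 by rewrite ltr_wpDl.
apply: (le_trans (H (e / (`|K| + 1)) _)); first by rewrite divr_gt0.
by rewrite mulrA ler_pdivrMr//; have := ler_norm K; nra.
Qed.

Lemma cint_close (F u G : T -> R[i]) : csq mu D F -> csq mu D u -> csq mu D G ->
  sqn (cintegral mu D (fun z => F z * G z) - cintegral mu D (fun z => u z * G z)) <=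
  2 * nsq mu D G * nsq mu D (fun z => F z - u z).
Proof.
move=> cF cu cG; rewrite -cintB//; [|exact: csq_mul|exact: csq_mul].
rewrite (eq_cint (G := fun z => (F z - u z) * G z)); last by move=> z _; rewrite mulrBl.
by rewrite -mulrA [nsq _ _ G * _]mulrC; apply: cauchy_schwarz => //; exact: csqB.
Qed.

Variables (I : eqType) (e : I -> T -> R[i]).
Hypothesis ce : forall i, csq mu D (e i).
Hypothesis orthonormal :
  forall i j, cintegral mu D (fun z => e i z * conjc (e j z)) = (i == j)%:R.

(** Convergence along all finite index sets, with no order of summation: finitely many series can be
    truncated at a common set, and that set can be enlarged to a rectangle. *)
Definition fsum_cvg (c : I -> R[i]) (F : T -> R[i]) := forall eps : R, 0 < eps ->
  exists2 A0, uniq A0 & forall A, uniq A -> {subset A0 <= A} ->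
  nsq mu D (fun z => F z - fsum e c A z) <= eps.

(** The last clause asks for the zero function itself, not for a function vanishing almost
    everywhere: the components of a wrong degree have to vanish at every point. *)
Lemma fourier_series c (B : R) : (forall A, uniq A -> \sum_(i <- A) sqn (c i) <= B) ->
  exists F, [/\ csq mu D F, nsq mu D F <= B, fsum_cvg c F &
    (forall i, c i = 0) -> F = fun=> 0].
Proof.
move=> cB; have B0 : 0 <= B by have := cB [::] isT; rewrite big_nil.
have [c0|c0] := pselect (forall i, c i = 0).
  have n0 : nsq mu D (fun=> 0 : R[i]) = 0.
    by rewrite /nsq; under eq_Rintegral => z _ do rewrite sqn0; rewrite Rintegral_cst ?mul0r.
  exists (fun=> 0); split => //; [exact: csq0|by rewrite n0|].
  move=> eps e0; exists [::] => // A uA _; rewrite (eq_nsq (G := fun=> 0)) ?n0 ?ltW//.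
  by move=> z _; rewrite /fsum big1 ?subr0// => i _; rewrite c0 mul0r.
have [F [s [cF sB adh ub HF]]] := riesz_fischer mD muD ce orthonormal cB.
exists F; split => //.
  apply: le_trans sB; have := HF [::] isT; rewrite big_nil subr0; apply: le_trans.
  rewrite le_eqVlt; apply/orP; left; apply/eqP; apply: eq_nsq => z _.
  by rewrite /fsum big_nil subr0.
move=> eps e0; have [A0 uA0 sA0] := adh eps e0; exists A0 => // A uA A0A.
apply: le_trans (HF A uA) _; rewrite lerBlDr -lerBlDl (le_trans (ltW sA0))//.
have -> : \sum_(i <- A0) sqn (c i) = \sum_(i <- A | i \in A0) sqn (c i).
  rewrite -[RHS]big_filter; apply: perm_big; apply: uniq_perm => //; first exact: filter_uniq.
  by move=> i; rewrite mem_filter; case: (boolP (i \in A0)) => //= /A0A.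
rewrite [leRHS](bigID (fun i => i \in A0))/= lerDl.
by apply: sumr_ge0 => i _; exact: sqn_ge0.
Qed.

Lemma nsq_orthonormal i : nsq mu D (e i) = 1.
Proof. by rewrite nsq_cRe orthonormal eqxx. Qed.

(** The pairing is continuous in L^2, and it equals [c i] on every partial sum whose index set
    contains [i]. *)
Lemma fourier_coefficient c F i : csq mu D F -> fsum_cvg c F ->
  cintegral mu D (fun z => F z * conjc (e i z)) = c i.
Proof.
move=> cF cv; apply/eqP; rewrite -subr_eq0; apply/eqP; apply: (@sqn_small_eq0 _ 2) => eps e0.
have [A0 uA0 H] := cv eps e0; pose A := undup (i :: A0).
have uA : uniq A by exact: undup_uniq.
have iA : i \in A by rewrite mem_undup inE eqxx.
have {}H := H A uA; have sub : {subset A0 <= A} by move=> j jA; rewrite mem_undup inE jA orbT.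
have := cint_close cF (csq_fsum mD ce c A) (csqJ mD (ce i)).
rewrite (cint_fsum_mulJ mD ce orthonormal c i uA) iA => /le_trans; apply.
rewrite (_ : nsq mu D _ = 1) ?mulr1; first by rewrite ler_pM2l// H.
transitivity (nsq mu D (e i)); last exact: nsq_orthonormal.
by apply: eq_Rintegral => z _; exact: sqnJ.
Qed.

End fourier_series.

(** * Orthonormality of the characters *)

Section torus_characters.
Context (R : realType) (n : nat).
Local Notation mV := (measurableTypeR R * 'rV[R]_n)%type.
Local Notation mR := (measurableTypeR R).
Local Notation leb := (@lebesgue_measure R).
Local Notation lebn := (lebesgue_rV R n).
Local Notation cellM := (@cell R n : set mV).
Local Notation cubeM := (@cube R n).
Local Notation I01 := (`[0, 1]%classic : set mR).

Lemma mcell : measurable cellM. Proof. exact: measurable_cell. Qed.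
Lemma mcube : measurable cubeM. Proof. exact: measurable_cube. Qed.
Lemma mI01 : measurable I01. Proof. exact: measurable_itv. Qed.
Lemma volM_cell_lty : (volM R n cellM < +oo)%E. Proof. by rewrite volM_cell ltry. Qed.
Lemma leb_I01_lty : (leb I01 < +oo)%E. Proof. by rewrite [X in (X < _)%E](lebesgue_itv01 R) ltry. Qed.

Lemma csq_chi s w : csq (volM R n) cellM (chi s w).
Proof.
by apply: (csq_bounded mcell volM_cell_lty (B := 1)); [exact: cmeas_chi|move=> z _; rewrite sqn_chi].
Qed.

Lemma csq_chiq w : csq lebn cubeM (chiq w).
Proof.
by apply: (csq_bounded mcube (lebesgue_cube_lty R n) (B := 1)); [exact: cmeas_chiq|move=> z _; rewrite sqn_chiq].
Qed.

Lemma csq_expi_lin s : csq leb I01 (fun x : mR => expi (2 * pi * s * x)).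
Proof.
apply: (csq_bounded mI01 leb_I01_lty (B := 1)); first exact: cmeas_expi_lin.
by move=> z _; rewrite sqn_expi.
Qed.

Lemma csq_fst (H : mR -> R[i]) : csq leb I01 H ->
  csq (volM R n) cellM (fun z => H z.1).
Proof.
move=> [[m1 m2] iH]; have mfst (h : mR -> R) : measurable_fun I01 h -> measurable_fun cellM (fun z => h z.1).
  move=> mh; apply: (measurable_comp mI01) mh _; first by move=> _ [z [z1 _] <-].
  by apply: measurable_funTS; exact: measurable_fst.
have cm : cmeas cellM (fun z => H z.1).
  by split; [exact: (mfst (fun x => cRe (H x)))|exact: (mfst (fun x => cIm (H x)))].
split => //; apply/integrableP; split; first by apply/measurable_EFinP; exact: cmeas_sqn.
have ms : measurable_fun cellM (fun z => `|(sqn (H z.1))%:E|%E).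
  by apply: measurableT_comp => //; apply/measurable_EFinP; exact: cmeas_sqn.
rewrite (tonelli_on leb lebn mI01 mcube ms (fun z _ => abse_ge0 _)).2 /=.
rewrite (eq_integral (fun x => `|(sqn (H x))%:E|%E)); last first.
  move=> x _; rewrite integral_cst; last exact: mcube.
  by rewrite [X in (_ * X)%E](_ : _ = 1%E); [rewrite mule1|exact: lebesgue_cube].
by have /integrableP[] := iH.
Qed.

Lemma cint_fst_chiq (H : mR -> R[i]) w : csq leb I01 H ->
  cintegral (volM R n) cellM (fun z => H z.1 * chiq w z.2) =
  cintegral leb I01 H * cintegral lebn cubeM (chiq w).
Proof.
move=> cH; have iH := csq_cintble mI01 leb_I01_lty cH.
have mchi : cmeas cellM (fun z => chiq w z.2 : R[i]).
  have [m1 m2] := @cmeas_chiq R n w setT.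
  by split; apply: measurable_funTS; [exact: (measurableT_comp m1 measurable_snd)|exact: (measurableT_comp m2 measurable_snd)].
have iHc : cintble (volM R n) cellM (fun z => H z.1 * chiq w z.2).
  apply: (cintbleM1 mcell _ mchi); last by move=> z _; rewrite sqn_chiq.
  exact: (csq_cintble mcell volM_cell_lty (csq_fst cH)).
have [_ -> _] := cfubini_on mI01 mcube iHc.
rewrite (eq_cint (G := fun x : mR => cintegral lebn cubeM (chiq w) * H x)); last first.
  move=> x _; rewrite mulrC -cintZ//; first exact: mcube.
  exact: (csq_cintble mcube (lebesgue_cube_lty R n) (csq_chiq w)).
by rewrite cintZ; [rewrite mulrC|exact: mI01|].
Qed.

Lemma cint_cst1 dd (T : measurableType dd) (mu : {measure set T -> \bar R}) (D : set T) :
  measurable D -> mu D = 1%E -> cintegral mu D (fun=> 1) = 1.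
Proof. by move=> mD D1; rewrite /cintegral /= !Rintegral_cst// D1 mul0r mulr1. Qed.

(** For [k 0 j != 0], the integral of the derivative of the character in the direction [j] is 0 and
    also equals [2 pi i (k 0 j)] times the integral of the character. *)
Lemma cint_chiq (k : 'rV[int]_n) : cintegral lebn cubeM (chiq (map_mx intr k)) = (k == 0)%:R :> R[i].
Proof.
have [->|/eqP k0] := eqVneq k 0.
  rewrite (eq_cint (G := fun=> 1)); first by rewrite cint_cst1//; [exact: mcube|exact: lebesgue_cube].
  by move=> y _; rewrite /chiq big1 ?mulr0 ?expi0// => j _; rewrite !mxE mul0r.
have [j kj] : exists j, k 0 j != 0.
  apply: contrapT => H; apply: k0; apply/rowP => j; rewrite mxE; apply/eqP; apply: contraT => kj.
  by case: H; exists j.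
have := cintegral_dy (cC1dir_chi (lift 0 j) 0 (map_mx intr k : 'rV[R]_n)) (@chi_periodic R n 0 k).
rewrite cintZ; [|exact: mcell|exact: (csq_cintble mcell volM_cell_lty (csq_chi _ _))].
have -> : cintegral (volM R n) cellM (chi 0 (map_mx intr k)) = cintegral lebn cubeM (chiq (map_mx intr k)).
  rewrite (eq_cint (G := fun z => (fun=> 1) z.1 * chiq (map_mx intr k) z.2)).
    have c1 : csq leb I01 (fun=> 1 : R[i]).
      by apply: (csq_bounded mI01 leb_I01_lty (B := 1)) => // x _; rewrite /sqn /= expr1n expr0n addr0.
    rewrite [LHS](cint_fst_chiq _ c1) (cint_cst1 mI01) ?mul1r//; exact: lebesgue_itv01.
  by move=> z _; rewrite /chi mulr0 mul0r expi0.
move/eqP; rewrite !mulf_eq0 => /orP[/orP[|]|/eqP ->//].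
  by rewrite /tpi eq_complex /= eqxx /= mulf_eq0 pnatr_eq0/= gt_eqF// pi_gt0.
rewrite cons_rVS mxE => /eqP[] /eqP; rewrite intr_eq0; by move/negbTE: kj => ->.
Qed.

(** As for the torus, with the derivative in [x]: there the boundary term is zero because an
    integral frequency gives equal values at 0 and 1. *)
Lemma cint_expi_lin (s : int) :
  cintegral leb I01 (fun x : mR => expi (2 * pi * s%:~R * x)) = (s == 0)%:R :> R[i].
Proof.
have [->|s0] := eqVneq s 0.
  rewrite (eq_cint (G := fun=> 1)); first by rewrite (cint_cst1 mI01)//; exact: lebesgue_itv01.
  by move=> x _; rewrite mulr0 mul0r expi0.
have := cintegral_dx (cC1dir_chi 0 s%:~R (map_mx intr (0 : 'rV[int]_n) : 'rV[R]_n)).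
rewrite [RHS](eq_cint (G := fun=> 0)); last first.
  by move=> y _; rewrite /chi /= mulr1 mulr0 expi2pi expi0 subrr.
rewrite cint0; last exact: mcube.
rewrite cintZ; [|exact: mcell|exact: (csq_cintble mcell volM_cell_lty (csq_chi _ _))].
rewrite [X in _ * X](_ : _ = cintegral leb I01 (fun x : mR => expi (2 * pi * s%:~R * x))); last first.
  have := cint_fst_chiq (map_mx intr (0 : 'rV[int]_n)) (csq_expi_lin s%:~R).
  by rewrite cint_chiq eqxx mulr1 => <-.
move/eqP; rewrite !mulf_eq0 => /orP[/orP[|]|/eqP ->//].
  by rewrite /tpi eq_complex /= eqxx /= mulf_eq0 pnatr_eq0/= gt_eqF// pi_gt0.
by rewrite cons_rV0 => /eqP[] /eqP; rewrite intr_eq0 (negbTE s0).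
Qed.

Lemma cint_chi_int (s : R) (k : 'rV[int]_n) :
  cintegral (volM R n) cellM (chi s (map_mx intr k)) =
  cintegral leb I01 (fun x : mR => expi (2 * pi * s * x)) * (k == 0)%:R.
Proof. by rewrite -cint_chiq -cint_fst_chiq//; exact: csq_expi_lin. Qed.

Lemma chi_mulJ (s t : R) (k l : 'rV[int]_n) z :
  chi s (map_mx intr k) z * conjc (chi t (map_mx intr l) z) = chi (s - t) (map_mx intr (k - l)) z :> R[i].
Proof. by rewrite conjc_chi chiM; congr (chi _ _ z); apply/rowP => j; rewrite !mxE rmorphB. Qed.

Lemma orthonormal_chiZ (i j : int * 'rV[int]_n) :
  cintegral (volM R n) cellM (fun z => chiZ i z * conjc (chiZ j z)) = (i == j)%:R :> R[i].
Proof.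
case: i j => [s k] [t l]; transitivity (cintegral (volM R n) cellM (chi (s - t)%:~R (map_mx intr (k - l)))).
  by apply: eq_cint => z _; rewrite /chiZ chi_mulJ rmorphB.
rewrite cint_chi_int cint_expi_lin -natrM mulnb !subr_eq0.
by rewrite -[in RHS]pair_eqE.
Qed.

Lemma orthonormal_expi (i j : int) :
  cintegral leb I01 (fun x : mR => expi (2 * pi * i%:~R * x) * conjc (expi (2 * pi * j%:~R * x)))
  = (i == j)%:R :> R[i].
Proof.
rewrite -subr_eq0 -cint_expi_lin; apply: eq_cint => x _.
by rewrite conjc_expi -expiD; congr expi; rewrite rmorphB /=; ring.
Qed.

Lemma orthonormal_chiq (k l : 'rV[int]_n) :
  cintegral lebn cubeM (fun y => chiq (map_mx intr k) y * conjc (chiq (map_mx intr l) y))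
  = (k == l)%:R :> R[i].
Proof.
rewrite -subr_eq0 -cint_chiq; apply: eq_cint => y _.
rewrite !chiqE conjc_expi -expiD -mulrN -mulrDr; congr (expi (_ * _)).
rewrite /dotp -sumrN -big_split /=; apply: eq_bigr => j _; rewrite !mxE rmorphB /=; ring.
Qed.

End torus_characters.

Lemma mcoeff_mon_sum (R : realType) n d (c : 'I_(nmons n d) -> R[i]) i :
  mcoeff (mon i) (\sum_(j < nmons n d) c j *: mpolyX R[i] (mon j)) = c i.
Proof.
rewrite raddf_sum/= (bigD1 i)//= mcoeffZ mcoeffX eqxx mulr1 big1 ?addr0// => j ji.
by rewrite mcoeffZ mcoeffX (inj_eq (@mon_inj n d)) (negbTE ji) mulr0.
Qed.

Lemma mon_sum_homog (R : realType) n d (c : 'I_(nmons n d) -> R[i]) :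
  \sum_(j < nmons n d) c j *: mpolyX R[i] (mon j) \is ishomog1 d mdeg.
Proof. by apply: rpred_sum => j _; apply: rpredZ; rewrite dhomogX; apply/eqP/mdeg_mon. Qed.

Section homogeneous_fields.
Context (R : realType) (n d : nat) dd (T : measurableType dd).
Variables (mu : {measure set T -> \bar R}) (D : set T).
Hypothesis mD : measurable D.
Local Notation P := (mpoly n.+1 R[i]).
Variable F : T -> P.
Hypothesis hF : forall z, D z -> F z \is ishomog1 d mdeg.
Hypothesis cF : forall al, csq mu D (fun z => mcoeff al (F z)).

Lemma csq_evalP_field u : csq mu D (fun z => evalP (F z) u).
Proof.
apply: (@eq_csq _ _ _ _ _ mD (fun z => \sum_(i < nmons n d) evalP (mpolyX R[i] (mon i)) u * mcoeff (mon i) (F z))).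
  by move=> z /set_mem Dz; rewrite (evalP_monE _ (hF Dz)); apply: eq_bigr => i _; rewrite mulrC.
by apply: csq_sum => // i _; exact: csqZ.
Qed.

Lemma cint_evalP u G : csq mu D G ->
  cintegral mu D (fun z => evalP (F z) u * G z) =
  \sum_(i < nmons n d) evalP (mpolyX R[i] (mon i)) u * cintegral mu D (fun z => mcoeff (mon i) (F z) * G z).
Proof.
move=> cG; rewrite (eq_cint (G := fun z => \sum_(i < nmons n d)
    evalP (mpolyX R[i] (mon i)) u * (mcoeff (mon i) (F z) * G z))).
  rewrite cint_sum//; last by move=> i _; apply: cintbleZ => //; exact: csq_mul.
  by apply: eq_bigr => i _; rewrite cintZ//; exact: csq_mul.
move=> z /set_mem Dz; rewrite (evalP_monE _ (hF Dz)) mulr_suml; apply: eq_bigr => i _.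
by rewrite [mcoeff _ _ * evalP _ _]mulrC mulrA.
Qed.

End homogeneous_fields.

(** * The Fourier coefficients of f as polynomials, and their division *)

Section fourier_polynomials.
Context (R : realType) (n m : nat).
Local Notation P := (mpoly n.+1 R[i]).
Local Notation mV := (measurableTypeR R * 'rV[R]_n)%type.
Local Notation cellM := (@cell R n : set mV).
Local Notation vol := (volM R n).
Local Notation idx := (int * 'rV[int]_n)%type.

Lemma cell_slab (z : R * 'rV[R]_n) : cell z -> slab z.
Proof. by move=> [? _]; split. Qed.

(** The frequency [(s, k)] as a single vector: differentiating the character in the direction [i]
    multiplies it by [tpi] times the entry [i]. *)
Definition kappa (ka : idx) : 'rV[R]_n.+1 := cons_rV (ka.1%:~R, map_mx intr ka.2).

Lemma kappa_dot ka (v : R) b : \sum_i kappa ka 0 i * cons_rV (v, b) 0 i =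
  ka.1%:~R * v + dotp (map_mx intr ka.2) b.
Proof.
rewrite big_ord_recl /kappa !cons_rV0 /=; congr (_ + _).
by apply: eq_bigr => j _; rewrite !cons_rVS.
Qed.

Lemma cons_rV_scale (u : 'rV[R]_n.+1) : u 0 0 != 0 ->
  u = u 0 0 *: cons_rV (1, \row_j (u 0 (lift 0 j) / u 0 0)).
Proof.
move=> u0; apply/rowP => i; rewrite mxE; case: (unliftP 0 i) => [j ->|->].
  by rewrite cons_rVS mxE mulrC mulfVK.
by rewrite cons_rV0 mulr1.
Qed.

Variable f : R * 'rV[R]_n -> P.
Hypothesis hf : forall z, slab z -> f z \is ishomog1 m mdeg.
Hypothesis pf : periodic_on (@slab R n) f.
Hypothesis cf : forall al, csq vol cellM (fun z => mcoeff al (f z)).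

Lemma xray_vanishes_pairing : xray_vanishes f <->
  forall b (k : 'rV[int]_n), cintegral vol cellM (fun z => evalP (f z) (cons_rV (1, b)) *
    chi (- dotp (map_mx intr k) b) (map_mx intr k) z) = 0.
Proof.
have pG b : periodic_on (@slab R n) (fun z => evalP (f z) (cons_rV (1, b))).
  by move=> z q sz; rewrite pf.
have iG b : cintble vol cellM (fun z => evalP (f z) (cons_rV (1, b))).
  apply: (csq_cintble (@mcell R n) (volM_cell_lty R n)).
  apply: (@csq_evalP_field _ _ m _ _ _ _ (@mcell R n) f) => // z Dz.
  exact/hf/cell_slab.
split=> H b; first by apply/(xray_fun_vanishes b (pG b) (iG b)); exact: H.
by apply/(xray_fun_vanishes b (pG b) (iG b)); exact: H.
Qed.

Definition fhat_c al (ka : idx) : R[i] :=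
  cintegral vol cellM (fun z => mcoeff al (f z) * conjc (chiZ ka z)).

Definition fhat (ka : idx) : P := \sum_(i < nmons n m) fhat_c (mon i) ka *: mpolyX R[i] (mon i).

Lemma fhat_homog ka : fhat ka \is ishomog1 m mdeg.
Proof. exact: mon_sum_homog. Qed.

Lemma mcoeff_fhat al ka : mcoeff al (fhat ka) = fhat_c al ka.
Proof.
have [/(@monP n m)[i ->]|ad] := eqVneq (mdeg al) m.
  exact: mcoeff_mon_sum.
rewrite (mcoeff_homog0 (fhat_homog ka) ad) /fhat_c; symmetry.
transitivity (cintegral vol cellM (fun=> 0)); last exact: (cint0 vol (@mcell R n)).
apply: eq_cint.
by move=> z /set_mem /cell_slab /hf hz; rewrite (mcoeff_homog0 hz ad) mul0r.
Qed.

Lemma csq_chiZJ ka : csq vol cellM (fun z => conjc (chiZ ka z)).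
Proof. by apply: csqJ; [exact: mcell|exact: csq_chi]. Qed.

Lemma evalP_fhat ka u : evalP (fhat ka) u =
  cintegral vol cellM (fun z => evalP (f z) u * conjc (chiZ ka z)).
Proof.
rewrite (@cint_evalP _ _ m _ _ _ _ (@mcell R n) f _ cf _ _ (csq_chiZJ ka)); last first.
  by move=> z /cell_slab; exact: hf.
rewrite (evalP_monE _ (fhat_homog ka)); apply: eq_bigr => i _.
by rewrite mcoeff_fhat mulrC.
Qed.

Hypothesis xf : xray_vanishes f.

(** After rescaling, [u = (1, b)] by homogeneity, and the hyperplane condition reads [s = - k . b].
    The conjugate character is then one of those that pair to 0 with [f (.; 1, b)]. *)
Lemma fhat_vanish ka (u : 'rV[R]_n.+1) : \sum_i kappa ka 0 i * u 0 i = 0 -> u 0 0 != 0 ->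
  evalP (fhat ka) u = 0.
Proof.
move=> ku u0; rewrite (cons_rV_scale u0) (evalP_scale _ _ (fhat_homog ka)).
set b := (\row_j _ : 'rV[R]_n).
have kb : ka.1%:~R + dotp (map_mx intr ka.2) b = 0.
  move: ku; rewrite (cons_rV_scale u0) -/b.
  under eq_bigr => i _ do rewrite [(_ *: cons_rV (1, b)) 0 i]mxE mulrCA.
  rewrite -mulr_sumr kappa_dot mulr1 => /eqP; rewrite mulf_eq0 => /orP[|/eqP//].
  by move: u0; rewrite [u 0 0]lock => /negbTE ->.
rewrite evalP_fhat [X in _ * X](_ : _ = 0) ?mulr0//.
have := (xray_vanishes_pairing.1 xf) b (- ka.2) => <-; apply: eq_cint => z _; congr (_ * _).
rewrite /chiZ conjc_chi.
have kN : map_mx intr (- ka.2) = - map_mx intr ka.2 :> 'rV[R]_n by apply/rowP => j; rewrite !mxE rmorphN.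
rewrite kN; congr (chi _ _ z); rewrite -[LHS]addr0 -kb addrA addNr add0r.
by rewrite /dotp -sumrN; apply: eq_bigr => j _; rewrite !mxE mulNr opprK.
Qed.

(** The frequency is 0, so the hyperplane is the whole space and [fhat] vanishes on a box where
    [u 0 0 >= 1]. *)
Lemma fhat00 : fhat (0, 0) = 0.
Proof.
apply: (@evalP_box_eq0 _ _ _ (fun=> 1) 1 ltr01) => u hu; apply: fhat_vanish.
  rewrite big1// => i _; rewrite /kappa; case: (unliftP 0 i) => [j ->|->].
    by rewrite cons_rVS !mxE mul0r.
  by rewrite cons_rV0 mul0r.
by have /andP[h _] := hu 0; rewrite gt_eqF// (lt_le_trans _ h).
Qed.

Lemma normcE (x : R[i]) : `|x| = (Num.sqrt (sqn x))%:C%C.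
Proof. by case: x => a b; rewrite normc_def. Qed.

(** At [k = 0] no division takes place: [q] is 0 and the coefficient is left to [h]. Otherwise the
    linear form involves some [w_j], as [linear_form_dvd] requires. *)
Lemma fhat_division ka : exists q : P, [/\ q \is ishomog1 m.-1 mdeg,
  m = 0%N -> q = 0, ka.2 = 0 -> q = 0,
  ka.2 != 0 -> forall al, fhat_c al ka =
    \sum_(i | (0 < al i)%N) (kappa ka 0 i)%:C%C * mcoeff (mnm_sub al (mnm1 i)) q &
  forall i be, kappa ka 0 i ^+ 2 * sqn (mcoeff be q) <=
    (n.+2%:R ^+ m.-1) ^+ 2 * \sum_(i < nmons n m) sqn (fhat_c (mon i) ka)].
Proof.
have S0 : 0 <= \sum_(i < nmons n m) sqn (fhat_c (mon i) ka).
  by apply: sumr_ge0 => i _; exact: sqn_ge0.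
have trivial_q : (ka.2 != 0 -> forall al, fhat_c al ka = 0) -> exists q : P, [/\ q \is ishomog1 m.-1 mdeg,
  m = 0%N -> q = 0, ka.2 = 0 -> q = 0,
  ka.2 != 0 -> forall al, fhat_c al ka =
    \sum_(i | (0 < al i)%N) (kappa ka 0 i)%:C%C * mcoeff (mnm_sub al (mnm1 i)) q &
  forall i be, kappa ka 0 i ^+ 2 * sqn (mcoeff be q) <=
    (n.+2%:R ^+ m.-1) ^+ 2 * \sum_(i < nmons n m) sqn (fhat_c (mon i) ka)].
  move=> H; exists 0; split => //; first exact: rpred0.
    by move=> k0 al; rewrite H// big1// => i _; rewrite mcoeff0 mulr0.
  by move=> i be; rewrite mcoeff0 sqn0 mulr0 mulr_ge0// exprn_ge0.
have [k0|k0] : ka.2 = 0 \/ ka.2 != 0 by case: (eqVneq ka.2 0); [left|right].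
  by apply: trivial_q; rewrite k0 eqxx.
have [j kj] : exists j, ka.2 0 j != 0.
  apply: contrapT => H; move/eqP: k0; apply; apply/rowP => j; rewrite mxE; apply/eqP.
  by apply: contraT => kj; case: H; exists j.
have kj' : kappa ka 0 (lift 0 j) != 0 by rewrite /kappa cons_rVS mxE intr_eq0.
have [q' pq'] := linear_form_dvd kj' (@fhat_vanish ka).
(* A constant divisible by a linear form is 0. This case is separate because [m.-1] is then 0 and
   not [-1]. *)
have [m0|m0] := eqVneq m 0%N.
  apply: trivial_q => _ al; rewrite -mcoeff_fhat.
  have [ad|ad] := eqVneq (mdeg al) m; last exact: mcoeff_homog0 (fhat_homog ka) ad.
  rewrite pq' mcoeff_linear_formM big_pred0// => i.
  have /eqP := ad; rewrite m0 mdeg_eq0 => /eqP ->.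
  by rewrite mnm0E.
pose q := pihomog mdeg m.-1 q'.
have hq : q \is ishomog1 m.-1 mdeg by exact: pihomogP.
have pq : fhat ka = linear_form (fun i => (kappa ka 0 i)%:C%C) * q.
  rewrite -[LHS](pihomog_dE (fhat_homog ka)) pq' -(pihomogM_homog _ _ (linear_form_homog _)).
  by congr (pihomog _ _ _); rewrite add1n prednK// lt0n.
exists q; split => //.
- by move=> m0'; rewrite m0' in m0.
- by move=> k00; rewrite k00 eqxx in k0.
- by move=> _ al; rewrite -mcoeff_fhat pq mcoeff_linear_formM.
move=> i be; set S := \sum_(i < _) _ in S0 *.
(* The quotient bound solves for the coefficients through the entry of [kappa] of largest modulus,
   and the resulting estimate dominates those for all other entries. *)
case: (@Order.TotalTheory.arg_maxP _ _ 'I_n.+1 ord0 xpredT (fun i => sqn ((kappa ka 0 i)%:C%C)) isT) => i0 _ hi0.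
have := @linear_form_quotient_bound _ _ _ (fun i => (kappa ka 0 i)%:C%C) i0 q (Num.sqrt S)%:C%C _ hq _ be.
have h1 i' : `|(kappa ka 0 i')%:C%C : R[i]| <= `|(kappa ka 0 i0)%:C%C|.
  by rewrite !normcE lecR ler_wsqrtr//; exact: (hi0 i' isT).
have h2 al : `|mcoeff al (linear_form (fun i => (kappa ka 0 i)%:C%C) * q)| <= (Num.sqrt S)%:C%C.
  rewrite -pq mcoeff_fhat normcE lecR ler_wsqrtr//.
  have [/(@monP n m)[l ->]|ad] := eqVneq (mdeg al) m.
    by rewrite /S (bigD1 l)//= lerDl; apply: sumr_ge0 => l' _; exact: sqn_ge0.
  by rewrite -mcoeff_fhat (mcoeff_homog0 (fhat_homog ka) ad) sqn0.
move=> /(_ h1 h2); rewrite !normcE -(rmorph_nat (real_complex R)) -rmorphXn -!rmorphM /= lecR => hb.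
have hb2 : (Num.sqrt (sqn (kappa ka 0 i0)%:C%C) * Num.sqrt (sqn (mcoeff be q))) ^+ 2 <=
   (n.+2%:R ^+ m.-1 * Num.sqrt S) ^+ 2.
  by rewrite ler_sqr ?nnegrE// mulr_ge0 ?sqrtr_ge0// exprn_ge0.
move: hb2; rewrite !exprMn !sqr_sqrtr ?sqn_ge0//; apply: le_trans.
by rewrite ler_wpM2r ?sqn_ge0// -sqnC; exact: (hi0 i isT).
Qed.

End fourier_polynomials.

Section weak_derivative_of_a_fourier_series.
Context (R : realType) (n : nat).
Local Notation mV := (measurableTypeR R * 'rV[R]_n)%type.
Local Notation cellM := (@cell R n : set mV).
Local Notation vol := (volM R n).
Local Notation idx := (int * 'rV[int]_n)%type.
Local Notation mC := (@mcell R n).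

(** The Fourier coefficients of the derivative in the direction [i]. *)
Definition dfreq (i : 'I_n.+1) (c : idx -> R[i]) (ka : idx) := tpi * (kappa R ka 0 i)%:C%C * c ka.

Lemma cC1dir_fsum i c A :
  cC1dir (coordM R i) (fsum (@chiZ R n) c A) (fsum (@chiZ R n) (dfreq i c) A).
Proof.
apply: cC1dir_sum => ka; apply: eq_cC1dir (cC1dirZ (c ka) (cC1dir_chi i ka.1%:~R (map_mx intr ka.2))) => z //.
by rewrite /dfreq /kappa /chiZ; ring.
Qed.

Lemma fsum_periodic c A : periodic_on setT (fsum (@chiZ R n) c A).
Proof. by move=> z q _; apply: eq_bigr => ka _; rewrite /chiZ chi_periodic. Qed.

Lemma csq_chiZ ka : csq vol cellM (@chiZ R n ka).
Proof. exact: csq_chi. Qed.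

Lemma csq_fsumZ c A : csq vol cellM (fsum (@chiZ R n) c A).
Proof. exact: (csq_fsum mC csq_chiZ). Qed.

Lemma cC1dir_csq_diff v F DF : cC1dir v F DF -> csq vol cellM DF.
Proof.
move=> [[_ c1 _] [_ c2 _]]; split.
  by split; apply: measurable_funTS; exact: continuous_measurable_RrV.
apply: (@continuous_rintble_cell _ _ (fun z => sqn (DF z))) => z; rewrite /sqn.
by apply: cvgD; [exact: (cvgM (c1 z) (c1 z))|exact: (cvgM (c2 z) (c2 z))].
Qed.

(** Only the direction [x] leaves a boundary term. It survives when [psi] takes different values at
    the two ends, as a character with nonintegral [s] does. *)
Lemma fsum_by_parts i c A (psi Dpsi : R * 'rV[R]_n -> R[i]) :
  cC1dir (coordM R i) psi Dpsi -> periodic_on setT psi ->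
  cintegral vol cellM (fun z => fsum (@chiZ R n) (dfreq i c) A z * psi z) +
  cintegral vol cellM (fun z => fsum (@chiZ R n) c A z * Dpsi z) =
  if i == 0 then cintegral (lebesgue_rV R n) (@cube R n) (fun y =>
    fsum (@chiZ R n) c A (1, y) * psi (1, y) - fsum (@chiZ R n) c A (0, y) * psi (0, y)) else 0.
Proof.
move=> C1psi ppsi; have C1u := cC1dir_fsum i c A; have C1 := cC1dirM C1u C1psi.
rewrite -cintD; [|exact: mC|..]; last 2 first.
- by apply: csq_mul; [exact: mC|exact: csq_fsumZ|exact: cC1dir_csq C1psi].
- by apply: csq_mul; [exact: mC|exact: csq_fsumZ|exact: cC1dir_csq_diff C1psi].
case: (unliftP 0 i) C1 => [j ->|->] C1; last by rewrite eqxx (cintegral_dx C1).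
rewrite (cintegral_dy C1)// => z k _; by rewrite fsum_periodic// ppsi.
Qed.

Lemma test_function_cC1dir i (phi : R * 'rV[R]_n -> R) : test_function phi ->
  cC1dir (coordM R i) (fun z => (phi z)%:C%C) (fun z => ('D_(coordM R i) phi z)%:C%C).
Proof. by move=> [sphi _ _]; apply: cC1dir_real; apply: C1dir_Ck1; exact: sphi. Qed.

(** The identity holds for partial sums, since test functions vanish at both ends, and passes to the
    limit because pairings are continuous in L^2. *)
Lemma weak_partial_fourier i c F F' : csq vol cellM F -> csq vol cellM F' ->
  fsum_cvg vol cellM (@chiZ R n) c F ->
  fsum_cvg vol cellM (@chiZ R n) (dfreq i c) F' ->
  forall phi : R * 'rV[R]_n -> R, test_function phi ->
  cintegral vol cellM (fun z => F z * ('D_(coordM R i) phi z)%:C%C) =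
  - cintegral vol cellM (fun z => F' z * (phi z)%:C%C).
Proof.
move=> cF cF' Fc F'c phi tphi; have C1 := test_function_cC1dir i tphi.
have [_ pphi [e0 e00 supp]] := tphi.
have c1 := cC1dir_csq C1; have c2 := cC1dir_csq_diff C1.
set P := fun z => (phi z)%:C%C in C1 c1 *; set DP := fun z => ('D_(coordM R i) phi z)%:C%C in C1 c2 *.
apply/eqP; rewrite -addr_eq0; apply/eqP.
apply: (@sqn_small_eq0 R _ (4 * nsq vol cellM DP + 4 * nsq vol cellM P)) => eps eps0.
have [A0 uA0 H0] := Fc eps eps0; have [A1 uA1 H1] := F'c eps eps0.
(* The two series have to be truncated at the same finite set. *)
pose A := undup (A0 ++ A1); have uA : uniq A by exact: undup_uniq.
have {}H0 := H0 A uA (fun x xA => ltac:(by rewrite mem_undup mem_cat xA)).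
have {}H1 := H1 A uA (fun x xA => ltac:(by rewrite mem_undup mem_cat xA orbT)).
have E := @fsum_by_parts i c A _ _ C1 (fun z q _ => ltac:(by rewrite /P pphi)).
have {}E : cintegral vol cellM (fun z => fsum (@chiZ R n) c A z * DP z) =
    - cintegral vol cellM (fun z => fsum (@chiZ R n) (dfreq i c) A z * P z).
  apply/eqP; rewrite -addr_eq0 addrC E; case: ifP => // _; apply/eqP.
  have phi0 x y : (x <= 0) || (1 <= x) -> phi (x, y) = 0.
    by move=> hx; apply/eqP; apply: contraT => /supp /= /andP[h1 h2]; case/orP: hx => hx; lra.
  rewrite (eq_cint (G := fun=> 0)) ?(cint0 _ (@mcube R n))// => y _.
  by rewrite /P !phi0 ?lexx ?orbT// mulr0 mulr0 subrr.
have h0 := cint_close mC cF (csq_fsumZ c A) c2; have h1 := cint_close mC cF' (csq_fsumZ (dfreq i c) A) c1.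
rewrite E in h0.
pose t := cintegral vol cellM (fun z : mV => fsum (@chiZ R n) (dfreq i c) A z * P z).
pose a := cintegral vol cellM (fun z : mV => F z * DP z).
pose b := cintegral vol cellM (fun z : mV => F' z * P z).
change (sqn (a + b) <= (4 * nsq vol cellM DP + 4 * nsq vol cellM P) * eps).
rewrite (_ : a + b = (a - - t) + (b - t)); last by ring.
apply: le_trans (sqnD_le _ _) _.
have n0 : 0 <= nsq vol cellM DP := nsq_ge0 _ _ _; have n1 : 0 <= nsq vol cellM P := nsq_ge0 _ _ _.
have l0 : sqn (a - - t) <= 2 * nsq vol cellM DP * eps.
  by apply: le_trans h0 _; rewrite ler_wpM2l// mulr_ge0.
have l1 : sqn (b - t) <= 2 * nsq vol cellM P * eps.
  by apply: le_trans h1 _; rewrite ler_wpM2l// mulr_ge0.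
move: l0 l1; move: (sqn _) (sqn _) (nsq vol cellM DP) (nsq vol cellM P) => s1 s2 x y l0 l1; nra.
Qed.

End weak_derivative_of_a_fourier_series.

Section solution.
Context (R : realType) (n m : nat).
Local Notation P := (mpoly n.+1 R[i]).
Local Notation mV := (measurableTypeR R * 'rV[R]_n)%type.
Local Notation mR := (measurableTypeR R).
Local Notation leb := (@lebesgue_measure R).
Local Notation cellM := (@cell R n : set mV).
Local Notation I01 := (`[0, 1]%classic : set mR).
Local Notation vol := (volM R n).
Local Notation idx := (int * 'rV[int]_n)%type.
Local Notation mC := (@mcell R n).
Local Notation chs := (@chiZ R n).
Local Notation volty := (volM_cell_lty R n).
Local Notation ortho := (@orthonormal_chiZ R n).

Variable f : R * 'rV[R]_n -> P.
Hypothesis hf : forall z, slab z -> f z \is ishomog1 m mdeg.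
Hypothesis cf : forall al, csq vol cellM (fun z => mcoeff al (f z)).

Definition energy := \sum_(i < nmons n m) nsq vol cellM (fun z => mcoeff (mon i) (f z)).
(** The square of the constant of [linear_form_quotient_bound], for [n.+1] variables and degree
    [m.-1]. *)
Definition qbound : R := (n.+2%:R ^+ m.-1) ^+ 2.

Lemma energy_ge0 : 0 <= energy.
Proof. by apply: sumr_ge0 => i _; exact: nsq_ge0. Qed.

Lemma qbound_ge1 : 1 <= qbound.
Proof. by rewrite /qbound -exprM exprn_ege1// ler1n. Qed.

Lemma fhat_bessel (A : seq idx) : uniq A ->
  \sum_(ka <- A) \sum_(i < nmons n m) sqn (fhat_c f (mon i) ka) <= energy.
Proof.
move=> uA; rewrite exchange_big; apply: ler_sum => i _.
exact: (bessel mC (@csq_chiZ R n) ortho (cf (mon i)) uA).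
Qed.

Variable q : idx -> P.
Hypothesis hq : forall ka, [/\ q ka \is ishomog1 m.-1 mdeg,
  m = 0%N -> q ka = 0, ka.2 = 0 -> q ka = 0,
  ka.2 != 0 -> forall al, fhat_c f al ka =
    \sum_(i | (0 < al i)%N) (kappa R ka 0 i)%:C%C * mcoeff (mnm_sub al (mnm1 i)) (q ka) &
  forall i be, kappa R ka 0 i ^+ 2 * sqn (mcoeff be (q ka)) <=
    qbound * \sum_(i < nmons n m) sqn (fhat_c f (mon i) ka)].

Definition gcoef be (ka : idx) : R[i] := tpi^-1 * mcoeff be (q ka).

Lemma sqn_tpi_ge1 : 1 <= sqn (tpi : R[i]).
Proof. by rewrite /sqn /tpi /= expr0n add0r; have := pi_ge2 R; nra. Qed.

Lemma tpi_neq0 : tpi != 0 :> R[i].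
Proof.
by apply: contraTneq sqn_tpi_ge1 => ->; rewrite sqn0 -ltNge ltr01.
Qed.

Lemma dfreq_gcoef i be ka : dfreq i (gcoef be) ka = (kappa R ka 0 i)%:C%C * mcoeff be (q ka).
Proof. by rewrite /dfreq /gcoef mulrA [tpi * _ * tpi^-1]mulrAC mulfV ?tpi_neq0// mul1r. Qed.

Lemma dfreq_gcoef_le i be (A : seq idx) : uniq A ->
  \sum_(ka <- A) sqn (dfreq i (gcoef be) ka) <= qbound * energy.
Proof.
move=> uA; apply: (@le_trans _ _ (\sum_(ka <- A) qbound * \sum_(i < nmons n m) sqn (fhat_c f (mon i) ka))).
  apply: ler_sum => ka _; rewrite dfreq_gcoef sqnM sqnC.
  by have [_ _ _ _] := hq ka; exact.
rewrite -mulr_sumr ler_wpM2l ?(le_trans ler01 qbound_ge1)//; exact: fhat_bessel.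
Qed.

(** For [k = 0] the coefficient is 0. Otherwise some integer [k 0 j] is nonzero, so its square is at
    least 1 and the bound on the derivative in that direction bounds the coefficient itself. *)
Lemma gcoef_le be (A : seq idx) : uniq A ->
  \sum_(ka <- A) sqn (gcoef be ka) <= qbound * energy.
Proof.
move=> uA; apply: (@le_trans _ _ (\sum_(ka <- A) qbound * \sum_(i < nmons n m) sqn (fhat_c f (mon i) ka))).
  apply: ler_sum => ka _; have [_ _ q0 _ qle] := hq ka.
  have S0 : 0 <= qbound * \sum_(i < nmons n m) sqn (fhat_c f (mon i) ka).
    by rewrite mulr_ge0 ?(le_trans ler01 qbound_ge1)// sumr_ge0// => i _; exact: sqn_ge0.
  rewrite /gcoef; have [/q0 ->|k0] := eqVneq ka.2 0; first by rewrite mcoeff0 mulr0 sqn0.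
  have [j kj] : exists j, ka.2 0 j != 0.
    apply: contrapT => H; move/eqP: k0; apply; apply/rowP => j; rewrite mxE; apply/eqP.
    by apply: contraT => kj; case: H; exists j.
  apply: le_trans (qle (lift 0 j) be).
  have k1 : 1 <= kappa R ka 0 (lift 0 j) ^+ 2.
    rewrite /kappa cons_rVS mxE -rmorphXn/= ler1z -gtz0_ge1 lt0r sqr_ge0 andbT.
    by rewrite expf_eq0 /=.
  apply: (@le_trans _ _ (sqn (mcoeff be (q ka)))).
    have s0 := sqn_ge0 (tpi^-1 * mcoeff be (q ka)).
    rewrite -[leRHS](_ : sqn tpi * sqn (tpi^-1 * mcoeff be (q ka)) = _); last first.
      by rewrite -sqnM mulrA mulfV ?tpi_neq0// mul1r.
    by rewrite ler_peMl// sqn_tpi_ge1.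
  by rewrite ler_peMl// sqn_ge0.
rewrite -mulr_sumr ler_wpM2l ?(le_trans ler01 qbound_ge1)//; exact: fhat_bessel.
Qed.

Lemma fhat0_le i (A : seq int) : uniq A ->
  \sum_(s <- A) sqn (fhat_c f (mon (i : 'I_(nmons n m))) (s, 0)) <= energy.
Proof.
move=> uA; have uA' : uniq [seq (s, 0 : 'rV[int]_n) | s <- A] by rewrite map_inj_uniq// => s t [].
apply: le_trans (fhat_bessel uA'); rewrite big_map; apply: ler_sum => s _.
by rewrite (bigD1 i)//= lerDl; apply: sumr_ge0 => j _; exact: sqn_ge0.
Qed.

End solution.

(** * Boundary values of the partial sums *)

Section slice_sums.
Context (R : realType) (n : nat).
Local Notation mV := (measurableTypeR R * 'rV[R]_n)%type.
Local Notation cellM := (@cell R n : set mV).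
Local Notation cubeM := (@cube R n).
Local Notation lebn := (lebesgue_rV R n).
Local Notation vol := (volM R n).
Local Notation idx := (int * 'rV[int]_n)%type.
Local Notation mC := (@mcell R n).
Local Notation chs := (@chiZ R n).

Definition zrange (M : nat) : seq int := [seq i%:Z - M%:Z | i <- iota 0 (M.*2).+1].

Lemma zrange_uniq M : uniq (zrange M).
Proof. by rewrite map_inj_uniq ?iota_uniq// => i j /addIr []. Qed.

Lemma mem_zrange M (s : int) : (`|s| <= M)%N -> s \in zrange M.
Proof.
move=> sM; apply/mapP; exists (absz (s + M%:Z)); first by rewrite mem_iota; lia.
by lia.
Qed.

Definition rect (M : nat) (K : seq 'rV[int]_n) : seq idx := [seq (s, k) | s <- zrange M, k <- K].

Lemma rect_uniq M K : uniq K -> uniq (rect M K).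
Proof. by move=> uK; apply: allpairs_uniq => //; [exact: zrange_uniq|move=> [? ?] [? ?] _ _ [-> ->]]. Qed.

(** The sum [T_M] at [k]. Characters with integer [s] do not depend on [s] at [x = 0] and [x = 1],
    so this is the [k]-th Fourier coefficient of both boundary values of a rectangular partial
    sum. *)
Definition slice_sum (c : idx -> R[i]) M k := \sum_(s <- zrange M) c (s, k).

Lemma sub_rect (A : seq idx) : exists M0, forall M K, (M0 <= M)%N ->
  {subset [seq ka.2 | ka <- A] <= K} -> {subset A <= rect M K}.
Proof.
exists (\max_(ka <- A) `|ka.1|)%N => M K M0M AK [s k] skA.
apply/allpairsP; exists (s, k); split => //=; last by apply: AK; apply/mapP; exists (s, k).
apply: mem_zrange; apply: leq_trans M0M.
by have := @leq_bigmax_seq _ A xpredT (fun ka : idx => `|ka.1|%N) (s, k) skA isT.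
Qed.

Lemma chiZ_boundary ka y : (chs ka (1, y) = chiq (map_mx intr ka.2) y) *
  (chs ka (0, y) = chiq (map_mx intr ka.2) y).
Proof. by rewrite /chiZ /chi /= mulr1 mulr0 expi2pi expi0 !mul1r. Qed.

Lemma fsum_rect_boundary c M K y :
  (fsum chs c (rect M K) (1, y) = fsum (fun k => chiq (map_mx intr k)) (slice_sum c M) K y) *
  (fsum chs c (rect M K) (0, y) = fsum (fun k => chiq (map_mx intr k)) (slice_sum c M) K y).
Proof.
have H : \sum_(ka <- rect M K) c ka * chiq (map_mx intr ka.2) y =
   fsum (fun k => chiq (map_mx intr k)) (slice_sum c M) K y :> R[i].
  rewrite /rect big_allpairs_dep exchange_big; apply: eq_bigr => k _.
  by rewrite /slice_sum mulr_suml.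
by split; rewrite -H; apply: eq_bigr => ka _; rewrite !chiZ_boundary.
Qed.

Variables (c : idx -> R[i]) (F : mV -> R[i]).
Hypothesis cF : csq vol cellM F.
Hypothesis Fc : fsum_cvg vol cellM chs c F.

Local Notation psi t k := (chi t (map_mx intr (- k))).

Lemma nsq_chi1 t w : nsq vol cellM (chi t w) = 1.
Proof.
rewrite /nsq; under eq_Rintegral => z _ do rewrite sqn_chi.
by rewrite Rintegral_cst; [rewrite [X in _ * fine X](volM_cell R n) mulr1|exact: mC].
Qed.

(** Both pairings are approximated at once by those of a rectangular partial sum. The set [K]
    contains [k], so that this slice is present, and does not change as [M] grows. *)
Let pairing_limit F' i (t : R) (k : 'rV[int]_n) : csq vol cellM F' ->
  fsum_cvg vol cellM chs (dfreq i c) F' -> forall eps : R, 0 < eps ->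
  exists M0 (K : seq 'rV[int]_n), [/\ uniq K, k \in K & forall M, (M0 <= M)%N ->
  sqn ((cintegral vol cellM (fun z => F' z * psi t k z) +
        tpi * (cons_rV (t, map_mx intr (- k)) 0 i)%:C%C * cintegral vol cellM (fun z => F z * psi t k z)) -
       (cintegral vol cellM (fun z => fsum chs (dfreq i c) (rect M K) z * psi t k z) +
        cintegral vol cellM (fun z => fsum chs c (rect M K) z *
          (tpi * (cons_rV (t, map_mx intr (- k)) 0 i)%:C%C * psi t k z)))) <= eps].
Proof.
(* The error is at most [2 (2 e1) + 2 sqn x (2 e1)], which the choice of [e1] makes equal to
   [eps]. *)
move=> cF' F'c eps e0; set x := tpi * _; pose e1 := eps / (4 * (1 + sqn x)).
have x0 := sqn_ge0 x; have x1 : 0 < 4 * (1 + sqn x) by nra.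
have e10 : 0 < e1 by rewrite divr_gt0.
have [A0 uA0 H0] := Fc e10; have [A1 uA1 H1] := F'c e1 e10.
have [M0 HM0] := sub_rect (A0 ++ A1).
pose K := undup (k :: [seq ka.2 | ka <- A0 ++ A1]); have uK : uniq K by exact: undup_uniq.
exists M0, K; split => //; first by rewrite mem_undup inE eqxx.
move=> M M0M; pose A := rect M K; have uA : uniq A by exact: rect_uniq.
have AA : {subset A0 ++ A1 <= A}.
  by apply: HM0 => // l lA; rewrite mem_undup inE lA orbT.
have {}H0 := H0 A uA (fun ka kaA => AA ka ltac:(by rewrite mem_cat kaA)).
have {}H1 := H1 A uA (fun ka kaA => AA ka ltac:(by rewrite mem_cat kaA orbT)).
have cpsi : csq vol cellM (psi t k) by exact: csq_chi.
have h0 := cint_close mC cF (csq_fsumZ c A) cpsi; have h1 := cint_close mC cF' (csq_fsumZ (dfreq i c) A) cpsi.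
rewrite nsq_chi1 !mulr1 in h0 h1.
have -> : cintegral vol cellM (fun z => fsum chs c A z * (x * psi t k z)) =
    x * cintegral vol cellM (fun z => fsum chs c A z * psi t k z).
  rewrite -cintZ; [|exact: mC|by apply: csq_mul; [exact: mC|exact: csq_fsumZ|]].
  by apply: eq_cint => z _; rewrite mulrCA.
set a := cintegral _ _ _ in h1 *; set b := cintegral _ _ _ in h0 *.
set a' := cintegral _ _ _ in h1 *; set b' := cintegral _ _ _ in h0 *.
rewrite (_ : _ - _ = (a - a') + x * (b - b')); last by ring.
apply: le_trans (sqnD_le _ _) _; rewrite sqnM.
have ea : sqn (a - a') <= 2 * e1 by apply: le_trans h1 _; rewrite ler_pM2l.
have eb : sqn (b - b') <= 2 * e1 by apply: le_trans h0 _; rewrite ler_pM2l.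
have ee : e1 * (4 * (1 + sqn x)) = eps by rewrite /e1 mulfVK// gt_eqF.
nra.
Qed.

(** Integration by parts against [chi t (- k)]: by orthogonality on the torus the boundary term
    retains only the slice [k], multiplied by the jump [expi (2 pi t) - 1] of the test character
    between the two ends. *)
Lemma slice_sum_limit F' (t : R) (k : 'rV[int]_n) : csq vol cellM F' ->
  fsum_cvg vol cellM chs (dfreq 0 c) F' -> forall eps : R, 0 < eps ->
  exists M0, forall M, (M0 <= M)%N ->
  sqn ((cintegral vol cellM (fun z => F' z * psi t k z) +
        tpi * t%:C%C * cintegral vol cellM (fun z => F z * psi t k z)) -
       (expi (2 * pi * t) - 1) * slice_sum c M k) <= eps.
Proof.
move=> cF' F'c eps e0; have [M0 [K [uK kK H]]] := pairing_limit t k cF' F'c e0.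
exists M0 => M M0M; have := H M M0M.
have ppsi := @chi_periodic R n t (- k).
rewrite (fsum_by_parts _ _ (cC1dir_chi 0 t (map_mx intr (- k))) ppsi) eqxx cons_rV0.
congr (sqn (_ - _) <= _).
rewrite (eq_cint (G := fun y => (expi (2 * pi * t) - 1) *
   (fsum (fun k => chiq (map_mx intr k)) (slice_sum c M) K y * conjc (chiq (map_mx intr k) y)))).
  have cq l : csq lebn cubeM (chiq (map_mx intr l)) by exact: csq_chiq.
  rewrite cintZ; [|exact: mcube|]; last first.
    by apply: csq_mul; [exact: mcube|exact: (csq_fsum (@mcube R n) cq)|apply: csqJ; [exact: mcube|exact: cq]].
  by rewrite (cint_fsum_mulJ (@mcube R n) cq (@orthonormal_chiq R n) _ _ uK) kK.
move=> y _; rewrite !fsum_rect_boundary.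
have -> : conjc (chiq (map_mx intr k) y) = chiq (map_mx intr (- k)) y :> R[i].
  rewrite !chiqE conjc_expi -mulrN; congr (expi (_ * _)).
  by rewrite /dotp -sumrN; apply: eq_bigr => j _; rewrite !mxE rmorphN mulNr.
by rewrite /chi /= mulr1 mulr0 expi0; ring.
Qed.

(** Along the torus there is no boundary term, so integration by parts is exact in the limit, for
    every real [t]. *)
Lemma pairing_lift F' j (t : R) (k : 'rV[int]_n) : csq vol cellM F' ->
  fsum_cvg vol cellM chs (dfreq (lift 0 j) c) F' ->
  cintegral vol cellM (fun z => F' z * psi t k z) =
  tpi * ((k 0 j)%:~R)%:C%C * cintegral vol cellM (fun z => F z * psi t k z).
Proof.
move=> cF' F'c; apply/eqP; rewrite -subr_eq0; apply/eqP; apply: (@sqn_small_eq0 R _ 1) => eps e0.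
have [M0 [K [uK kK H]]] := pairing_limit t k cF' F'c e0.
have := H M0 (leqnn _); have ppsi := @chi_periodic R n t (- k).
rewrite (fsum_by_parts _ _ (cC1dir_chi (lift 0 j) t (map_mx intr (- k))) ppsi) /= subr0 mul1r.
congr (sqn (_ + _) <= _); rewrite cons_rVS !mxE rmorphN -mulNr; congr (_ * _).
by rewrite rmorphN /= mulrN.
Qed.

End slice_sums.

Section smooth_trigonometric_polynomials.
Context (R : realType) (n : nat).
Local Notation V := (R * 'rV[R]_n)%type.

Lemma C1dir_derive (W : normedModType R) (v : W) (a Da : W -> R) : C1dir v a Da ->
  (forall z, derivable a z v) /\ (fun z => 'D_v a z) = Da.
Proof.
move=> [_ _ da].
have E z : (fun h : R => h^-1 *: (((fun s : R => a (z + s *: v)) \o shift 0) (h *: (1 : R)) - a (z + 0 *: v))) =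
   (fun h : R => h^-1 *: ((a \o shift z) (h *: v) - a z)).
  apply/funext => h /=; rewrite /shift/= scale0r !addr0 [h *: 1]mulr1.
  by congr (_ *: (a _ - _)); rewrite addrC.
have D z : is_derive (0 : R) (1 : R) (fun s : R => a (z + s *: v)) (Da z).
  by have := da z 0; rewrite scale0r addr0.
split=> [z|].
  by have [d _] := D z; move: d; rewrite /derivable E.
by apply/funext => z; have [_ <-] := D z; rewrite /derive E.
Qed.

Let dual (s : R) (w : 'rV[R]_n) (z : V) := s * z.1 + dotp w z.2.

Let trig (r : seq (R * R * (R * 'rV[R]_n))) (z : V) : R :=
  \sum_(p <- r) (p.1.1 * cos (2 * pi * dual p.2.1 p.2.2 z) + p.1.2 * sin (2 * pi * dual p.2.1 p.2.2 z)).

(** Real trigonometric sums with a fixed list of frequencies are closed under every directional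
    derivative; smoothness follows by induction on the order. *)
Let trig_C1 r (v : V) : C1dir v (trig r) (trig [seq
  ((p.1.2 * (2 * pi * dual p.2.1 p.2.2 v), - p.1.1 * (2 * pi * dual p.2.1 p.2.2 v)), p.2) | p <- r]).
Proof.
have base s w : C1dir v (fun z => cos (2 * pi * dual s w z))
     (fun z => - (2 * pi * dual s w v) * sin (2 * pi * dual s w z)) /\
   C1dir v (fun z => sin (2 * pi * dual s w z))
     (fun z => (2 * pi * dual s w v) * cos (2 * pi * dual s w z)).
  apply: C1dir_trig.
    have -> : (fun z => 2 * pi * dual s w z) = (fun z : V => 2 * pi * (s * z.1 + \sum_(j <- enum 'I_n) w 0 j * z.2 0 j)).
      by apply/funext => z; rewrite /dual /dotp big_enum.
    move=> z; apply: cvgM; first exact: cvg_cst.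
    apply: cvgD; first by apply: cvgM; [exact: cvg_cst|exact: cvg_fst].
    elim: (enum 'I_n) => [|j l IH].
      rewrite big_nil; under eq_fun do rewrite big_nil; exact: cvg_cst.
    rewrite big_cons; under eq_fun do rewrite big_cons; apply: cvgD => //.
    apply: cvgM; first exact: cvg_cst.
    apply: (continuous_comp (f := snd) (g := fun y : 'rV[R]_n => y 0 j)); first exact: cvg_snd.
    exact: coord_continuous.
  move=> z t; rewrite /dual.
  have -> : (z + t *: v).1 = z.1 + t * v.1 by [].
  have -> : (z + t *: v).2 = z.2 + t *: v.2 by [].
  by rewrite dotpDr dotpZr; ring.
elim: r => [|[[a b] [s w]] r IH].
  by rewrite /trig /=; have := C1dir_cst v 0; congr C1dir; apply/funext => z; rewrite big_nil.
have [Bc Bs] := base s w.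
have := C1dirD (C1dirD (C1dirM (C1dir_cst v a) Bc) (C1dirM (C1dir_cst v b) Bs)) IH.
rewrite /trig /=; congr C1dir; apply/funext => z; rewrite big_cons //=.
by congr (_ + _); ring.
Qed.

Let trig_smooth r : smooth (trig r).
Proof.
move=> k; elim: k r => [|k IH] r; split => //.
- by have [c _ _] := trig_C1 r 0.
- by have [c _ _] := trig_C1 r 0.
- by move=> v; have [d E] := C1dir_derive (trig_C1 r v); split => //; rewrite E; exact: IH.
Qed.

Lemma fsum_smooth c A : smooth (fun z : V => cRe (fsum (@chiZ R n) c A z)) /\
  smooth (fun z : V => cIm (fsum (@chiZ R n) c A z)).
Proof.
have ER : (fun z : V => cRe (fsum (@chiZ R n) c A z)) =
  trig [seq ((cRe (c ka), - cIm (c ka)), (ka.1%:~R, map_mx intr ka.2)) | ka <- A].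
  apply/funext => z; rewrite /fsum cRe_sum /trig big_map; apply: eq_bigr => ka _.
  by rewrite /chiZ chiE cpartE /= /dual mulNr.
have EI : (fun z : V => cIm (fsum (@chiZ R n) c A z)) =
  trig [seq ((cIm (c ka), cRe (c ka)), (ka.1%:~R, map_mx intr ka.2)) | ka <- A].
  apply/funext => z; rewrite /fsum cIm_sum /trig big_map; apply: eq_bigr => ka _.
  by rewrite /chiZ chiE cpartE /= /dual addrC.
by rewrite ER EI; split; exact: trig_smooth.
Qed.

Lemma cC1dir_derive v (F DF : V -> R[i]) z : cC1dir v F DF ->
  DF z = Complex ('D_v (fun z => cRe (F z)) z) ('D_v (fun z => cIm (F z)) z).
Proof.
move=> [/C1dir_derive[_ /(congr1 (@^~ z)) /= ->] /C1dir_derive[_ /(congr1 (@^~ z)) /= ->]].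
by case: (DF z).
Qed.

End smooth_trigonometric_polynomials.

(** * Construction of the decomposition *)

Section fields_from_coefficients.
Context (R : realType) (n d : nat) (T : Type).
Local Notation P := (mpoly n.+1 R[i]).
Variable G : multinom n.+1 -> T -> R[i].
Hypothesis G0 : forall be, mdeg be != d -> G be = fun=> 0.

Definition fld (z : T) : P := \sum_(j < nmons n d) G (mon j) z *: mpolyX R[i] (mon j).

Lemma fld_homog z : fld z \is ishomog1 d mdeg.
Proof. exact: mon_sum_homog. Qed.

Lemma mcoeff_fld be z : mcoeff be (fld z) = G be z.
Proof.
have [/(@monP n d)[i ->]|ad] := eqVneq (mdeg be) d; first exact: mcoeff_mon_sum.
by rewrite (mcoeff_homog0 (fld_homog z) ad) (G0 ad).
Qed.

End fields_from_coefficients.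

(** The map [phi], the identity on [D], allows a field given on the cell to be replaced by its
    periodic extension. *)
Lemma fld_L2 (R : realType) n d dd (T : measurableType dd) (mu : {measure set T -> \bar R})
    (D : set T) (mD : measurable D) (G : multinom n.+1 -> T -> R[i]) (phi : T -> T) (C b : R) :
  (forall be, mdeg be != d -> G be = fun=> 0) ->
  (forall z, D z -> phi z = z) ->
  (forall be, csq mu D (G be)) -> (forall be, nsq mu D (G be) <= b) -> 0 <= C -> 0 <= b ->
  (forall p : mpoly n.+1 R[i], p \is ishomog1 d mdeg ->
    normP p ^+ 2 <= C * \sum_(i < nmons n d) sqn (mcoeff (mon i) p)) ->
  L2 mu D (fun z => fld d G (phi z)) /\
  (L2norm mu D (fun z => fld d G (phi z)) <= (Num.sqrt (C * ((nmons n d)%:R * b)))%:E)%E.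
Proof.
move=> G0 phiD cG Gb C0 b0 HC.
have E be : {in D, G be =1 (fun z => mcoeff be (fld d G (phi z)))}.
  by move=> z /set_mem Dz; rewrite mcoeff_fld// phiD.
have cf be : csq mu D (fun z => mcoeff be (fld d G (phi z))) := eq_csq mD (E be) (cG be).
have nb : (L2norm mu D (fun z => fld d G (phi z)) <= (Num.sqrt (C * ((nmons n d)%:R * b)))%:E)%E.
  apply: (@L2norm_le R n d _ T mu D mD _ _ C) => //.
  - by move=> z _; exact: fld_homog.
  - rewrite sqr_sqrtr ?mulr_ge0// ler_wpM2l//.
    have -> : (nmons n d)%:R * b = \sum_(i < nmons n d) b by rewrite sumr_const card_ord mulr_natl.
    apply: ler_sum => i _.
    by apply: le_trans (Gb (mon i)); rewrite le_eqVlt; apply/orP; left; apply/eqP/esym/eq_nsq.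
split => //; split; last exact: le_lt_trans nb (ltry _).
by move=> al; exact: (cf al).1.
Qed.

Section solution_identity.
Context (R : realType) (n m : nat).
Local Notation P := (mpoly n.+1 R[i]).
Local Notation mV := (measurableTypeR R * 'rV[R]_n)%type.
Local Notation mR := (measurableTypeR R).
Local Notation leb := (@lebesgue_measure R).
Local Notation cellM := (@cell R n : set mV).
Local Notation I01 := (`[0, 1]%classic : set mR).
Local Notation vol := (volM R n).
Local Notation idx := (int * 'rV[int]_n)%type.
Local Notation mC := (@mcell R n).
Local Notation chs := (@chiZ R n).
Local Notation volty := (volM_cell_lty R n).
Local Notation ortho := (@orthonormal_chiZ R n).
Local Notation ex := (fun (s : int) (x : mR) => expi (2 * pi * s%:~R * x) : R[i]).

(** The projection to the fundamental cube in [y]. Functions composed with it are periodic at every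
    point, although Fourier series only define them almost everywhere on the cell. *)
Definition torus (z : R * 'rV[R]_n) : R * 'rV[R]_n := (z.1, translate 0 z.2).

Lemma torus_cell z : cell z -> torus z = z.
Proof.
case: z => x y [_ cy]; congr (_, _); apply/rowP => j; rewrite !mxE addr0 frac_id//.
Qed.

Lemma torus_periodic z (k : 'rV[int]_n) : torus (z.1, z.2 + map_mx intr k) = torus z.
Proof. by congr (_, _); apply/rowP => j; rewrite !mxE /= !addr0 frac_int. Qed.

Variable f : R * 'rV[R]_n -> P.
Hypothesis hf : forall z, slab z -> f z \is ishomog1 m mdeg.
Hypothesis cf : forall al, csq vol cellM (fun z => mcoeff al (f z)).
Variable q : idx -> P.
Hypothesis q0 : forall ka, ka.2 = 0 -> q ka = 0.
Hypothesis fq : forall ka, ka.2 != 0 -> forall al, fhat_c f al ka =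
  \sum_(i | (0 < al i)%N) (kappa R ka 0 i)%:C%C * mcoeff (mnm_sub al (mnm1 i)) (q ka).
Variables (DG : 'I_n.+1 -> multinom n.+1 -> mV -> R[i]) (H : multinom n.+1 -> mR -> R[i]).
Hypothesis cDG : forall i be, csq vol cellM (DG i be).
Hypothesis DGc : forall i be, fsum_cvg vol cellM chs (dfreq i (gcoef q be)) (DG i be).
Hypothesis cH : forall al, csq leb I01 (H al).
Hypothesis Hc : forall al, fsum_cvg leb I01 ex (fun s => fhat_c f al (s, 0)) (H al).

Let rest (al : multinom n.+1) (z : mV) : R[i] :=
  \sum_(i | (0 < al i)%N) DG i (mnm_sub al (mnm1 i)) z.

Lemma cint_fst_chiJ (K : mR -> R[i]) (s : R) (k : 'rV[int]_n) : csq leb I01 K ->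
  cintegral vol cellM (fun z => K z.1 * chi s (map_mx intr k) z) =
  cintegral leb I01 (fun x => K x * expi (2 * pi * s * x)) * (k == 0)%:R.
Proof.
move=> cK; have cKe : csq leb I01 (fun x => K x * expi (2 * pi * s * x)).
  split; first by apply: cmeasM; [exact: cK.1|exact: cmeas_expi_lin].
  by apply: (eq_rintble (@mI01 R) _ cK.2) => x _; rewrite sqnM sqn_expi mulr1.
rewrite -cint_chiq -(cint_fst_chiq _ cKe); apply: eq_cint => z _.
by rewrite /chi mulrA.
Qed.

(** All Fourier coefficients of the difference vanish: at [k = 0] the series of [H] was built from
    those of [f] and [q] is 0, elsewhere [H] does not contribute and the division formula gives
    those of [f]. Totality concludes. *)
Lemma solution_identity_coef al : {ae vol, forall z, cellM z ->
  mcoeff al (f z) - H al z.1 - rest al z = 0}.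
Proof.
have crest : csq vol cellM (rest al) by apply: csq_sum; [exact: mC|move=> i _; exact: cDG].
have cHf : csq vol cellM (fun z => H al z.1) := csq_fst n (cH al).
have cr : csq vol cellM (fun z => mcoeff al (f z) - H al z.1 - rest al z).
  by apply: csqB; [exact: mC|apply: csqB; [exact: mC|exact: cf|exact: cHf]|exact: crest].
apply: (ctotal_cell (csq_cintble mC volty cr)) => kb.
(* Totality pairs without conjugation and Fourier coefficients with it, whence the opposite
   frequency. *)
pose ka : idx := (- kb.1, - kb.2).
have E z : chiZ kb z = conjc (chs ka z).
  rewrite /chiZ conjc_chi /ka /= rmorphN opprK; congr (chi _ _ z).
  by apply/rowP => j; rewrite !mxE rmorphN opprK.
have cJ : csq vol cellM (fun z => conjc (chs ka z)) by exact: csq_chiZJ.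
transitivity (cintegral vol cellM (fun z => mcoeff al (f z) * conjc (chs ka z) - H al z.1 * conjc (chs ka z)
   - rest al z * conjc (chs ka z))); first by apply: eq_cint => z _; rewrite E !mulrBl.
rewrite cintB; [|exact: mC|..]; last 2 first.
- by apply: cintbleB; [exact: mC|apply: csq_mul => //; exact: mC|apply: csq_mul => //; exact: mC].
- by apply: csq_mul => //; exact: mC.
rewrite cintB; [|exact: mC|apply: csq_mul => //; exact: mC|apply: csq_mul => //; exact: mC].
rewrite -/(fhat_c f al ka).
have -> : cintegral vol cellM (fun z => H al z.1 * conjc (chs ka z)) =
    fhat_c f al (ka.1, 0) * (ka.2 == 0)%:R.
  rewrite -(fourier_coefficient (@mI01 R) (fun s => csq_expi_lin s%:~R)
     (@orthonormal_expi R n) ka.1 (cH al) (Hc al)).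
  rewrite (eq_cint (G := fun z => H al z.1 * chi (- ka.1%:~R) (map_mx intr (- ka.2)) z)).
    rewrite (cint_fst_chiJ _ _ (cH al)) oppr_eq0; congr (_ * _); apply: eq_cint => x _.
    by rewrite conjc_expi; congr (_ * expi _); ring.
  have kN : map_mx intr (- ka.2) = - map_mx intr ka.2 :> 'rV[R]_n by apply/rowP => j; rewrite !mxE rmorphN.
  by move=> z _; rewrite kN -conjc_chi.
have -> : cintegral vol cellM (fun z => rest al z * conjc (chs ka z)) =
    \sum_(i | (0 < al i)%N) (kappa R ka 0 i)%:C%C * mcoeff (mnm_sub al (mnm1 i)) (q ka).
  rewrite (eq_cint (G := fun z => \sum_(i | (0 < al i)%N) DG i (mnm_sub al (mnm1 i)) z * conjc (chs ka z))).
    rewrite cint_sum; [|exact: mC|by move=> i _; apply: csq_mul => //; exact: mC].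
    apply: eq_bigr => i _; rewrite (fourier_coefficient mC (@csq_chiZ R n) ortho ka (cDG _ _) (DGc _ _)).
    by rewrite dfreq_gcoef.
  by move=> z _; rewrite /rest mulr_suml.
have [k0|k0] := eqVneq ka.2 0; last by rewrite mulr0 subr0 (fq k0) subrr.
rewrite mulr1 -k0 -surjective_pairing subrr big1 ?subr0// => i _.
by rewrite (q0 k0) mcoeff0 mulr0.
Qed.

Lemma solution_identity : {ae vol, forall z, cellM z -> forall al,
  mcoeff al (f z) = H al z.1 + rest al z}.
Proof.
have : {ae vol, forall z, forall N : nat, if unpickle N is Some al then
    cellM z -> mcoeff al (f z) = H al z.1 + rest al z else True}.
  apply: ae_foralln => N; case: (unpickle N) => [al|]; last exact: nearW.
  apply: filterS (solution_identity_coef al) => z h cz; apply/eqP.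
  by rewrite -subr_eq0 opprD addrA h.
apply: filterS => z h cz al; have := h (pickle al); rewrite pickleK; exact.
Qed.

Hypothesis H0 : forall al, mdeg al != m -> H al = fun=> 0.
Hypothesis DG0 : forall i be, mdeg be != m.-1 -> DG i be = fun=> 0.

Lemma solution_equation : {ae vol, forall z, cellM z ->
  f z = fld m H z.1 + symd (fun i => fld m.-1 (DG i)) z}.
Proof.
apply: filterS solution_identity => z h cz; apply/mpolyP => al.
rewrite (h cz) mcoeffD (mcoeff_fld H0); congr (_ + _).
rewrite /symd raddf_sum/= /rest big_mkcond; apply: eq_bigr => i _.
by rewrite mcoeff_mulXU; case: ifP => // _; rewrite (mcoeff_fld (DG0 i)).
Qed.

Lemma csq_fld_DG i al : csq vol cellM (fun z => mcoeff al (fld m.-1 (DG i) z)).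
Proof. by apply: eq_csq (cDG i al); [exact: mC|move=> z _; rewrite (mcoeff_fld (DG0 i))]. Qed.

Lemma csq_fld_H al : csq vol cellM (fun z => mcoeff al (fld m H z.1)).
Proof. by apply: eq_csq (csq_fst n (cH al)); [exact: mC|move=> z _; rewrite (mcoeff_fld H0)]. Qed.

Lemma evalP_symd (Dg : 'I_n.+1 -> R * 'rV[R]_n -> P) z (u : 'rV[R]_n.+1) :
  evalP (symd Dg z) u = \sum_i (u 0 i)%:C%C * evalP (Dg i z) u.
Proof.
rewrite /symd /evalP raddf_sum/=; apply: eq_bigr => i _.
by rewrite mevalM mevalXU.
Qed.

Lemma symd_pairing (u : 'rV[R]_n.+1) (psi : mV -> R[i]) : csq vol cellM psi ->
  \sum_i (u 0 i)%:C%C * cintegral vol cellM (fun z => evalP (fld m.-1 (DG i) z) u * psi z) =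
  cintegral vol cellM (fun z => evalP (f z) u * psi z) -
  cintegral vol cellM (fun z => evalP (fld m H z.1) u * psi z).
Proof.
move=> cpsi.
have ef : csq vol cellM (fun z => evalP (f z) u).
  by apply: (csq_evalP_field mC (d := m) _ cf) => z /cell_slab; exact: hf.
have eH : csq vol cellM (fun z => evalP (fld m H z.1) u).
  by apply: (csq_evalP_field mC (d := m) _ csq_fld_H) => z _; exact: fld_homog.
have eD i : csq vol cellM (fun z => evalP (fld m.-1 (DG i) z) u).
  by apply: (csq_evalP_field mC (d := m.-1) _ (csq_fld_DG i)) => z _; exact: fld_homog.
rewrite -cintB; [|exact: mC|apply: csq_mul => //; exact: mC|apply: csq_mul => //; exact: mC].
under eq_bigr => i _ do rewrite -(cintZ mC _ (csq_mul mC (eD i) cpsi)).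
rewrite -cint_sum; [|exact: mC|]; last first.
  by move=> i _; apply: cintbleZ; [exact: mC|apply: csq_mul => //; exact: mC].
apply: (ae_eq_cint mC).
- apply: cmeas_sum => i _; apply: cmeasM; first exact: cmeas_cst.
  by apply: cmeasM; [exact: (eD i).1|exact: cpsi.1].
- by apply: cmeasB; apply: cmeasM; by [exact: ef.1|exact: eH.1|exact: cpsi.1].
apply: filterS solution_equation => z h cz.
rewrite (h cz) evalPD evalP_symd mulrDl addrAC subrr add0r mulr_suml.
by apply: eq_bigr => i _; rewrite mulrA.
Qed.

Lemma fld_H_pairing (u : 'rV[R]_n.+1) (s : R) (k : 'rV[int]_n) : k != 0 ->
  cintegral vol cellM (fun z => evalP (fld m H z.1) u * chi s (map_mx intr k) z) = 0.
Proof.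
move=> k0; rewrite (cint_evalP mC (d := m) _ csq_fld_H); [|by move=> z _; exact: fld_homog|exact: csq_chi].
rewrite big1// => i _.
rewrite (eq_cint (G := fun z => H (mon i) z.1 * chi s (map_mx intr k) z)).
  by rewrite (cint_fst_chiJ _ _ (cH _)) (negbTE k0) !mulr0.
by move=> z _; rewrite (mcoeff_fld H0).
Qed.

Hypothesis pf : periodic_on (@slab R n) f.
Hypothesis xf : xray_vanishes f.
Hypothesis hq : forall ka, q ka \is ishomog1 m.-1 mdeg.
Variable G : multinom n.+1 -> mV -> R[i].
Hypothesis cG : forall be, csq vol cellM (G be).
Hypothesis Gc : forall be, fsum_cvg vol cellM chs (gcoef q be) (G be).

Lemma expi_neq1 (t : R) : 0 < t < 1 -> expi (2 * pi * t) != 1.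
Proof.
move=> /andP[t0 t1]; apply/eqP => /(congr1 (fun z => cRe z)) /= c1.
have pt0 : 0 < pi * t by rewrite mulr_gt0// pi_gt0.
have pt1 : pi * t < pi by rewrite gtr_pMr// pi_gt0.
have s0 : 0 < sin (pi * t) by apply: sin_gt0_pi; rewrite pt0.
have := cosD (pi * t) (pi * t); rewrite (_ : pi * t + pi * t = 2 * pi * t); last by ring.
rewrite c1 => E; have := cos2Dsin2 (pi * t); nra.
Qed.

(** The limits for the single coefficients are assembled into a polynomial [tauP]. The X-ray
    condition involves all coefficients at once, through evaluation at [(1, b)], so it is this
    polynomial that is shown to vanish. *)
Lemma slice_sum_cvg0 be k : k != 0 -> forall eps : R, 0 < eps ->
  exists M0, forall M, (M0 <= M)%N -> sqn (slice_sum (gcoef q be) M k) <= eps.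
Proof.
move=> k0.
have [db|db] := eqVneq (mdeg be) m.-1; last first.
  move=> eps e0; exists 0%N => M _; rewrite /slice_sum big1 ?sqn0 ?ltW// => s _.
  by rewrite /gcoef (mcoeff_homog0 (hq _) db) mulr0.
pose L be' (t : R) := cintegral vol cellM (fun z => DG 0 be' z * chi t (map_mx intr (- k)) z) +
   tpi * t%:C%C * cintegral vol cellM (fun z => G be' z * chi t (map_mx intr (- k)) z).
(* At [t = 1 / 2] the factor [expi (2 pi t) - 1] is [- 2], so the sums converge to
   [- L (1 / 2) / 2]. *)
pose tau be' := - (2^-1 * L be' (2^-1)).
have half : expi (2 * pi * 2^-1) - 1 = - 2 :> R[i].
  rewrite (_ : 2 * pi * 2^-1 = pi); last by rewrite mulrAC mulfV ?mul1r// pnatr_eq0.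
  by rewrite /expi cospi sinpi; apply: eq_cparts; rewrite ?cpartE /=; ring.
have T_tau be' eps : 0 < eps -> exists M0, forall M, (M0 <= M)%N ->
    sqn (slice_sum (gcoef q be') M k - tau be') <= eps.
  move=> e0; have [M0 hM] := slice_sum_limit (cG be') (Gc be') 2^-1 k (cDG 0 be') (DGc 0 be') e0.
  exists M0 => M M0M; have := hM M M0M; rewrite half -/(L be' _) => h.
  rewrite (_ : _ - tau be' = 2^-1 * (L be' 2^-1 - - 2 * slice_sum (gcoef q be') M k)); last first.
    by rewrite /tau; field.
  rewrite sqnM; apply: le_trans h; rewrite ler_piMl ?sqn_ge0//.
  rewrite (_ : sqn (2^-1 : R[i]) = 4^-1); first by rewrite invf_le1// ler1n.
  have : sqn ((2 : R[i]) * 2^-1) = 1 by rewrite mulfV ?pnatr_eq0// /sqn /= expr1n expr0n addr0.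
  by rewrite sqnM (_ : sqn (2 : R[i]) = 4); [move=> h4; lra|rewrite /sqn /=; ring].
(* Uniqueness of the limit, now that the sums are known to converge. *)
have L_tau be' t : L be' t = (expi (2 * pi * t) - 1) * tau be'.
  apply/eqP; rewrite -subr_eq0; apply/eqP; set ee := expi _ - 1.
  apply: (@sqn_small_eq0 R _ (2 + 2 * sqn ee)) => eps e0.
  have [M0 hM] := slice_sum_limit (cG be') (Gc be') t k (cDG 0 be') (DGc 0 be') e0.
  have [M1 hM1] := T_tau be' eps e0.
  have := hM _ (leq_maxl M0 M1); have := hM1 _ (leq_maxr M0 M1); rewrite -/(L be' t) -/ee.
  set S := slice_sum _ _ _ => h1 h2.
  rewrite (_ : _ - _ = (L be' t - ee * S) + ee * (S - tau be')); last by ring.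
  apply: le_trans (sqnD_le _ _) _; rewrite sqnM; have := sqn_ge0 ee; nra.
pose tauP : P := \sum_(j < nmons n m.-1) tau (mon j) *: mpolyX R[i] (mon j).
have htau : tauP \is ishomog1 m.-1 mdeg := mon_sum_homog _.
(* With [t = k . b] the pairings of [f] and of the part [h] are 0, so the combination of derivative
   pairings with weights [(1, b)] is 0. By [pairing_lift] its terms along the torus add up to
   [tpi t] times the pairing of [G], which turns it into the values [L (k . b)] assembled at
   [(1, b)]. *)
have tau0 b : (expi (2 * pi * dotp (map_mx intr k) b) - 1) * evalP tauP (cons_rV (1, b)) = 0.
  set t := dotp _ b; set u := cons_rV _; have cpsi := @csq_chi R n t (map_mx intr (- k)).
  have kN0 : - k != 0 by rewrite oppr_eq0.
  have fpair : cintegral vol cellM (fun z => evalP (f z) u * chi t (map_mx intr (- k)) z) = 0.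
    rewrite -((xray_vanishes_pairing hf pf cf).1 xf b (- k)); apply: eq_cint => z _.
    congr (_ * chi _ _ z); rewrite /t /dotp -sumrN; apply: eq_bigr => j _.
    by rewrite !mxE rmorphN mulNr opprK.
  have := symd_pairing u cpsi; rewrite fpair fld_H_pairing// subr0 => E.
  rewrite -[RHS]E (evalP_monE _ htau) mulr_sumr.
  have E1 i : cintegral vol cellM (fun z => evalP (fld m.-1 (DG i) z) u * chi t (map_mx intr (- k)) z) =
     \sum_(j < nmons n m.-1) evalP (mpolyX R[i] (mon j)) u *
        cintegral vol cellM (fun z => DG i (mon j) z * chi t (map_mx intr (- k)) z).
    rewrite (cint_evalP mC (d := m.-1) _ (csq_fld_DG i)); [|by move=> z _; exact: fld_homog|exact: cpsi].
    apply: eq_bigr => j _; congr (_ * _); apply: eq_cint => z _.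
    by rewrite (mcoeff_fld (DG0 i)).
  under [RHS]eq_bigr => i _ do rewrite E1 mulr_sumr.
  rewrite exchange_big; apply: eq_bigr => j _ /=.
  rewrite mcoeff_mon_sum mulrA -L_tau /L big_ord_recl /u cons_rV0 mul1r mulrDl mulrC; congr (_ + _).
  under [RHS]eq_bigr => l _ do rewrite cons_rVS (pairing_lift (cG _) (Gc _) _ _ (cDG _ _) (DGc _ _)).
  set Z := cintegral _ _ _.
  have tE : t%:C%C = \sum_l (((k 0 l)%:~R : R) * b 0 l)%:C%C.
    by rewrite /t /dotp rmorph_sum; apply: eq_bigr => l _; rewrite !mxE.
  transitivity (t%:C%C * (evalP (mpolyX R[i] (mon j)) (cons_rV (1, b)) * tpi * Z)); first by ring.
  by rewrite tE mulr_suml; apply: eq_bigr => l _; rewrite rmorphM /=; ring.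
suff tP0 : tauP = 0.
  have [i bE] := monP db; have t0 : tau be = 0 by rewrite bE -(mcoeff_mon_sum (fun j => tau (mon j))) -/tauP tP0 mcoeff0.
  by move=> eps e0; have := T_tau be eps e0; rewrite t0; under eq_exists do under eq_forall do rewrite subr0.
have [j kj] : exists j, k 0 j != 0.
  apply: contrapT => Hn; move/eqP: k0; apply; apply/rowP => j; rewrite mxE; apply/eqP.
  by apply: contraT => kj; case: Hn; exists j.
pose Sk : R := \sum_i `|(k 0 i)%:~R|.
have Sk0 : 0 <= Sk by apply: sumr_ge0.
(* The box starts at the point [(1, w)] with [k . w = 1 / 2], and is small enough to keep [k . w]
   between [1 / 4] and [3 / 4]. *)
pose e : R := (4 * (1 + Sk))^-1.
have e0 : 0 < e by rewrite invr_gt0; nra.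
pose c (i : 'I_n.+1) : R := if unlift 0 i is Some l then (if l == j then (2 * (k 0 j)%:~R)^-1 else 0) else 1.
apply: (@evalP_box_eq0 _ _ tauP c e e0) => u hu.
have /andP[u1 u2] : 1 <= u 0 0 <= 1 + e by have := hu 0; rewrite /c unlift_none.
have e4 : e <= 4^-1 by rewrite lef_pV2 ?posrE//; nra.
have eS : e * Sk <= 4^-1.
  by rewrite /e ler_pdivrMl; nra.
have u00 : u 0 0 != 0 by rewrite gt_eqF// (lt_le_trans _ u1).
pose w : 'rV[R]_n := \row_l u 0 (lift 0 l).
have kw : `|dotp (map_mx intr k) w - 2^-1| <= 4^-1.
  pose c' : 'rV[R]_n := \row_l c (lift 0 l).
  have -> : 2^-1 = dotp (map_mx intr k) c'.
    rewrite /dotp (bigD1 j)//= big1 ?addr0.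
      by rewrite !mxE /c liftK eqxx invfM mulrCA mulfV ?mulr1// intr_eq0.
    by move=> l lj; rewrite !mxE /c liftK (negbTE lj) mulr0.
  rewrite /dotp -sumrB; apply: le_trans (ler_norm_sum _ _ _) _; apply: le_trans eS.
  rewrite /Sk mulr_sumr; apply: ler_sum => l _; rewrite !mxE -mulrBr normrM mulrC ler_wpM2r//.
  by have /andP[h1 h2] := hu (lift 0 l); rewrite ger0_norm ?subr_ge0// lerBlDl.
rewrite (cons_rV_scale u00) (evalP_scale _ _ htau).
set b := (\row_l _ : 'rV[R]_n).
have := tau0 b => /eqP; rewrite mulf_eq0 => /orP[|/eqP ->]; last by rewrite mulr0.
have -> : dotp (map_mx intr k) b = (u 0 0)^-1 * dotp (map_mx intr k) w.
  by rewrite -dotpZr; congr dotp; apply/rowP => l; rewrite !mxE mulrC.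
rewrite subr_eq0; move: kw; rewrite ler_norml => /andP[k1 k2].
have kw0 : 0 < dotp (map_mx intr k) w by move: k1; set x := dotp _ _; lra.
have kw1 : dotp (map_mx intr k) w < 1 by move: k2; set x := dotp _ _; lra.
(* Dividing by [u 0 0 >= 1] leaves [k . b] strictly between 0 and 1, hence not an integer. *)
have /expi_neq1 /negbTE -> // : 0 < (u 0 0)^-1 * dotp (map_mx intr k) w < 1.
have u0 : 0 < u 0 0 by exact: lt_le_trans u1.
rewrite mulr_gt0 ?invr_gt0//= ltr_pdivrMl// mulr1; exact: lt_le_trans u1.
Qed.

End solution_identity.

Section L2norm_estimates.
Context (R : realType) (n d : nat).
Local Notation P := (mpoly n.+1 R[i]).

Lemma L2norm_small dd (T : measurableType dd) (mu : {measure set T -> \bar R})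
    (D : set T) (mD : measurable D) (F : T -> P) (C e B : R) :
  (forall z, D z -> F z \is ishomog1 d mdeg) ->
  (forall al, csq mu D (fun z => mcoeff al (F z))) ->
  (forall i, nsq mu D (fun z => mcoeff (mon (i : 'I_(nmons n d))) (F z)) <= e) -> 0 <= C -> 0 <= B ->
  (forall p : P, p \is ishomog1 d mdeg ->
    normP p ^+ 2 <= C * \sum_(i < nmons n d) sqn (mcoeff (mon i) p)) ->
  C * ((nmons n d)%:R * e) <= B ^+ 2 -> (L2norm mu D F <= B%:E)%E.
Proof.
move=> hF cF Fe C0 B0 HC HB; apply: (@L2norm_le R n d _ T mu D mD F hF C) => //.
apply: le_trans HB; rewrite ler_wpM2l//.
have -> : (nmons n d)%:R * e = \sum_(i < nmons n d) e by rewrite sumr_const card_ord mulr_natl.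
by apply: ler_sum => i _; exact: Fe.
Qed.

Lemma L2norm_ge0 dd (T : measurableType dd) (mu : {measure set T -> \bar R}) (D : set T) (F : T -> P) :
  (0 <= L2norm mu D F)%E.
Proof. exact: Lnorm_ge0. Qed.

Lemma H1norm_ge0 (g : R * 'rV[R]_n -> P) Dg : (0 <= H1norm g Dg)%E.
Proof. exact: poweR_ge0. Qed.

Let sqre_le (x : \bar R) (r : R) : (0 <= x)%E -> (x <= r%:E)%E -> (x ^+ 2 <= (r ^+ 2)%:E)%E.
Proof.
case: x => [x| |]//; rewrite ?leye_eq// => x0 xr; rewrite expe2 -EFinM lee_fin.
by move: x0 xr; rewrite !lee_fin; nra.
Qed.

(** There are [n.+2] squares; the factor [n.+2] is a crude bound for the square root of their
    number. *)
Lemma H1norm_le (g : R * 'rV[R]_n -> P) Dg (r : R) : 0 <= r ->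
  (L2norm (volM R n) (@cell R n) g <= r%:E)%E ->
  (forall i, L2norm (volM R n) (@cell R n) (Dg i) <= r%:E)%E ->
  (H1norm g Dg <= (n.+2%:R * r)%:E)%E.
Proof.
move=> r0 hg hD; rewrite /H1norm sqrt_poweR ?mulr_ge0//; last first.
  by apply: adde_ge0; [exact: sqre_ge0|apply: sume_ge0 => i _; exact: sqre_ge0].
apply: (@le_trans _ _ ((r ^+ 2)%:E + \sum_(i < n.+1) (r ^+ 2)%:E)%E).
  apply: leeD; first by apply: sqre_le => //; exact: L2norm_ge0.
  by apply: lee_sum => i _; apply: sqre_le => //; exact: L2norm_ge0.
rewrite sumEFin -EFinD lee_fin sumr_const card_ord -[r ^+ 2 *+ n.+1]mulr_natl.
have n2 : (n.+2%:R : R) = 1 + n.+1%:R by rewrite -natr1 addrC.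
have n1 : 0 <= n.+1%:R :> R by [].
rewrite exprMn n2; move: n1; move: (n.+1%:R : R) => N N0.
have := mulr_ge0 (mulr_ge0 N0 N0) (sqr_ge0 r); have := mulr_ge0 N0 (sqr_ge0 r); nra.
Qed.

Lemma L2norm_le_H1norm (g : R * 'rV[R]_n -> P) Dg :
  (L2norm (volM R n) (@cell R n) g <= H1norm g Dg)%E /\
  (forall i, L2norm (volM R n) (@cell R n) (Dg i) <= H1norm g Dg)%E.
Proof.
have mono (x y : \bar R) : (0 <= x)%E -> (x ^+ 2 <= y)%E -> (x <= y `^ 2^-1)%E.
  have py : (+oo `^ 2^-1 = +oo :> \bar R)%E.
    by rewrite /poweR (_ : (2^-1 == 0 :> R) = false)//; apply/negbTE; rewrite invr_eq0.
  case: y => [y| |]; last 2 first.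
  - by move=> _ _; rewrite py leey.
  - by move=> x0; rewrite leeNy_eq => /eqP xy; have := sqre_ge0 x; rewrite xy.
  case: x => [x| |] x0; [|by rewrite expe2 mulyy leye_eq|by []].
  rewrite expe2 -EFinM lee_fin => xy; rewrite lee_fin in x0.
  have y0 : 0 <= y by apply: le_trans xy; exact: mulr_ge0.
  rewrite poweR_EFin powR12_sqrt// lee_fin -[x]ger0_norm// -sqrtr_sqr ler_wsqrtr//.
split=> [|i]; (apply: mono; first exact: L2norm_ge0).
  by rewrite leeDl// sume_ge0// => i _; exact: sqre_ge0.
rewrite (bigD1 i)//= addeCA leeDl// adde_ge0 ?sqre_ge0// sume_ge0// => l _.
exact: sqre_ge0.
Qed.

Lemma cvg_ereal0 (X : nat -> \bar R) (c : R) :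
  (forall N, (0 <= X N)%E) -> (forall N, (X N <= (c * N.+1%:R^-1)%:E)%E) -> X @ \oo --> 0%E.
Proof.
move=> X0 Xc; apply: (@squeeze_cvge _ _ _ _ (fun=> 0%E) _ (fun N => (c * N.+1%:R^-1)%:E)).
- by apply: nearW => N; rewrite X0 Xc.
- exact: cvg_cst.
- apply: cvg_EFin; first exact: nearW.
  rewrite -[X in _ --> X](mulr0 c); apply: cvgM; first exact: cvg_cst.
  exact: cvg_harmonic.
Qed.

(** The order is the integer [m - 1] in the statement and the natural number [m.-1] in the
    construction. They differ at [m = 0], where the field must vanish instead of being a
    constant. *)
Lemma homogP_pred k (p : P) : (k = 0%N -> p = 0) -> p \is ishomog1 k.-1 mdeg -> Defs.homogP (k%:Z - 1) p.
Proof.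
case: k => [|k] h0 hp; first by rewrite /= h0.
by rewrite (_ : k.+1%:Z - 1 = k%:Z)//; lia.
Qed.

Lemma homog_of_homogP k (p : P) : Defs.homogP (k%:Z - 1) p -> p \is ishomog1 k.-1 mdeg.
Proof.
case: k => [|k]; first by move=> /= /eqP ->; exact: rpred0.
by rewrite (_ : k.+1%:Z - 1 = k%:Z)//; lia.
Qed.

End L2norm_estimates.

(** * Smooth approximants with small boundary values *)

Section approximants.
Context (R : realType) (n m : nat).
Local Notation P := (mpoly n.+1 R[i]).
Local Notation mV := (measurableTypeR R * 'rV[R]_n)%type.
Local Notation cellM := (@cell R n : set mV).
Local Notation cubeM := (@cube R n).
Local Notation lebn := (lebesgue_rV R n).
Local Notation vol := (volM R n).
Local Notation idx := (int * 'rV[int]_n)%type.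
Local Notation chs := (@chiZ R n).
Local Notation cq := (fun k : 'rV[int]_n => chiq (map_mx intr k) : 'rV[R]_n -> R[i]).
Variables (K : finType) (c : K -> idx -> R[i]) (F : K -> mV -> R[i]).
Variables (J : finType) (a : J -> idx -> R[i]).
Hypothesis Fc : forall x, fsum_cvg vol cellM chs (c x) (F x).
Hypothesis a0 : forall j k, forall eps : R, 0 < eps ->
  exists M0, forall M, (M0 <= M)%N -> sqn (slice_sum (a j) M k) <= eps.

Lemma approximants (eps : R) : 0 < eps -> exists A : seq idx,
  [/\ forall x, nsq vol cellM (fun z => F x z - fsum chs (c x) A z) <= eps,
      forall j, nsq lebn cubeM (fun y => fsum chs (a j) A (0, y)) <= eps &
      forall j, nsq lebn cubeM (fun y => fsum chs (a j) A (1, y)) <= eps].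
Proof.
move=> e0; have /boolp.choice[B HB] x : exists A0 : seq idx, forall A, uniq A -> {subset A0 <= A} ->
    nsq vol cellM (fun z => F x z - fsum chs (c x) A z) <= eps.
  by have [A0 _ h] := Fc x e0; exists A0.
pose A0 := flatten [seq B x | x <- enum K].
have [M0 HM0] := sub_rect A0.
(* The set [L] of frequencies on the torus is fixed before [M], so that the boundary norm is a sum
   of finitely many slices and no uniformity in [k] is needed. *)
pose L := undup [seq ka.2 | ka <- A0]; have uL : uniq L by exact: undup_uniq.
pose e1 := eps / (size L).+1%:R; have e10 : 0 < e1 by rewrite divr_gt0.
have /boolp.choice[M1 HM1] (jk : J * 'rV[int]_n) : exists M1, forall M, (M1 <= M)%N ->
    sqn (slice_sum (a jk.1) M jk.2) <= e1 by exact: a0.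
(* [M] is large enough for the rectangle to contain [A0] and for every slice sum over [L] to be
   below [eps / (size L).+1]. *)
pose M := maxn M0 (\max_(k <- L) \max_j M1 (j, k)).
have bnd j : nsq lebn cubeM (fsum cq (slice_sum (a j) M) L) <= eps.
  rewrite (nsq_fsum (@mcube R n) (fun k => csq_chiq _) (@orthonormal_chiq R n))//.
  apply: (@le_trans _ _ (\sum_(k <- L) e1)).
    rewrite !big_seq; apply: ler_sum => k kL; apply: (HM1 (j, k)).
    apply: leq_trans (leq_maxr _ _).
    apply: leq_trans (@leq_bigmax_seq _ L xpredT (fun k => \max_j M1 (j, k))%N k kL isT).
    exact: (leq_bigmax (F := fun j => M1 (j, k))).
  have -> : \sum_(k <- L) e1 = (size L)%:R * e1.
    by rewrite big_const_seq count_predT iter_addr_0 mulr_natl.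
  by rewrite /e1 mulrA ler_pdivrMr// mulrC ler_pM2l// ler_nat.
have rE b j : (b == 0) || (b == 1) -> nsq lebn cubeM (fun y => fsum chs (a j) (rect M L) (b, y)) <= eps.
  move=> hb; apply: le_trans (bnd j); rewrite le_eqVlt; apply/orP; left; apply/eqP.
  by apply: eq_nsq => y _; case/orP: hb => /eqP ->; rewrite !fsum_rect_boundary.
exists (rect M L); split => [x|j|j]; last 2 first.
- by apply: rE; rewrite eqxx.
- by apply: rE; rewrite eqxx orbT.
apply: HB; first exact: rect_uniq.
move=> ka kaB; apply: HM0; first exact: leq_maxl.
  by move=> k; rewrite mem_undup.
by apply/flattenP; exists (B x) => //; apply/mapP; exists x => //; rewrite mem_enum.
Qed.

End approximants.

(** * Integration by parts for fields with zero trace *)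

Section converse.
Context (R : realType) (n m : nat).
Local Notation P := (mpoly n.+1 R[i]).
Local Notation mV := (measurableTypeR R * 'rV[R]_n)%type.
Local Notation cellM := (@cell R n : set mV).
Local Notation cubeM := (@cube R n).
Local Notation lebn := (lebesgue_rV R n).
Local Notation vol := (volM R n).
Local Notation mC := (@mcell R n).

Lemma L2_csq dd (T : measurableType dd) (mu : {measure set T -> \bar R}) (D : set T)
    (F : T -> P) d : measurable D -> (forall z, D z -> F z \is ishomog1 d mdeg) -> L2 mu D F ->
  forall al, csq mu D (fun z => mcoeff al (F z)).
Proof.
move=> mD hF [mF Foo]; have [C C0 HC] := normP_lower R n d.
have fn : L2norm mu D F = (fine (L2norm mu D F))%:E.
  by rewrite fineK// ge0_fin_numE// L2norm_ge0.
have b0 : 0 <= fine (L2norm mu D F) by apply: fine_ge0; exact: L2norm_ge0.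
move=> al; have := @le_L2norm R n d _ T mu D mD F hF C _ C0 mF HC b0.
by rewrite -fn => /(_ (lexx _) al)[].
Qed.

Variables (g : R * 'rV[R]_n -> P) (Dg : 'I_n.+1 -> R * 'rV[R]_n -> P).
Hypothesis gH : H10 (m%:Z - 1) g Dg.

Let hg z : cell z -> g z \is ishomog1 m.-1 mdeg.
Proof. by case: gH => -[[h _ _] _ _] _ /cell_slab cz; exact: (homog_of_homogP (h z cz)). Qed.

Let hDg i z : cell z -> Dg i z \is ishomog1 m.-1 mdeg.
Proof. by case: gH => -[_ h _] _ /cell_slab cz; have [hD _ _] := h i; exact: (homog_of_homogP (hD z cz)). Qed.

Lemma H10_csq : (forall al, csq vol cellM (fun z => mcoeff al (g z))) /\
  (forall i al, csq vol cellM (fun z => mcoeff al (Dg i z))).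
Proof.
case: gH => -[[_ _ Lg] hD _] _; split; first exact: (L2_csq mC hg Lg).
by move=> i; have [_ _ LD] := hD i; exact: (L2_csq mC (fun z cz => hDg i cz) LD).
Qed.

(** Characters are not test functions, since they do not vanish near the boundary. The formula is
    proved for the smooth fields of [has_trace], where the boundary term is controlled by their
    boundary norms, and these tend to 0. *)
Lemma H10_by_parts i al s (k : 'rV[int]_n) :
  cintegral vol cellM (fun z => mcoeff al (Dg i z) * chi s (map_mx intr k) z) =
  - (tpi * (cons_rV (s, map_mx intr k) 0 i)%:C%C *
     cintegral vol cellM (fun z => mcoeff al (g z) * chi s (map_mx intr k) z)).
Proof.
have [cg cD] := H10_csq; have [_ [u [Du [su cu H1 t0 t1]]]] := gH.
pose ch : mV -> R[i] := chi s (map_mx intr k); set x := tpi * _.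
have [C C0 HC] := normP_lower R n m.-1.
have hu N z : u N z \is ishomog1 m.-1 mdeg by have [h _ _] := su N; exact: (homog_of_homogP (h z)).
have C1u N be j : cC1dir (coordM R j) (fun z => mcoeff be (u N z)) (fun z => mcoeff be (Du N j z)).
  have [_ _ sm] := su N; have [s1 s2] := sm be.
  have [d1 d2] := conj (C1dir_Ck1 (coordM R j) (s1 1%N)) (C1dir_Ck1 (coordM R j) (s2 1%N)).
  by split; [move: d1|move: d2]; congr C1dir; apply/funext => z; rewrite cu.
have pu N be : periodic_on setT (fun z => mcoeff be (u N z)).
  by have [_ p _] := su N; move=> z q _; rewrite p.
have csu N be : csq vol cellM (fun z => mcoeff be (u N z)) := cC1dir_csq (C1u N be 0).
have csDu N be j : csq vol cellM (fun z => mcoeff be (Du N j z)) := cC1dir_csq_diff (C1u N be j).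
(* Coefficients of a wrong degree vanish identically in the smooth field, hence so do their
   derivatives. *)
have hDu N j z : Du N j z \is ishomog1 m.-1 mdeg.
  apply/dhomogP => be; rewrite mcoeff_msupp; apply: contraNeq => dbe.
  have C1 := C1u N be j; apply/eqP.
  rewrite (cC1dir_derive z C1).
  have E0 : (fun z => mcoeff be (u N z)) = fun=> 0 by apply/funext => y; exact: mcoeff_homog0 (hu N y) dbe.
  rewrite (_ : (fun z => cRe (mcoeff be (u N z))) = fun=> 0); last first.
    by apply/funext => y; rewrite (congr1 (@^~ y) E0).
  rewrite (_ : (fun z => cIm (mcoeff be (u N z))) = fun=> 0); last first.
    by apply/funext => y; rewrite (congr1 (@^~ y) E0).
  by rewrite derive_cst.
have slice N be b : cmeas cubeM (fun y => mcoeff be (u N (b, y))).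
  have [[c1 _ _] [c2 _ _]] := C1u N be 0.
  split; apply: measurable_funTS.
    exact: (measurableT_comp (continuous_measurable_RrV c1) (measurable_pair1 (b : measurableTypeR R))).
  exact: (measurableT_comp (continuous_measurable_RrV c2) (measurable_pair1 (b : measurableTypeR R))).
apply/eqP; rewrite -addr_eq0; apply/eqP.
(* Squared errors: [2 eps] for each of the two pairings and [8 eps] for the boundary term; the
   doublings in [sqnD_le] give [4 + 2 (4 sqn x + 16)]. *)
apply: (@sqn_small_eq0 R _ (36 + 8 * sqn x)) => eps e0.
pose r := Num.sqrt (eps / (C + 1)).
have C1 : 0 < C + 1 by rewrite ltr_wpDl.
have r0 : 0 < r by rewrite sqrtr_gt0 divr_gt0.
have Cr : C * r ^+ 2 <= eps.
  have E : r ^+ 2 = eps / (C + 1) by rewrite sqr_sqrtr// divr_ge0// ltW.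
  by rewrite E mulrA ler_pdivrMr//; nra.
have small (X : nat -> \bar R) : X @ \oo --> 0%E -> \forall N \near \oo, (X N <= r%:E)%E.
  move=> X0; have : \forall y \near (0%E : \bar R), (y <= r%:E)%E.
    apply/nbhs_EFin; apply: filterS (nbhs0_lt r0) => y hy.
    by rewrite lee_fin (le_trans (ler_norm y))// ltW.
  exact: X0.
have : \forall N \near \oo, [/\ (H1norm (u N \- g)%R (fun i => (Du N i \- Dg i)%R) <= r%:E)%E,
   (L2norm lebn cubeM (fun y => (u N (0, y) - 0)%R) <= r%:E)%E &
   (L2norm lebn cubeM (fun y => (u N (1, y) - 0)%R) <= r%:E)%E].
  by apply: filterS3 (small _ H1) (small _ t0) (small _ t1) => N.
move=> /filter_ex[N [HN N0 N1]].
have [L2g L2D] := @L2norm_le_H1norm R n (u N \- g) (fun i => Du N i \- Dg i).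
have rr0 := ltW r0.
have ng : nsq vol cellM (fun z => mcoeff al (g z) - mcoeff al (u N z)) <= eps.
  have hug z : cell z -> (u N \- g) z \is ishomog1 m.-1 mdeg by move=> cz; apply: rpredB; [exact: hu|exact: hg].
  have mug be : cmeas cellM (fun z => mcoeff be ((u N \- g) z)).
    by under eq_fun do rewrite mcoeffB; apply: cmeasB; [exact: (csu N be).1|exact: (cg be).1].
  have [_] := le_L2norm mC hug C0 mug HC rr0 (le_trans L2g HN) al.
  move=> /le_trans /(_ Cr); apply: le_trans; rewrite le_eqVlt; apply/orP; left; apply/eqP.
  by apply: eq_Rintegral => z _; rewrite mcoeffB -sqnN opprB.
have nD : nsq vol cellM (fun z => mcoeff al (Dg i z) - mcoeff al (Du N i z)) <= eps.
  have hug z : cell z -> (Du N i \- Dg i) z \is ishomog1 m.-1 mdeg.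
    by move=> cz; apply: rpredB; [exact: hDu|exact: hDg].
  have mug be : cmeas cellM (fun z => mcoeff be ((Du N i \- Dg i) z)).
    by under eq_fun do rewrite mcoeffB; apply: cmeasB; [exact: (csDu N be i).1|exact: (cD i be).1].
  have [_] := le_L2norm mC hug C0 mug HC rr0 (le_trans (L2D i) HN) al.
  move=> /le_trans /(_ Cr); apply: le_trans; rewrite le_eqVlt; apply/orP; left; apply/eqP.
  by apply: eq_Rintegral => z _; rewrite mcoeffB -sqnN opprB.
have nT (b : R) : (L2norm lebn cubeM (fun y => (u N (b, y) - 0)%R) <= r%:E)%E ->
    csq lebn cubeM (fun y => mcoeff al (u N (b, y))) /\ nsq lebn cubeM (fun y => mcoeff al (u N (b, y))) <= eps.
  under [X in L2norm _ _ X]eq_fun do rewrite subr0.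
  move=> hb; have [h1 h2] := le_L2norm (@mcube R n) (fun y _ => hu N (b, y)) C0 (fun be => slice N be b) HC rr0 hb al.
  by split => //; exact: le_trans h2 Cr.
have [c0 n0] := nT 0 N0; have [c1 n1] := nT 1 N1.
have cch : csq vol cellM ch by exact: csq_chi.
have C1ch : cC1dir (coordM R i) ch (fun z => x * ch z) := cC1dir_chi i s (map_mx intr k).
have cxch : csq vol cellM (fun z => x * ch z) by apply: csqZ => //; exact: mC.
have cchb (b : R) : csq lebn cubeM (fun y => ch (b, y)).
  apply: (csq_bounded (@mcube R n) (lebesgue_cube_lty R n) (B := 1)); last by move=> y _; rewrite /ch sqn_chi.
  rewrite (_ : (fun y => ch (b, y)) = fun y => expi (2 * pi * s * b) * chiq (map_mx intr k) y)//.
  by apply: cmeasM; [split; exact: measurable_cst|exact: cmeas_chiq].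
have nchb (b : R) : nsq lebn cubeM (fun y => ch (b, y)) = 1.
  rewrite /nsq; under eq_Rintegral => z _ do rewrite /ch sqn_chi.
  by rewrite Rintegral_cst; [rewrite [X in _ * fine X](lebesgue_cube R n) mulr1|exact: mcube].
pose bd := cintegral vol cellM (fun z => mcoeff al (Du N i z) * ch z) +
   cintegral vol cellM (fun z => mcoeff al (u N z) * (x * ch z)).
have bdE : sqn bd <= 8 * eps.
  have prod := cC1dirM (C1u N al i) C1ch.
  rewrite /bd -cintD; [|exact: mC|apply: csq_mul => //; exact: mC|apply: csq_mul => //; exact: mC].
  move: prod; case: (unliftP 0 i) => [j ->|->] prod.
    rewrite (cintegral_dy prod) ?sqn0 ?mulr_ge0 ?ltW// => z q _.
    by rewrite pu// /ch chi_periodic.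
  rewrite (cintegral_dx prod).
  rewrite cintB; [|exact: mcube|apply: csq_mul => //; exact: mcube|apply: csq_mul => //; exact: mcube].
  have b1 := cauchy_schwarz (@mcube R n) c1 (cchb 1); have b0 := cauchy_schwarz (@mcube R n) c0 (cchb 0).
  rewrite nchb mulr1 in b1; rewrite nchb mulr1 in b0.
  apply: le_trans (sqnB_le _ _) _; lra.
have p1 := cint_close mC (cD i al) (csDu N al i) cch.
have p2 := cint_close mC (cg al) (csu N al) cch.
rewrite nsq_chi1 mulr1 in p1; rewrite nsq_chi1 mulr1 in p2.
have xE : cintegral vol cellM (fun z => mcoeff al (u N z) * (x * ch z)) =
    x * cintegral vol cellM (fun z => mcoeff al (u N z) * ch z).
  rewrite -cintZ; [|exact: mC|by apply: csq_mul => //; exact: mC].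
  by apply: eq_cint => z _; rewrite mulrCA.
rewrite /bd xE in bdE.
pose a1 := cintegral vol cellM (fun z => mcoeff al (Dg i z) * ch z).
pose a2 := cintegral vol cellM (fun z => mcoeff al (g z) * ch z).
change (sqn (a1 + x * a2) <= (36 + 8 * sqn x) * eps).
change (is_true (sqn (a1 - cintegral vol cellM (fun z => mcoeff al (Du N i z) * ch z)) <= 2 * nsq vol cellM (fun z => mcoeff al (Dg i z) - mcoeff al (Du N i z)))) in p1.
change (is_true (sqn (a2 - cintegral vol cellM (fun z => mcoeff al (u N z) * ch z)) <= 2 * nsq vol cellM (fun z => mcoeff al (g z) - mcoeff al (u N z)))) in p2.
move: p1 p2 bdE; set w1 := cintegral _ _ _; set w2 := cintegral _ _ _ => p1 p2 p3.
rewrite (_ : a1 + x * a2 = (a1 - w1) + (x * (a2 - w2) + (w1 + x * w2))); last by ring.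
apply: le_trans (sqnD_le _ _) _.
have := sqnD_le (x * (a2 - w2)) (w1 + x * w2); rewrite sqnM => p4.
have := sqn_ge0 x; nra.
Qed.

End converse.

(** * The two implications *)

Section xray_implies_decomposition.
Context (R : realType) (n m : nat).
Local Notation P := (mpoly n.+1 R[i]).
Local Notation mV := (measurableTypeR R * 'rV[R]_n)%type.
Local Notation mR := (measurableTypeR R).
Local Notation leb := (@lebesgue_measure R).
Local Notation cellM := (@cell R n : set mV).
Local Notation cubeM := (@cube R n).
Local Notation I01 := (`[0, 1]%classic : set mR).
Local Notation vol := (volM R n).
Local Notation idx := (int * 'rV[int]_n)%type.
Local Notation mC := (@mcell R n).
Local Notation chs := (@chiZ R n).
Local Notation volty := (volM_cell_lty R n).
Local Notation ortho := (@orthonormal_chiZ R n).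
Local Notation nm d := (nmons n d)%:R.
Local Notation qb := (qbound R n m).

Variable f : R * 'rV[R]_n -> P.
Hypothesis Lf : L2_tensor m%:Z f.
Hypothesis xf : xray_vanishes f.
Variables Ch Cg : R.
Hypotheses (Ch0 : 0 <= Ch) (Cg0 : 0 <= Cg).
Hypothesis HCh : forall p : P, p \is ishomog1 m mdeg ->
    normP p ^+ 2 <= Ch * \sum_(i < nmons n m) sqn (mcoeff (mon i) p).
Hypothesis HCg : forall p : P, p \is ishomog1 m.-1 mdeg ->
    normP p ^+ 2 <= Cg * \sum_(i < nmons n m.-1) sqn (mcoeff (mon i) p).

Let hf z : slab z -> f z \is ishomog1 m mdeg.
Proof. by case: Lf => h _ _ sz; exact: (h z sz). Qed.

Let pf : periodic_on (@slab R n) f.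
Proof. by case: Lf. Qed.

Let cf al : csq vol cellM (fun z => mcoeff al (f z)).
Proof. by case: Lf => _ _ L; apply: (L2_csq mC _ L) => z /cell_slab; exact: hf. Qed.

Let W := energy m f.

Let fhat0_energy al (A : seq int) : uniq A -> \sum_(s <- A) sqn (fhat_c f al (s, 0)) <= W.
Proof.
move=> uA; have [/(@monP n m)[i ->]|ad] := eqVneq (mdeg al) m; first exact: (fhat0_le cf).
rewrite big1 ?energy_ge0// => s _.
by rewrite -(mcoeff_fhat hf) (mcoeff_homog0 (fhat_homog _ _ _) ad) sqn0.
Qed.

Lemma xray_decomposition : exists (h : R -> P) (g : R * 'rV[R]_n -> P)
    (Dg : 'I_n.+1 -> R * 'rV[R]_n -> P),
  [/\ L2_profile m%:Z h, H10 (m%:Z - 1) g Dg,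
    forall (v : R) (w : 'rV[R]_n),
      cintegral leb `[0, 1] (fun x => evalP (h x) (cons_rV (v, w))) = 0,
    {ae vol, forall z, cell z -> f z = h z.1 + symd Dg z} &
    (L2norm leb `[0%R, 1%R] h <= (Num.sqrt (Ch * (nm m * W)))%:E)%E /\
    (H1norm g Dg <= (n.+2%:R * Num.sqrt (Cg * (nm m.-1 * (qb * W))))%:E)%E].
Proof.
have W0 : 0 <= W by exact: energy_ge0.
have qW0 : 0 <= qb * W by rewrite mulr_ge0// (le_trans ler01 (qbound_ge1 R n m)).
have /boolp.choice[q hq] := fhat_division hf pf cf xf.
have hqh ka : q ka \is ishomog1 m.-1 mdeg by have [] := hq ka.
have hq0 ka : ka.2 = 0 -> q ka = 0 by have [_ _ h _ _] := hq ka.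
have hfq ka : ka.2 != 0 -> forall al, fhat_c f al ka =
  \sum_(i | (0 < al i)%N) (kappa R ka 0 i)%:C%C * mcoeff (mnm_sub al (mnm1 i)) (q ka) by have [_ _ _ h _] := hq ka.
have /boolp.choice[G hG] be := fourier_series mC volty (@csq_chiZ R n) ortho (fun A uA => gcoef_le cf hq be uA).
have /boolp.choice[DG' hDG'] (ib : 'I_n.+1 * multinom n.+1) :=
  fourier_series mC volty (@csq_chiZ R n) ortho (fun A uA => dfreq_gcoef_le cf hq ib.1 ib.2 uA).
pose DG i be := DG' (i, be).
have /boolp.choice[H hH] al := fourier_series (@mI01 R) (leb_I01_lty R) (fun s : int => csq_expi_lin s%:~R)
  (@orthonormal_expi R n) (fhat0_energy al).
have cG be : csq vol cellM (G be) by have [] := hG be.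
have cDG i be : csq vol cellM (DG i be) by have [] := hDG' (i, be).
have cH al : csq leb I01 (H al) by have [] := hH al.
have Gc be : fsum_cvg vol cellM chs (gcoef q be) (G be) by have [] := hG be.
have DGc i be : fsum_cvg vol cellM chs (dfreq i (gcoef q be)) (DG i be) by have [] := hDG' (i, be).
have Hc al : fsum_cvg leb I01 (fun (s : int) (x : mR) => expi (2 * pi * s%:~R * x) : R[i])
    (fun s => fhat_c f al (s, 0)) (H al) by have [] := hH al.
(* [m = 0] is singled out because [m.-1 = 0] would allow constants where the field of order [-1]
   must be 0. *)
have gz be : (m = 0%N \/ mdeg be != m.-1) -> forall ka, gcoef q be ka = 0.
  case=> [m0|db] ka; rewrite /gcoef.
    by have [_ h _ _ _] := hq ka; rewrite h// mcoeff0 mulr0.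
  by rewrite (mcoeff_homog0 (hqh ka) db) mulr0.
have Gz be : (m = 0%N \/ mdeg be != m.-1) -> G be = fun=> 0.
  by move=> hb; have [_ _ _] := hG be; apply; exact: gz.
have DGz i be : (m = 0%N \/ mdeg be != m.-1) -> DG i be = fun=> 0.
  by move=> hb; have [_ _ _] := hDG' (i, be); apply => ka; rewrite /dfreq gz// mulr0.
have G0 be : mdeg be != m.-1 -> G be = fun=> 0 by move=> db; apply: Gz; right.
have DG0 i be : mdeg be != m.-1 -> DG i be = fun=> 0 by move=> db; apply: DGz; right.
have H0 al : mdeg al != m -> H al = fun=> 0.
  move=> ad; have [_ _ _] := hH al; apply => s.
  by rewrite -(mcoeff_fhat hf) (mcoeff_homog0 (fhat_homog _ _ _) ad).
pose tor : mV -> mV := @torus R n.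
have torK (z : mV) : cellM z -> tor z = z by move=> cz; exact: torus_cell.
pose g (z : mV) := fld m.-1 G (tor z); pose Dg i (z : mV) := fld m.-1 (DG i) (tor z).
have Lg : L2 vol cellM g /\ (L2norm vol cellM g <= (Num.sqrt (Cg * (nm m.-1 * (qb * W))))%:E)%E.
  by apply: (fld_L2 mC G0 torK cG _ Cg0 qW0 HCg) => be; have [] := hG be.
have LDg i : L2 vol cellM (Dg i) /\ (L2norm vol cellM (Dg i) <= (Num.sqrt (Cg * (nm m.-1 * (qb * W))))%:E)%E.
  by apply: (fld_L2 mC (DG0 i) torK (cDG i) _ Cg0 qW0 HCg) => be; have [] := hDG' (i, be).
have Lh : L2 leb I01 (fld m H) /\ (L2norm leb I01 (fld m H) <= (Num.sqrt (Ch * (nm m * W)))%:E)%E.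
  by apply: (fld_L2 (@mI01 R) (phi := id) H0 _ cH _ Ch0 W0 HCh) => // al; have [] := hH al.
have m0fld (K : multinom n.+1 -> mV -> R[i]) z : (forall be, m = 0%N -> K be = fun=> 0) ->
    m = 0%N -> fld m.-1 K z = 0.
  by move=> K0 m0; rewrite /fld big1// => j _; rewrite K0// scale0r.
have Tg : L2_tensor (m%:Z - 1) g.
  split; last exact: Lg.1.
    move=> z _; apply: homogP_pred; last exact: fld_homog.
    by apply: m0fld => be m0; apply: Gz; left.
  by move=> z k _; rewrite /g /tor torus_periodic.
have TDg i : L2_tensor (m%:Z - 1) (Dg i).
  split; last exact: (LDg i).1.
    move=> z _; apply: homogP_pred; last exact: fld_homog.
    by apply: m0fld => be m0; apply: DGz; left.
  by move=> z k _; rewrite /Dg /tor torus_periodic.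
exists (fld m H), g, Dg; split.
- split; last exact: Lh.1.
  by move=> x _; exact: fld_homog.
- split.
    split => // i phi tphi al.
    transitivity (cintegral vol cellM (fun z => G al z * ('D_(coordM R i) phi z)%:C%C)).
      by apply: eq_cint => z /set_mem cz; rewrite /g torK// (mcoeff_fld G0).
    rewrite (weak_partial_fourier (cG al) (cDG i al) (Gc al) (DGc i al) tphi); congr (- _).
    by apply: eq_cint => z /set_mem cz; rewrite /Dg torK// (mcoeff_fld (DG0 i)).
  (* A single finite family: [None] stands for [g] and [Some i] for its derivative [i], for each
     monomial. The approximants then share one index set. *)
  pose cc (x : option 'I_n.+1 * 'I_(nmons n m.-1)) :=
    if x.1 is Some i then dfreq i (gcoef q (mon x.2)) else gcoef q (mon x.2).
  pose FF (x : option 'I_n.+1 * 'I_(nmons n m.-1)) : mV -> R[i] :=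
    if x.1 is Some i then DG i (mon x.2) else G (mon x.2).
  have FFc x : fsum_cvg vol cellM chs (cc x) (FF x) by case: x => [[i|] j]; [exact: DGc|exact: Gc].
  have slice0 (j : 'I_(nmons n m.-1)) (k : 'rV[int]_n) (eps : R) : 0 < eps ->
      exists M0, forall M, (M0 <= M)%N -> sqn (slice_sum (gcoef q (mon j)) M k) <= eps.
    move=> e0; have [k0|k0] := eqVneq k 0.
      exists 0%N => M _; rewrite /slice_sum big1 ?sqn0 ?ltW// => s _.
      by rewrite /gcoef hq0// mcoeff0 mulr0.
    exact: (slice_sum_cvg0 hf cf hq0 hfq cDG DGc cH Hc H0 DG0 pf xf hqh cG Gc (mon j) k0 e0).
  (* Chosen so that the coefficient errors give a field norm of at most [1 / N.+1]; the added 1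
     keeps the denominator positive. *)
  pose ep (N : nat) : R := N.+1%:R^-1 ^+ 2 / (Cg * nm m.-1 + 1).
  have Cn0 : 0 <= Cg * nm m.-1 by exact: mulr_ge0.
  have Cn1 : 0 < Cg * nm m.-1 + 1 by rewrite ltr_wpDl.
  have ep0 N : 0 < ep N by rewrite divr_gt0// exprn_gt0// invr_gt0.
  have epB N : Cg * (nm m.-1 * ep N) <= N.+1%:R^-1 ^+ 2.
    rewrite mulrA /ep mulrA ler_pdivrMr// mulrC ler_wpM2l ?sqr_ge0//.
    by rewrite lerDl.
  have /boolp.choice[A hA] N := approximants FFc slice0 (ep0 N).
  pose uc N be := fsum chs (gcoef q be) (A N).
  pose Duc N i be := fsum chs (dfreq i (gcoef q be)) (A N).
  have uc0 N be : (m = 0%N \/ mdeg be != m.-1) -> uc N be = fun=> 0.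
    move=> hb; apply/funext => z; rewrite /uc /fsum big1// => ka _.
    by rewrite gz// mul0r.
  have Duc0 N i be : (m = 0%N \/ mdeg be != m.-1) -> Duc N i be = fun=> 0.
    move=> hb; apply/funext => z; rewrite /Duc /fsum big1// => ka _.
    by rewrite /dfreq gz// mulr0 mul0r.
  have uc0' N be : mdeg be != m.-1 -> uc N be = fun=> 0 by move=> db; apply: uc0; right.
  have Duc0' N i be : mdeg be != m.-1 -> Duc N i be = fun=> 0 by move=> db; apply: Duc0; right.
  pose u N (z : mV) := fld m.-1 (uc N) z; pose Du N i (z : mV) := fld m.-1 (Duc N i) z.
  have inv0 N : 0 <= N.+1%:R^-1 :> R by rewrite invr_ge0.
  have csqu N be : csq vol cellM (uc N be) := csq_fsumZ _ _.
  have csqDu N i be : csq vol cellM (Duc N i be) := csq_fsumZ _ _.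
  have diffL2 N (K K' : multinom n.+1 -> mV -> R[i]) :
      (forall be, mdeg be != m.-1 -> K be = fun=> 0) -> (forall be, mdeg be != m.-1 -> K' be = fun=> 0) ->
      (forall be, csq vol cellM (K be)) -> (forall be, csq vol cellM (K' be)) ->
      (forall j : 'I_(nmons n m.-1), nsq vol cellM (fun z => K' (mon j) z - K (mon j) z) <= ep N) ->
      (L2norm vol cellM (fun z => (fld m.-1 K z - fld m.-1 K' (tor z))%R) <= (N.+1%:R^-1)%:E)%E.
    move=> K0 K0' cK cK' KK'.
    have E be : {in cellM, (fun z => K be z - K' be z) =1
        (fun z => mcoeff be (fld m.-1 K z - fld m.-1 K' (tor z)))}.
      by move=> z /set_mem cz; rewrite mcoeffB (mcoeff_fld K0) (mcoeff_fld K0') torK.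
    apply: (@L2norm_small R n m.-1 _ _ _ _ mC _ Cg (ep N)) => //.
    - by move=> z _; apply: rpredB; exact: fld_homog.
    - by move=> al; apply: (eq_csq mC (E al)); apply: csqB; [exact: mC|exact: cK|exact: cK'].
    - move=> j; apply: le_trans (KK' j); rewrite le_eqVlt; apply/orP; left; apply/eqP.
      transitivity (nsq vol cellM (fun z => K (mon j) z - K' (mon j) z)).
        by apply: eq_nsq => z zc; exact/esym/E.
      by apply: eq_Rintegral => z _; rewrite -sqnN opprB.
  have bdL2 N (b : R) : (forall j : 'I_(nmons n m.-1),
      nsq (lebesgue_rV R n) cubeM (fun y => fsum chs (gcoef q (mon j)) (A N) (b, y)) <= ep N) ->
      (forall be, csq (lebesgue_rV R n) cubeM (fun y => uc N be (b, y))) ->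
      (L2norm (lebesgue_rV R n) cubeM (fun y => (u N (b, y) - 0)%R) <= (N.+1%:R^-1)%:E)%E.
    move=> hb cb; apply: (@L2norm_small R n m.-1 _ _ _ _ (@mcube R n) _ Cg (ep N)) => //.
    - by move=> y _; rewrite subr0; exact: fld_homog.
    - by move=> al; apply: (eq_csq (@mcube R n) _ (cb al)) => y _; rewrite subr0 (mcoeff_fld (uc0' N)).
    - move=> j; apply: le_trans (hb j); rewrite le_eqVlt; apply/orP; left; apply/eqP.
      by apply: eq_nsq => y _; rewrite subr0 (mcoeff_fld (uc0' N)).
  have cslice N b be : csq (lebesgue_rV R n) cubeM (fun y => uc N be (b, y)).
    apply: csq_sum; first exact: mcube.
    move=> ka _; apply: csqZ; first exact: mcube.
    apply: (csq_bounded (@mcube R n) (lebesgue_cube_lty R n) (B := 1)); last by move=> y _; rewrite sqn_chi.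
    rewrite (_ : (fun y => chs ka (b, y)) =
      fun y => expi (2 * pi * ka.1%:~R * b) * chiq (map_mx intr ka.2) y)//.
    by apply: cmeasM; [split; exact: measurable_cst|exact: cmeas_chiq].
  exists u, Du; split.
  + move=> N; split.
    * move=> z; apply: homogP_pred; last exact: fld_homog.
      by apply: m0fld => be m0; apply: uc0; left.
    * move=> z k _; apply: eq_bigr => j _; congr (_ *: _).
      exact: (@fsum_periodic R n _ _ z k Logic.I).
    * move=> al; have [s1 s2] := fsum_smooth (gcoef q al) (A N).
      by split; [move: s1|move: s2]; congr smooth; apply/funext => z; rewrite (mcoeff_fld (uc0' N)).
  + move=> N i z al; rewrite (mcoeff_fld (Duc0' N i)) /Duc.
    rewrite (cC1dir_derive z (cC1dir_fsum i (gcoef q al) (A N))).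
    have E1 : (fun z => cRe (mcoeff al (u N z))) = fun z => cRe (fsum chs (gcoef q al) (A N) z).
      by apply/funext => y; rewrite (mcoeff_fld (uc0' N)).
    have E2 : (fun z => cIm (mcoeff al (u N z))) = fun z => cIm (fsum chs (gcoef q al) (A N) z).
      by apply/funext => y; rewrite (mcoeff_fld (uc0' N)).
    by rewrite E1 E2.
  + apply: (@cvg_ereal0 R _ n.+2%:R) => N; first exact: H1norm_ge0.
    have [h1 _ _] := hA N; apply: H1norm_le => //.
      exact: (diffL2 N (uc N) G (uc0' N) G0 (csqu N) cG (fun j => h1 (None, j))).
    move=> i; exact: (diffL2 N (Duc N i) (DG i) (Duc0' N i) (DG0 i) (csqDu N i) (cDG i) (fun j => h1 (Some i, j))).
  + apply: (@cvg_ereal0 R _ 1) => N; first exact: L2norm_ge0.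
    by have [_ h0 _] := hA N; rewrite mul1r; apply: bdL2.
  + apply: (@cvg_ereal0 R _ 1) => N; first exact: L2norm_ge0.
    by have [_ _ h0] := hA N; rewrite mul1r; apply: bdL2.
(* The mean of each coefficient of [h] is its Fourier coefficient at frequency 0, which is an entry
   of [fhat (0, 0) = 0]. *)
- move=> v w.
  have cHf al : csq leb I01 (fun x => mcoeff al (fld m H x)).
    by apply: (eq_csq (@mI01 R) _ (cH al)) => x _; rewrite (mcoeff_fld H0).
  have c1 : csq leb I01 (fun=> 1 : R[i]).
    by apply: (csq_bounded (@mI01 R) (leb_I01_lty R) (B := 1)) => // x _; rewrite /sqn /= expr1n expr0n addr0.
  have := cint_evalP (@mI01 R) (fun x _ => fld_homog m H x) cHf (cons_rV (v, w)) c1.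
  rewrite (eq_cint (G := fun x : mR => evalP (fld m H x) (cons_rV (v, w)))); last by move=> x _; rewrite mulr1.
  move=> ->; rewrite big1// => i _.
  rewrite (eq_cint (G := fun x : mR => H (mon i) x * conjc (expi (2 * pi * (0 : int)%:~R * x)))); last first.
    by move=> x _; rewrite (mcoeff_fld H0) mulr0 mul0r expi0 rmorph1.
  rewrite (fourier_coefficient (@mI01 R) (fun s : int => csq_expi_lin s%:~R)
     (@orthonormal_expi R n) 0 (cH (mon i)) (Hc (mon i))).
  by rewrite -(mcoeff_fhat hf) (fhat00 hf pf cf xf) mcoeff0 mulr0.
- have AF : Filter (almost_everywhere vol) by exact: (ae_filter_ringOfSetsType vol).
  have fE : {ae vol, forall z, cellM z -> f z = fld m H z.1 + symd Dg z}.
    have SE := solution_equation cf hq0 hfq cDG DGc cH Hc H0 DG0.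
    apply: (@filterS _ _ AF _ _ _ SE) => z hz cz.
    by rewrite (hz cz) /symd /Dg torK.
  exact: fE.
- split; first exact: Lh.2.
  by apply: H1norm_le; [exact: sqrtr_ge0|exact: Lg.2|move=> i; exact: (LDg i).2].
Qed.

End xray_implies_decomposition.

Section decomposition_implies_xray.
Context (R : realType) (n m : nat).
Local Notation P := (mpoly n.+1 R[i]).
Local Notation mV := (measurableTypeR R * 'rV[R]_n)%type.
Local Notation mR := (measurableTypeR R).
Local Notation leb := (@lebesgue_measure R).
Local Notation cellM := (@cell R n : set mV).
Local Notation I01 := (`[0, 1]%classic : set mR).
Local Notation vol := (volM R n).
Local Notation mC := (@mcell R n).

(** Each pairing of [f (.; 1, b)] with [chi (- k . b) k] splits into a part from [h], which is zero
    by its mean or by orthogonality, and a part from [dg], where integration by parts gives the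
    derivative of the character in the direction [(1, b)], along which it is constant. *)
Lemma decomposition_xray (f : R * 'rV[R]_n -> P) (h : R -> P) (g : R * 'rV[R]_n -> P)
    (Dg : 'I_n.+1 -> R * 'rV[R]_n -> P) : L2_tensor m%:Z f ->
  L2_profile m%:Z h -> H10 (m%:Z - 1) g Dg ->
  (forall (v : R) (w : 'rV[R]_n),
      cintegral leb `[0, 1] (fun x => evalP (h x) (cons_rV (v, w))) = 0) ->
  {ae vol, forall z, cell z -> f z = h z.1 + symd Dg z} -> xray_vanishes f.
Proof.
move=> [hf pf L2f] [hh L2h] gH h0 fE.
have hf' z : slab z -> f z \is ishomog1 m mdeg by move=> sz; exact: (hf z sz).
have hh' x : I01 x -> h x \is ishomog1 m mdeg by move=> x01; apply: (hh x).
have cf : forall al, csq vol cellM (fun z => mcoeff al (f z)).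
  by apply: (L2_csq mC _ L2f) => z /cell_slab; exact: hf'.
have ch : forall al, csq leb I01 (fun x => mcoeff al (h x)) := L2_csq (@mI01 R) hh' L2h.
have [cg cD] := H10_csq gH.
have hg z : cellM z -> g z \is ishomog1 m.-1 mdeg.
  by case: gH => -[[hg _ _] _ _] _ /cell_slab sz; exact: (homog_of_homogP (hg z sz)).
have hD i z : cellM z -> Dg i z \is ishomog1 m.-1 mdeg.
  by case: gH => -[_ hD _] _ /cell_slab sz; have [h1 _ _] := hD i; exact: (homog_of_homogP (h1 z sz)).
apply/(xray_vanishes_pairing hf' pf cf) => b k.
set u := cons_rV _; set s := - dotp _ _.
have cchi : csq vol cellM (chi s (map_mx intr k)) by exact: csq_chi.
have eh : csq leb I01 (fun x : mR => evalP (h x) u) := csq_evalP_field (@mI01 R) hh' ch u.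
have ehz : csq vol cellM (fun z => evalP (h z.1) u) := csq_fst n eh.
have eD i : csq vol cellM (fun z => evalP (Dg i z) u) := csq_evalP_field mC (hD i) (cD i) u.
have ef : csq vol cellM (fun z => evalP (f z) u).
  by apply: (csq_evalP_field mC (d := m) _ cf) => z /cell_slab; exact: hf'.
have iD i : cintble vol cellM (fun z => evalP (Dg i z) u * chi s (map_mx intr k) z).
  by apply: csq_mul => //; exact: mC.
transitivity (cintegral vol cellM (fun z => evalP (h z.1) u * chi s (map_mx intr k) z +
    \sum_i (u 0 i)%:C%C * (evalP (Dg i z) u * chi s (map_mx intr k) z))).
  apply: (ae_eq_cint mC).
  - by apply: cmeasM; [exact: ef.1|exact: cchi.1].
  - apply: cmeasD; first by apply: cmeasM; [exact: ehz.1|exact: cchi.1].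
    by apply: cmeas_sum => i _; apply: cmeasM; [exact: cmeas_cst|apply: cmeasM; [exact: (eD i).1|exact: cchi.1]].
  have AF : Filter (almost_everywhere vol) by exact: (ae_filter_ringOfSetsType vol).
  apply: (@filterS _ _ AF _ _ _ fE) => z hz cz; rewrite (hz cz) evalPD evalP_symd mulrDl mulr_suml; congr (_ + _).
  by apply: eq_bigr => i _; rewrite mulrA.
rewrite cintD; [|exact: mC|by apply: csq_mul => //; exact: mC|]; last first.
  by apply: cintble_sum; [exact: mC|move=> i _; apply: cintbleZ => //; exact: mC].
rewrite (cint_fst_chiJ s k eh) cint_sum; [|exact: mC|by move=> i _; apply: cintbleZ => //; exact: mC].
(* For [k = 0] the frequency [s] is 0 too, and the zero mean of [h] at [(1, b)] applies. *)
have -> : cintegral leb I01 (fun x => evalP (h x) u * expi (2 * pi * s * x)) * (k == 0)%:R = 0.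
  have [k0|_] := eqVneq k 0; last by rewrite mulr0.
  rewrite mulr1 -(h0 1 b); apply: eq_cint => x _.
  rewrite /s k0 (_ : dotp _ b = 0) ?oppr0 ?mulr0 ?mul0r ?expi0 ?mulr1//.
  by rewrite /dotp big1// => j _; rewrite !mxE mul0r.
rewrite add0r.
pose Z := \sum_(j < nmons n m.-1) evalP (mpolyX R[i] (mon j)) u *
  cintegral vol cellM (fun z => mcoeff (mon j) (g z) * chi s (map_mx intr k) z).
transitivity (\sum_i (u 0 i)%:C%C * (- (tpi * (cons_rV (s, map_mx intr k) 0 i)%:C%C * Z))).
  apply: eq_bigr => i _; rewrite cintZ//; last exact: mC.
  congr (_ * _); rewrite (cint_evalP mC (hD i) (cD i) _ cchi) /Z mulr_sumr -sumrN.
  by apply: eq_bigr => j _; rewrite (H10_by_parts gH); ring.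
(* The last factor is [s + k . b], which is 0 by the choice of [s]. *)
transitivity (- (tpi * Z) * (\sum_i (cons_rV (s, map_mx intr k) 0 i * u 0 i))%:C%C).
  by rewrite rmorph_sum/= mulr_sumr; apply: eq_bigr => i _; rewrite rmorphM/=; ring.
rewrite big_ord_recl /u !cons_rV0 mulr1.
rewrite (_ : \sum_i _ = dotp (map_mx intr k) b); last first.
  by apply: eq_bigr => j _; rewrite !cons_rVS.
by rewrite /s addNr mulr0.
Qed.

End decomposition_implies_xray.

Theorem theorem2 (R : realType) (m n : nat) :
  exists C : R, forall f : R * 'rV[R]_n -> mpoly n.+1 R[i],
    L2_tensor m%:Z f ->
    (xray_vanishes f <->
     exists (h : R -> mpoly n.+1 R[i]) (g : R * 'rV[R]_n -> mpoly n.+1 R[i])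
       (Dg : 'I_n.+1 -> R * 'rV[R]_n -> mpoly n.+1 R[i]),
       [/\ L2_profile m%:Z h,
           H10 (m%:Z - 1) g Dg,
           forall (v : R) (w : 'rV[R]_n),
             cintegral (@lebesgue_measure R) `[0, 1]
               (fun x => evalP (h x) (cons_rV (v, w))) = 0,
           {ae volM R n, forall z, cell z -> f z = h z.1 + symd Dg z} &
           (L2norm (@lebesgue_measure R) `[0%R, 1%R] h + H1norm g Dg
              <= C%:E * L2norm (volM R n) (@cell R n) f)%E]).
Proof.
have [C2 C20 HC2] := normP_lower R n m.
have [Ch Ch0 HCh] := normP_upper R n m; have [Cg Cg0 HCg] := normP_upper R n m.-1.
(* [K] compares the energy of the coefficients of [f] with its squared L^2 norm; [a] and [b] then
   bound [h] and each of [g] and its derivatives, and [n.+2] comes from [H1norm_le]. *)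
pose K := (nmons n m)%:R * C2; have K0 : 0 <= K by exact: mulr_ge0.
have qb0 : 0 <= qbound R n m := le_trans ler01 (qbound_ge1 R n m).
pose a := Num.sqrt (Ch * ((nmons n m)%:R * K)).
pose b := Num.sqrt (Cg * ((nmons n m.-1)%:R * (qbound R n m * K))).
exists (a + n.+2%:R * b) => f Lf; split => [xf|[h [g [Dg [Lh gH h0 fE _]]]]]; last first.
  exact: decomposition_xray Lf Lh gH h0 fE.
have [h [g [Dg [Lh gH h0 fE [nh ng]]]]] := xray_decomposition Lf xf Ch0 Cg0 HCh HCg.
exists h, g, Dg; split => //.
have [hf _ [mf foo]] := Lf.
have N0 : 0 <= fine (L2norm (volM R n) (@cell R n) f) by apply: fine_ge0; exact: L2norm_ge0.
have NE : L2norm (volM R n) (@cell R n) f = (fine (L2norm (volM R n) (@cell R n) f))%:E.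
  by rewrite fineK// ge0_fin_numE// L2norm_ge0.
rewrite NE; move: N0 NE; move: (fine _) => N N0 NE.
have hf' z : cell z -> f z \is ishomog1 m mdeg by move=> /cell_slab sz; exact: (hf z sz).
have WN : energy m f <= K * N ^+ 2.
  have -> : K * N ^+ 2 = \sum_(i < nmons n m) C2 * N ^+ 2.
    by rewrite sumr_const card_ord -mulr_natl mulrA.
  apply: ler_sum => i _.
  have LN : (L2norm (volM R n) (@cell R n) f <= N%:E)%E by rewrite NE.
  exact: (@le_L2norm R n m _ _ _ _ (@mcell R n) f hf' C2 N C20 mf HC2 N0 LN (mon i)).2.
have sN (x : R) : 0 <= x -> Num.sqrt x * N = Num.sqrt (x * N ^+ 2).
  by move=> x0; rewrite sqrtrM// sqrtr_sqr ger0_norm.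
have la : Num.sqrt (Ch * ((nmons n m)%:R * energy m f)) <= a * N.
  rewrite /a sN ?mulr_ge0// ler_wsqrtr// -!mulrA ler_wpM2l// ler_wpM2l//.
  by rewrite mulrA.
have lb : Num.sqrt (Cg * ((nmons n m.-1)%:R * (qbound R n m * energy m f))) <= b * N.
  rewrite /b sN ?mulr_ge0// ler_wsqrtr// -!mulrA ler_wpM2l// ler_wpM2l// ler_wpM2l ?exprn_ge0//.
  by rewrite ler_wpM2l ?exprn_ge0// mulrA.
apply: (@le_trans _ _ ((a * N)%:E + (n.+2%:R * (b * N))%:E)%E).
  by apply: leeD; [apply: le_trans nh _|apply: le_trans ng _]; rewrite lee_fin// ler_wpM2l.
rewrite -EFinD -EFinM lee_fin le_eqVlt; apply/orP; left; apply/eqP; ring.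
Qed.
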